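(* In the setting described in the context, with $\tilde{\mathcal{L}}_\omega=\rho_\omega^{-1}\mathcal{L}_\omega$ and $\xi>0$ as defined there: for every $\epsilon>0$ there exists a finite measurable function $C_\epsilon:\Omega\to(0,\infty)$ such that for $\mathbb{P}$-a.e. $\omega\in\Omega$, all $n\ge1$ and all $f\in BV(X_{\theta^{-n}\omega})$, $$\operatorname{var}(\tilde{\mathcal{L}}^n_{\theta^{-n}\omega}f)\le C_\epsilon(\omega)e^{-(\xi-\epsilon)n}\operatorname{var}(f)+C_\epsilon(\omega)F_\omega(\tilde{\mathcal{L}}^n_{\theta^{-n}\omega}|f|).$$
   Context: **Base and maps.** $(\Omega,\mathcal{F},\mathbb{P})$ is a complete probability space, $\theta:\Omega\to\Omega$ an invertible ergodic $\mathbb{P}$-preserving map. $I\subset\mathbb{R}$ is a compact interval with Borel $\sigma$-algebra $\mathcal{B}$. For each $\omega$, $T_\omega:I\to I$ is surjective and there is a countable partition $\mathcal{Z}^*_\omega=\{Z_{\omega,i}\}_{i\ge1}$ of $I$, up to a Lebesgue-null set, into intervals on each of which $T_\omega$ is continuous, strictly monotone and extends to a homeomorphism onto its image, an interval. The skew product $T(\omega,x)=(\theta\omega,T_\omega x)$ is $\mathcal{F}\otimes\mathcal{B}$-measurable; $T^n_\omega:=T_{\theta^{n-1}\omega}\circ\cdots\circ T_\omega$, and $T_\omega^{-n}$ denotes preimage under $T_\omega^n$. $D_\omega$ is the set of endpoints of the $Z_{\omega,i}$; the singular set $\bigcup_{k\ge0}T_\omega^{-k}(D_{\theta^k\omega})$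 is assumed dense in $I$, and $X_\omega$ is its complement in $I$, so $T_\omega(X_\omega)\subseteq X_{\theta\omega}$. $X:=\bigcup_\omega\{\omega\}\times X_\omega$. $\mathcal{Z}^1_\omega:=\{Z\cap X_\omega:Z\in\mathcal{Z}^*_\omega\}$, $\mathcal{Z}^n_\omega:=\bigvee_{i=0}^{n-1}T_\omega^{-i}(\mathcal{Z}^1_{\theta^i\omega})$; these partitions are assumed generating. **Functions.** $\operatorname{var}_A(f)$ is the total variation of $f$ on $A$ (supremum over finite increasing sequences of points of $A$); $\operatorname{var}(f)$ is the variation on the whole domain; $B(\cdot)$, $BV(\cdot)$ are the bounded functions and the bounded functions of bounded variation; $\|f\|_{BV}=\|f\|_\infty+\operatorname{var}(f)$. **Potential.** $\varphi_c:\Omega\times I\to\mathbb{R}\cup\{-\infty\}$, $\varphi_{\omega,c}=\varphi_c(\omega,\cdot)$, $g^1_{\omega,c}:=e^{\varphi_{\omega,c}}$, $g^n_{\omega,c}:=\exp\big(\sum_{i=0}^{n-1}\varphi_{\theta^i\omega,c}\circ T_\omega^i\big)$. It is *summable*: $\inf_Z g^1_{\omega,c}>0$ for all $Z\in\mathcal{Z}^1_\omega$; $g^1_{\omega,c}\in BV(I)$; $S^1_\omega:=\sum_{Z\in\mathcal{Z}^*_\omega}\sup_Z g^1_{\omega,c}<\infty$. The closed operator is $\mathcal{L}_{\omega,c}f(x)=\sum_{y\in T_\omega^{-1}x}f(y)g^1_{\omega,c}(y)$, $x\in X_{\theta\omega}$, with iterates $\mathcal{L}^n_{\omega,c}f(x)=\sum_{y\in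 T_\omega^{-n}x}f(y)g^n_{\omega,c}(y)$. Assume $\log S^1_\omega,\ \log\inf\mathcal{L}_{\omega,c}\mathbb{1}_{X_\omega}\in L^1(\mathbb{P})$. Also $\varphi_c$ is *contracting for the closed system*: for $\mathbb{P}$-a.e. $\omega$, $\lim\frac1n\log\|g^n_{\omega,c}\|_\infty<\lim\frac1n\log\inf\mathcal{L}^n_{\omega,c}\mathbb{1}_{X_\omega}$, and for some $N\ge1$, $-\infty<\int\log\|g^N_{\omega,c}\|_\infty d\mathbb{P}-\int\log\inf\mathcal{L}^N_{\omega,c}\mathbb{1}_{X_\omega}d\mathbb{P}<0$. Under these assumptions it is known that there is a unique random probability measure $\nu_c=\{\nu_{\omega,c}\}$ (measurable family of Borel probability measures on $I$) with $\nu_{\theta\omega,c}(\mathcal{L}_{\omega,c}f)=\lambda_{\omega,c}\nu_{\omega,c}(f)$ for $f\in BV(I)$, $\lambda_{\omega,c}:=\nu_{\theta\omega,c}(\mathcal{L}_{\omega,c}\mathbb{1})>0$. **Hole and open operator.** $H\subseteq X$ is $\mathcal{F}\otimes\mathcal{B}$-measurable with $\nu_c(H)\nu_c(X\setminus H)\ne0$ and fibers $H_\omega\subseteq X_\omega$. $J_\omega:=X_\omega\setminus H_\omega$, $\mathbb{1}_\omega:=\mathbb{1}_{J_\omega}$. Survivor sets: $K_{\omega,n}:=\bigcap_{i=0}^nT_\omega^{-i}(J_{\theta^i\omega})$, $K_{\omega,\infty}:=\bigcap_nK_{\omega,n}$; $\bigcup_\omega\{\omega\}\times K_{\omega,\infty}$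 is assumed nonempty. The open operator is $\mathcal{L}_\omega f:=\mathcal{L}_{\omega,c}(f\mathbb{1}_\omega)$, so $\mathcal{L}^n_\omega f=\mathcal{L}^n_{\omega,c}(f\mathbb{1}_{K_{\omega,n-1}})$; $g^n_\omega:=g^n_{\omega,c}|_{K_{\omega,n-1}}$. $S_{\omega,n}:=\{x\in X_\omega:\mathcal{L}^n_{\theta^{-n}\omega}\mathbb{1}_{\theta^{-n}\omega}(x)\ne0\}$ is decreasing in $n$, with limit $S_{\omega,\infty}$, assumed nonempty. **Functional.** $F_\omega(f):=\lim_{n\to\infty}\inf_{x\in S_{\theta^n\omega,n}}\frac{\mathcal{L}^n_\omega f(x)}{\mathcal{L}^n_\omega\mathbb{1}_\omega(x)}$ for $f\in BV(X_\omega)$ (an increasing limit). $\rho_\omega:=F_{\theta\omega}(\mathcal{L}_\omega\mathbb{1}_\omega)>0$, $\rho^n_\omega:=\prod_{i=0}^{n-1}\rho_{\theta^i\omega}$; $\log\rho_\omega\in L^1(\mathbb{P})$. **Partitions and contraction for the open system.** Fix $a\ge0$, $b\ge1$. For each $\omega,n$ take a finite partition $\mathcal{U}=\{U_i\}$ of $I$ with $\operatorname{var}_{U_i}(g^n_\omega)\le a\|g^n_\omega\|_\infty$ and $\sum_{Z\in\mathcal{Z}^n_\omega,\,Z\cap U_i\ne\varnothing}\sup_{Z\cap U_i}g^n_\omega\le b\|g^n_\omega\|_\infty$ for all $i$; let $\tilde{\mathcal{U}}$ be the coarsest finite partition among those finer than $\mathcal{Z}^n_\omega$ and $\mathcal{U}$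 whose elements are either disjoint from or contained in $K_{\omega,n-1}$. Put $\mathcal{Z}^n_{\omega,g}:=\{U\in\tilde{\mathcal{U}}:U\subseteq K_{\omega,n-1},F_\omega(\mathbb{1}_U)>0\}$, $\mathcal{Z}^n_{\omega,b}:=\{U\in\tilde{\mathcal{U}}:U\subseteq K_{\omega,n-1},F_\omega(\mathbb{1}_U)=0\}$. Assume for every $n$ there is $\delta_{\omega,n}>0$ with $\log\delta_{\omega,n}\in L^1(\mathbb{P})$ and $\inf_{U\in\mathcal{Z}^n_{\omega,g}}F_\omega(\mathbb{1}_U)\ge2\delta_{\omega,n}$. Two elements of $\mathcal{Z}^n_{\omega,g}\cup\mathcal{Z}^n_{\omega,b}$ are contiguous if they share a boundary point or are separated by a connected component of $\bigcup_{i=0}^{n-1}T_\omega^{-i}(H_{\theta^i\omega})$; $\eta^n_\omega$ is the maximal number of contiguous elements in $\mathcal{Z}^n_{\omega,b}$, and $\log\eta^n_\omega\in L^1(\mathbb{P})$ is assumed. Finally $\varphi_c$ is *contracting for the open system*: for $\mathbb{P}$-a.e. $\omega$, $\lim\frac1n\log\|g^n_\omega\|_\infty+\limsup\frac1n\log\eta^n_\omega<\lim\frac1n\log\inf_{S_{\theta^n\omega,\infty}}\mathcal{L}^n_\omega\mathbb{1}_\omega$. **Constants.** $\tilde{\mathcal{L}}_\omega:=\rho_\omega^{-1}\mathcal{L}_\omega$, $\tilde{\mathcal{L}}^n_\omega=(\rho^n_\omega)^{-1}\mathcal{L}^n_\omega$. $C_{\omega,n}:=(\rho^n_\omega)^{-1}\big(a+2b+1+(2a+4b)\eta^n_\omega\big)\|g^n_\omega\|_\infty$.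 $N_c\ge1$ is the smallest integer $n\geq 1$ with $-\infty<\int_\Omega\log C_{\omega,n}\,d\mathbb{P}<0$, and $\xi:=-\frac1{N_c}\int_\Omega\log C_{\omega,N_c}\,d\mathbb{P}(\omega)>0$. *)

(* Defs.v *)
From HB Require Import structures.
From mathcomp Require Import all_boot all_order all_algebra.
From mathcomp Require Import all_classical all_reals all_analysis.

Set Implicit Arguments.
Unset Strict Implicit.
Unset Printing Implicit Defensive.

Import Order.TTheory GRing.Theory Num.Theory.
Import numFieldNormedType.Exports.

Local Open Scope classical_set_scope.
Local Open Scope ring_scope.

(* Functions on a subset A of the interval (such as X_w) are represented by
   total functions R -> R of which only the values on A are ever used. *)
Section functions_on_subsets.
Context {R : realType}.
Implicit Types (A W : set R) (f g : R -> R).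

Definition var A f : \bar R :=
  ereal_sup [set (\sum_(0 <= i < (size s).-1) `|f s`_i.+1 - f s`_i|)%:E
            | s in [set s : seq R |
                     sorted <%R s /\ forall x, x \in s -> A x]].

Definition bounded_on A f := exists M : R, forall x, A x -> `|f x| <= M.

Definition BV A f := bounded_on A f /\ (var A f < +oo)%E.

(* These suprema and infima are only taken of functions that are bounded on A;
   supremum_on set0 f = 0, so empty sets do not contribute to sums of suprema
   of nonnegative functions. *)
Definition supremum_on A f : R := sup [set f x | x in A].
Definition infimum_on A f : R := inf [set f x | x in A].
Definition supnorm A f : R := supremum_on A (fun x => `|f x|).

(* Sum of an absolutely summable real family over a (countable) set. *)
Definition set_sum A f : R :=
  fine (\esum_(y in A) (f^\+ y)%:E) - fine (\esum_(y in A) (f^\- y)%:E).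

(* Traces on Y of the intervals of R. *)
Definition interval_in (Y W : set R) :=
  W `<=` Y /\
  forall x y z, W x -> W y -> Y z -> x <= z -> z <= y -> W z.

Definition interval_partition (Y : set R) (V : set (set R)) :=
  partition V id Y /\ forall W, V W -> interval_in Y W.

Definition finer (V V' : set (set R)) :=
  forall W, V W -> exists2 W', V' W' & W `<=` W'.

Definition strictly_monotone_on A f :=
  {in A &, {homo f : x y / x < y}} \/ {in A &, {homo f : x y /~ x < y}}.

(* h is an extension of f to the closure of A, with continuous inverse k on its
   image. *)
Definition extends_to_homeo A f :=
  exists h k : R -> R,
    [/\ {in A, h =1 f},
        {within closure A, continuous h},
        {within h @` closure A, continuous k} &
        {in closure A, cancel h k}].

End functions_on_subsets.

Record open_system (R : realType) d (Omega : measurableType d) := OpenSystem {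
  theta : Omega -> Omega;
  thetaV : Omega -> Omega;  (* the inverse of theta *)
  lo : R;
  hi : R;  (* the interval is [lo, hi] *)
  Tw : Omega -> R -> R;
  (* Zstar w i are the elements of Z*_w; empty sets pad a finite partition. *)
  Zstar : Omega -> nat -> set R;
  phi : Omega -> R -> \bar R;
  hole : set (Omega * R) }.

Section open_system_definitions.
Context {R : realType} {d : measure_display} {Omega : measurableType d}.
Variable s : open_system R Omega.
Implicit Types (w : Omega) (n i k : nat) (f : R -> R).

Definition Ivl : set R := `[lo s, hi s]%classic.

Definition thetan n w : Omega := iter n (theta s) w.
Definition thetaVn n w : Omega := iter n (thetaV s) w.

Fixpoint Tn w n (x : R) : R :=
  if n is n'.+1 then Tw s (thetan n' w) (Tn w n' x) else x.

Definition Dw w : set R :=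
  [set x | exists2 i, Zstar s w i !=set0 &
             x = inf (Zstar s w i) \/ x = sup (Zstar s w i)].

Definition singular w : set R :=
  [set x | Ivl x /\ exists k, Dw (thetan k w) (Tn w k x)].

Definition Xw w : set R := Ivl `\` singular w.

Definition Z1 w : set (set R) :=
  [set A | A !=set0 /\ exists i, A = Zstar s w i `&` Xw w].

(* The join of the pulled back partitions T_w^{-i} Z^1_{theta^i w}, i < n. *)
Definition Zn w n : set (set R) :=
  [set A | A !=set0 /\
     exists2 B : nat -> set R, (forall i, (i < n)%N -> Z1 (thetan i w) (B i)) &
       A = [set x | Xw w x /\ forall i, (i < n)%N -> B i (Tn w i x)]].

Definition g1 w (x : R) : R := fine (expeR (phi s w x)).

Definition gcn w n (x : R) : R :=
  fine (expeR (\sum_(i < n) phi s (thetan i w) (Tn w i x))%E).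

Definition S1 w : \bar R :=
  (\sum_(0 <= i <oo) (supremum_on (Zstar s w i) (g1 w))%:E)%E.

(* Functions in the domain of the operator live on X_w, hence so does the sum
   over the preimages. *)
Definition Lc w f (x : R) : R :=
  set_sum [set y | Xw w y /\ Tw s w y = x] (fun y => f y * g1 w y).

Fixpoint Lcn w n f : R -> R :=
  if n is n'.+1 then Lc (thetan n' w) (Lcn w n' f) else f.

Definition Hw w : set R := xsection (hole s) w.
Definition Jw w : set R := Xw w `\` Hw w.

Definition Kw w n : set R :=
  [set x | Xw w x /\ forall i, (i <= n)%N -> Jw (thetan i w) (Tn w i x)].

Definition Kinf w : set R := \bigcap_n Kw w n.

Definition Lopen w f : R -> R := Lc w (fun y => f y * \1_(Jw w) y).

Fixpoint Ln w n f : R -> R :=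
  if n is n'.+1 then Lopen (thetan n' w) (Ln w n' f) else f.

Definition Sw w n : set R :=
  [set x | Xw w x /\ Ln (thetaVn n w) n (\1_(Jw (thetaVn n w))) x != 0].

Definition Sinf w : set R := \bigcap_n Sw w n.

Definition Fw w f : R :=
  limn (fun n => infimum_on (Sw (thetan n w) n)
                   (fun x => Ln w n f x / Ln w n (\1_(Jw w)) x)).

Definition rho w : R := Fw (theta s w) (Lopen w (\1_(Jw w))).

Definition rhon w n : R := \prod_(i < n) rho (thetan i w).

Definition Ltn w n f : R -> R := fun x => (rhon w n)^-1 * Ln w n f x.

(* For n >= 1, g^n_w is the restriction of gcn w n to K w n.-1; its norm and
   variations only involve points of that set. *)
Definition open_gnorm w n : R := supnorm (Kw w n.-1) (gcn w n).

Definition admissible_partition (a b : R) w n (V : set (set R)) :=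
  [/\ finite_set V, interval_partition Ivl V &
      forall A, V A ->
        (var (A `&` Kw w n.-1) (gcn w n) <= (a * open_gnorm w n)%:E)%E /\
        (\esum_(Z in [set Z | Zn w n Z /\ Z `&` A !=set0])
           (supremum_on (Z `&` A `&` Kw w n.-1) (gcn w n))%:E
         <= (b * open_gnorm w n)%:E)%E].

Definition adapted_partition w n (V W : set (set R)) :=
  [/\ finite_set W, interval_partition (Xw w) W,
      finer W (Zn w n), finer W V &
      forall A, W A -> A `<=` Kw w n.-1 \/ A `&` Kw w n.-1 = set0].

Definition coarsest_adapted_partition w n (V W : set (set R)) :=
  adapted_partition w n V W /\
  forall W', adapted_partition w n V W' -> finer W' W.

Definition Zg (Ut : set (set R)) w n : set (set R) :=
  [set A | [/\ Ut A, A `<=` Kw w n.-1 & 0 < Fw w (\1_A)]].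

Definition Zb (Ut : set (set R)) w n : set (set R) :=
  [set A | [/\ Ut A, A `<=` Kw w n.-1 & Fw w (\1_A) = 0]].

Definition hole_preimages w n : set R :=
  [set x | Xw w x /\ exists2 i, (i < n)%N & Hw (thetan i w) (Tn w i x)].

(* As X_w has dense complement, connectedness is understood in terms of
   intervals of X_w: the components of a set are the maximal intervals of X_w
   that it contains. *)
Definition is_component w (O C : set R) :=
  [/\ C !=set0, C `<=` O, interval_in (Xw w) C &
      forall C', interval_in (Xw w) C' -> C' `<=` O -> C `<=` C' -> C' = C].

(* A lies to the left of B, and the two intervals have an endpoint in common. *)
Definition share_endpoint (A B : set R) :=
  (forall x y, A x -> B y -> x < y) /\ sup A = inf B.

(* Contiguity, with A the element on the left. *)
Definition contiguous w n (A B : set R) :=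
  share_endpoint A B \/
  exists C, [/\ is_component w (hole_preimages w n) C,
                share_endpoint A C & share_endpoint C B].

Definition contiguous_chain w n (Q : set (set R)) k (c : nat -> set R) :=
  (forall i, (i < k)%N -> Q (c i)) /\
  (forall i, (i.+1 < k)%N -> contiguous w n (c i) (c i.+1)).

(* Maximal number of contiguous elements of Z^n_{w,b}; 0 if there is none. *)
Definition eta (Ut : set (set R)) w n : R :=
  sup [set k%:R | k in [set k : nat |
         exists c, contiguous_chain w n (Zb Ut w n) k c]].

Definition Cst (a b : R) (Ut : Omega -> nat -> set (set R)) w n : R :=
  (rhon w n)^-1 * (a + 2 * b + 1 + (2 * a + 4 * b) * eta (Ut w n) w n)
  * open_gnorm w n.

End open_system_definitions.

(* Logarithms are extended real-valued (lne 0 = -oo) wherever the argument may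
   vanish. *)
Section standing_assumptions.
Context {R : realType} {d : measure_display} {Omega : measurableType d}.
Variables (P : probability Omega R) (s : open_system R Omega).

Definition in_L1 (h : Omega -> \bar R) := P.-integrable [set: Omega] h.

Record base_assumptions : Prop := {
  base_complete : measure_is_complete P;
  base_thetaK : cancel (theta s) (thetaV s);
  base_thetaVK : cancel (thetaV s) (theta s);
  base_measurable : measurable_fun setT (theta s);
  base_measurableV : measurable_fun setT (thetaV s);
  base_preserving : forall A, measurable A -> P (theta s @^-1` A) = P A;
  base_ergodic : forall A, measurable A -> theta s @^-1` A = A ->
    P A = 0%E \/ P A = 1%E }.

Record map_assumptions : Prop := {
  map_interval : lo s < hi s;
  map_surjective : forall w, Tw s w @` Ivl s = Ivl s;
  map_skew_measurable :
    measurable_fun ([set: Omega] `*` Ivl s)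
      (fun p : Omega * R => (theta s p.1, Tw s p.1 p.2));
  map_branch_interval : forall w i,
    is_interval (Zstar s w i) /\ Zstar s w i `<=` Ivl s;
  map_branch_disjoint : forall w, trivIset setT (Zstar s w);
  map_branch_cover : forall w,
    lebesgue_measure (Ivl s `\` \bigcup_i Zstar s w i) = 0%E;
  map_branch_monotone : forall w i,
    [/\ {within Zstar s w i, continuous (Tw s w)},
        strictly_monotone_on (Zstar s w i) (Tw s w),
        extends_to_homeo (Zstar s w i) (Tw s w) &
        is_interval (Tw s w @` Zstar s w i)];
  map_singular_dense : forall w, Ivl s `<=` closure (singular s w);
  (* Z^1_w is a partition of X_w: the null set left out by Z*_w is disjoint
     from X_w. *)
  map_Z1_cover : forall w, Xw s w `<=` \bigcup_i Zstar s w i;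
  map_generating : forall w,
    <<s Xw s w, [set A | exists2 n, (0 < n)%N & Zn s w n A] >> =
    [set A | exists2 B : set R, measurable B & A = B `&` Xw s w] }.

Record potential_assumptions : Prop := {
  pot_lty : forall w x, Ivl s x -> (phi s w x < +oo)%E;
  pot_inf_gt0 : forall w Z, Z1 s w Z -> 0 < infimum_on Z (g1 s w);
  pot_BV : forall w, BV (Ivl s) (g1 s w);
  pot_S1_lty : forall w, (S1 s w < +oo)%E;
  pot_log_S1 : in_L1 (fun w => lne (S1 s w));
  pot_log_inf :
    in_L1 (fun w => lne (infimum_on (Xw s (theta s w))
                        (Lc s w (\1_(Xw s w))))%:E) }.

Definition log_norm_gcn n w : \bar R := lne (supnorm (Ivl s) (gcn s w n))%:E.
Definition log_inf_Lcn n w : \bar R :=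
  lne (infimum_on (Xw s (thetan s n w)) (Lcn s w n (\1_(Xw s w))))%:E.

Record closed_contracting : Prop := {
  closed_contracting_ae : {ae P, forall w, exists l1 l2 : \bar R,
    [/\ (fun n => ((n%:R)^-1)%:E * log_norm_gcn n w)%E @ \oo --> l1,
        (fun n => ((n%:R)^-1)%:E * log_inf_Lcn n w)%E @ \oo --> l2 &
        (l1 < l2)%E]};
  closed_contracting_int : exists N : nat,
    [/\ (1 <= N)%N, in_L1 (log_norm_gcn N), in_L1 (log_inf_Lcn N) &
        (-oo < (\int[P]_w log_norm_gcn N w) -
               (\int[P]_w log_inf_Lcn N w) < 0)%E]
  }.

Definition closed_conformal (nu : R.-pker Omega ~> R) :=
  (forall w, nu w (Ivl s) = 1%E) /\
  {ae P, forall w,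
    let lambda :=
      (\int[nu (theta s w)]_(x in Xw s (theta s w)) (Lc s w (cst 1%R) x)%:E)%E in
    (0 < lambda)%E /\
    forall f : R -> R, BV (Ivl s) f ->
      (\int[nu (theta s w)]_(x in Xw s (theta s w)) (Lc s w f x)%:E)%E =
      (lambda * \int[nu w]_(x in Ivl s) (f x)%:E)%E}.

Record hole_assumptions (nu : R.-pker Omega ~> R) : Prop := {
  hole_measurable : measurable (hole s);
  hole_sub : forall w, Hw s w `<=` Xw s w;
  hole_nontrivial :
    ((\int[P]_w nu w (Hw s w)) * (\int[P]_w nu w (Jw s w)) != 0)%E;
  hole_survivors : exists w, Kinf s w !=set0;
  hole_Sinf : forall w, Sinf s w !=set0 }.

Record functional_assumptions : Prop := {
  rho_gt0 : forall w, 0 < rho s w;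
  rho_log : in_L1 (fun w => lne (rho s w)%:E) }.

Record partition_assumptions (a b : R) (U Ut : Omega -> nat -> set (set R)) :
    Prop := {
  part_a : 0 <= a;
  part_b : 1 <= b;
  part_U : forall w n, (1 <= n)%N -> admissible_partition s a b w n (U w n);
  part_Ut : forall w n, (1 <= n)%N ->
    coarsest_adapted_partition s w n (U w n) (Ut w n);
  part_delta : forall n, (1 <= n)%N -> exists delta : Omega -> R,
    [/\ forall w, 0 < delta w, in_L1 (fun w => (ln (delta w))%:E) &
        forall w A, Zg s (Ut w n) w n A -> 2 * delta w <= Fw s w (\1_A)];
  (* Here ln 0 = 0, so that the absence of bad elements is allowed. *)
  part_eta : forall n, (1 <= n)%N ->
    in_L1 (fun w => (ln (eta s (Ut w n) w n))%:E) }.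

Definition open_contracting (Ut : Omega -> nat -> set (set R)) :=
  {ae P, forall w, exists l1 l2 : \bar R,
    let ls := limn_esup (fun n =>
      ((n%:R)^-1 * ln (eta s (Ut w n) w n))%:E) in
    [/\ (fun n => ((n%:R)^-1)%:E * lne (open_gnorm s w n)%:E)%E @ \oo --> l1,
        (fun n => ((n%:R)^-1)%:E *
           lne (infimum_on (Sinf s (thetan s n w))
                           (Ln s w n (\1_(Jw s w))))%:E)%E @ \oo --> l2,
        adde_def l1 ls &
        (l1 + ls < l2)%E]}.

Definition int_log_Cst (a b : R) (Ut : Omega -> nat -> set (set R)) n :
    \bar R :=
  (\int[P]_w lne (Cst s a b Ut w n)%:E)%E.

Definition negative_mean a b (Ut : Omega -> nat -> set (set R)) n :=
  in_L1 (fun w => lne (Cst s a b Ut w n)%:E) /\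
  (-oo < int_log_Cst a b Ut n < 0)%E.

Definition is_Nc a b (Ut : Omega -> nat -> set (set R)) (N : nat) :=
  [/\ (1 <= N)%N, negative_mean a b Ut N &
      forall n, (1 <= n < N)%N -> ~ negative_mean a b Ut n].

Definition xi a b (Ut : Omega -> nat -> set (set R)) (N : nat) : R :=
  - (N%:R)^-1 * fine (int_log_Cst a b Ut N).

End standing_assumptions.

(* Main.v *)
(* A Lasota-Yorke inequality with the constants C_{w,n} is iterated along blocks
   of length N_c, and the ergodic theorem controls the product of constants.

   For the inequality, L^n_w f is a finite sum over the cells of the partition
   inside K_{w,n-1}; on a good cell the supremum of |f| is at most its variation
   plus F_w(1_Z |f|) / F_w(1_Z), and a bad cell is compared with a good cell
   at most eta cells away. Two consecutive cells of K_{w,n-1} are contiguous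
   because X_w is dense in the interval. Good cells exist for every n: otherwise
   F_w(1_Z) = 0 for all cells Z, and the inequality for large k bounds L^k_w 1 by
   a multiple of max(1, eta) ||g^k||, against the contraction.

   theta^{N_c} need not be ergodic. Almost every backward orbit nevertheless has a
   residue class mod N_c along which the sums of log C + N_c (xi - e) are bounded
   above (Garsia's maximal inequality and the ergodicity of theta). Blocks are
   aligned, once and for all from the end point w, with such a class; the fewer
   than N_c remaining steps at both ends cost only tempered factors. *)
Require Import Defs.
From HB Require Import structures.
From mathcomp Require Import all_boot all_order all_algebra.
From mathcomp Require Import all_classical all_reals all_analysis.
From mathcomp Require Import measurable_realfun.
From mathcomp Require Import zify ring lra.
Import Order.TTheory GRing.Theory Num.Theory.
Import numFieldNormedType.Exports.
Local Open Scope classical_set_scope.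
Local Open Scope ring_scope.

Set Implicit Arguments.
Unset Strict Implicit.
Unset Printing Implicit Defensive.

(** * Variation along a set *)

Section variation.
Context {R : realType}.
Implicit Types (A B C W Y : set R) (f g h : R -> R) (s t : seq R).

(** The functional enters through two inequalities: superadditivity, and rho_w F_w(f) <= F_{theta
    w}(L_w f). By the second, the functional term on every intermediate fiber is at most the single
    number Phi = F_w(L~^n |f|), so the iteration becomes a scalar recursion for the variations v_j
    over theta^{-j} w. The bracket in C_{w,n} is (a + 2b)(1 + 2 eta) + 1. A cell costs a for the
    variation of g^n and 2 <= 2b for the two ends of its image; a good cell serves itself, the bad
    run after it and, if it is the first one, also the run before it, whence 1 + 2 eta; the last 1
    is the variation of f on the cells. The obstacle in the iteration is that C_eps may depend on w
    but not on n. All errors are therefore measured backwards from w: constants at theta^{-j} w are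
    at most exp(K(w) + e j). Leftover steps near w then cost a bounded factor, those near theta^{-n}
    w a factor exp(N_c (K(w) + e n)). Together with the e given up to make the mean of log C + N_c
    (xi - e) negative, this loses (N_c + 1) e in the rate, and e = min(xi, eps) / (N_c + 2) leaves
    room for it. *)

Fixpoint pathvar f x s : R :=
  if s is y :: s' then `|f y - f x| + pathvar f y s' else 0.

Definition seqvar f s : R := if s is x :: s' then pathvar f x s' else 0.

(** A bound rather than a value, so that estimates of finite variation stay in R; [var_leP] is the
    link to the extended real [var]. *)
Definition varle A f (M : R) := forall s,
  sorted <%R s -> (forall x, x \in s -> A x) -> seqvar f s <= M.

Lemma sum_seqvar f s :
  \sum_(0 <= i < (size s).-1) `|f s`_i.+1 - f s`_i| = seqvar f s.
Proof.
case: s => [|x s] /=; first by rewrite big_geq.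
elim: s x => [|y s IH] x /=; first by rewrite big_geq.
by rewrite big_nat_recl //= -IH.
Qed.

Lemma var_leP A f M : (var A f <= M%:E)%E <-> varle A f M.
Proof.
split=> [H s ss sA|H].
- rewrite -lee_fin -sum_seqvar; apply: le_trans H; apply: ereal_sup_ubound.
  by exists s.
- by apply: ge_ereal_sup => _ [s [ss sA] <-]; rewrite lee_fin sum_seqvar; exact: H.
Qed.

Lemma varle_ge0 A f M : varle A f M -> 0 <= M.
Proof. by move=> /(_ [::]) /=; exact. Qed.

Lemma var_ge0 A f : (0 <= var A f)%E.
Proof. by apply: ereal_sup_ubound; exists [::] => //=; rewrite big_geq. Qed.

Lemma seqvar_cons_le f x s : seqvar f s <= pathvar f x s.
Proof. by case: s => [|y s] //=; rewrite lerDr. Qed.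

Lemma pathvar_cat_le f x s t : pathvar f x s + seqvar f t <= pathvar f x (s ++ t).
Proof.
elim: s x => [|y s IH] x /=; first by rewrite add0r seqvar_cons_le.
by rewrite -addrA lerD2l.
Qed.

Lemma seqvar_cat_le f s t : seqvar f s + seqvar f t <= seqvar f (s ++ t).
Proof. by case: s => [|x s] /=; rewrite ?add0r ?pathvar_cat_le. Qed.

Lemma seqvar_rcons2 f s x y :
  seqvar f (rcons (rcons s x) y) = seqvar f (rcons s x) + `|f y - f x|.
Proof.
case: s => [|z s] /=; first by rewrite addr0 add0r.
by elim: s z => [|u s IH] z /=; rewrite ?addr0 // IH addrA.
Qed.

(** Serves the decreasing branches, along which increasing sequences become decreasing. *)
Lemma seqvar_rev f s : seqvar f (rev s) = seqvar f s.
Proof.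
elim: s => [|x [|y s] IH] //.
rewrite rev_cons rev_cons seqvar_rcons2 -rev_cons IH /=.
by rewrite addrC distrC.
Qed.

Lemma seqvar_map f (k : R -> R) s : seqvar f (map k s) = seqvar (f \o k) s.
Proof. by case: s => [|x s] //=; elim: s x => [|y s IH] x //=; rewrite IH. Qed.

Lemma eq_seqvar f g s : {in s, f =1 g} -> seqvar f s = seqvar g s.
Proof.
case: s => [|x s] //=; elim: s x => [|y s IH] x H //=.
by rewrite IH ?H ?mem_head// ?inE ?eqxx ?orbT // => z zs; apply: H; rewrite inE zs orbT.
Qed.

Lemma varleS A B f M : A `<=` B -> varle B f M -> varle A f M.
Proof. by move=> AB H s ss sA; apply: H => // x /sA /AB. Qed.

Lemma varle_le A f M N : varle A f M -> M <= N -> varle A f N.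
Proof. by move=> H MN s ss sA; apply: le_trans MN; exact: H. Qed.

Lemma eq_varle A f g M : (forall x, A x -> f x = g x) -> varle A f M -> varle A g M.
Proof.
move=> fg H s ss sA; rewrite -(@eq_seqvar f) => [|x /sA /fg //]; exact: H.
Qed.

Lemma varle_dist A f M x y : varle A f M -> A x -> A y -> `|f x - f y| <= M.
Proof.
move=> H Ax Ay; case: (ltgtP x y) => [xy|xy|->].
- have := H [:: x; y]; rewrite /= xy addr0 distrC; apply => //.
  by move=> z; rewrite !inE => /orP[] /eqP ->.
- have := H [:: y; x]; rewrite /= xy addr0; apply => //.
  by move=> z; rewrite !inE => /orP[] /eqP ->.
- by rewrite subrr normr0 (varle_ge0 H).
Qed.

Lemma varle_bounded A f M : varle A f M -> bounded_on A f.
Proof.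
move=> H; have [[x Ax]|/set0P/negP/negPn/eqP ->] := pselect (A !=set0); last by exists 0.
exists (`|f x| + M) => y Ay.
rewrite -[f y](subrK (f x)) addrC (le_trans (ler_normD _ _)) // lerD2l.
exact: varle_dist H _ _.
Qed.

Lemma varleD A f g M N :
  varle A f M -> varle A g N -> varle A (fun x => f x + g x) (M + N).
Proof.
move=> Hf Hg s ss sA; apply: (le_trans _ (lerD (Hf s ss sA) (Hg s ss sA))).
case: s {ss sA} => [|x s] /=; first by rewrite addr0.
elim: s x => [|y s IH] x /=; first by rewrite addr0.
rewrite addrACA lerD // opprD addrACA; exact: ler_normD.
Qed.

Lemma varle_sum (I : eqType) A (r : seq I) (F : I -> R -> R) (M : I -> R) :
  (forall i, i \in r -> varle A (F i) (M i)) ->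
  varle A (fun x => \sum_(i <- r) F i x) (\sum_(i <- r) M i).
Proof.
elim: r => [|i r IH] H.
- apply: (@eq_varle _ (cst 0)) => [x _|]; first by rewrite big_nil.
  rewrite big_nil => s _ _; case: s => [|x s] //=.
  by elim: s x => [|y s IH] x //=; rewrite subrr normr0 add0r.
- apply: (@eq_varle _ (fun x => F i x + \sum_(i <- r) F i x)) => [x _|].
    by rewrite big_cons.
  rewrite big_cons; apply: varleD; first by apply: H; rewrite mem_head.
  by apply: IH => j jr; apply: H; rewrite inE jr orbT.
Qed.

Lemma varleZ A f M c : varle A f M -> varle A (fun x => c * f x) (`|c| * M).
Proof.
move=> H s ss sA; apply: le_trans (ler_wpM2l (normr_ge0 c) (H s ss sA)).
case: s {ss sA} => [|x s] /=; first by rewrite mulr0.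
elim: s x => [|y s IH] x /=; first by rewrite mulr0.
by rewrite mulrDr lerD // -mulrBr normrM.
Qed.

Lemma varleM A f g u v F G : varle A f u -> varle A g v ->
  (forall x, A x -> `|f x| <= F) -> (forall x, A x -> `|g x| <= G) ->
  0 <= F -> 0 <= G ->
  varle A (fun x => f x * g x) (F * v + G * u).
Proof.
move=> Hf Hg fF gG F0 G0 s ss sA.
apply: le_trans (lerD (ler_wpM2l F0 (Hg s ss sA)) (ler_wpM2l G0 (Hf s ss sA))).
case: s {ss} sA => [|x s] /= sA; first by rewrite !mulr0 addr0.
elim: s x sA => [|y s IH] x sA /=; first by rewrite !mulr0 addr0.
have Ax : A x by apply: sA; rewrite mem_head.
have Ay : A y by apply: sA; rewrite !inE eqxx orbT.
rewrite !mulrDr addrACA lerD //; last first.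
  by apply: IH => z zs; apply: sA; rewrite inE zs orbT.
have -> : f y * g y - f x * g x = f y * (g y - g x) + (f y - f x) * g x by ring.
rewrite (le_trans (ler_normD _ _)) // !normrM lerD //.
- by rewrite ler_wpM2r // fF.
- by rewrite mulrC ler_wpM2r // gG.
Qed.

Lemma lt_sorted_cat A B s t : (forall x y, A x -> B y -> x < y) ->
  sorted <%R s -> (forall x, x \in s -> A x) ->
  sorted <%R t -> (forall x, x \in t -> B x) -> sorted <%R (s ++ t).
Proof.
move=> AB; rewrite !lt_sorted_pairwise => ss sA st tB.
rewrite pairwise_cat ss st !andbT.
by apply/allrelP => x y /sA Ax /tB By; exact: AB.
Qed.

(** The exact variation as a real number. The [sup] is meaningful only when some [varle A f M]
    holds, which explains that hypothesis below. *)
Definition rvar A f : R := sup [set seqvar f s | s in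
  [set s | sorted <%R s /\ forall x, x \in s -> A x]].

Lemma rvar_le A f M : varle A f M -> rvar A f <= M.
Proof.
move=> H; apply: ge_sup; first by exists 0; exists [::].
by move=> _ [s [ss sA] <-]; exact: H.
Qed.

Lemma varle_rvar A f M : varle A f M -> varle A f (rvar A f).
Proof.
move=> H s ss sA; apply: ub_le_sup; last by exists s.
by exists M => _ [t [st tA] <-]; exact: H.
Qed.

Lemma rvar_ge0 A f M : varle A f M -> 0 <= rvar A f.
Proof. by move=> H; apply: varle_ge0 (varle_rvar H). Qed.

Lemma rvarD A B C f M : A `<=` C -> B `<=` C ->
  (forall x y, A x -> B y -> x < y) -> varle C f M ->
  rvar A f + rvar B f <= rvar C f.
Proof.
move=> AC BC AB H; have HC := varle_rvar H.
rewrite -lerBrDr; apply: rvar_le => s ss sA.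
rewrite lerBrDr addrC -lerBrDr; apply: rvar_le => t st tB.
rewrite lerBrDr addrC; apply: le_trans (seqvar_cat_le _ _ _) _.
apply: HC; first exact: lt_sorted_cat AB ss sA st tB.
by move=> x; rewrite mem_cat => /orP[/sA /AC|/tB /BC].
Qed.

Lemma rvar_sum (L : seq (set R)) C f M :
  pairwise (fun A B => `[< forall x y, A x -> B y -> x < y >]) L ->
  (forall A, A \in L -> A `<=` C) -> varle C f M ->
  \sum_(A <- L) rvar A f <= rvar C f.
Proof.
elim: L C => [|A L IH] C; first by rewrite big_nil => _ _ /rvar_ge0.
move=> /= /andP[/allP AL pL] LC HC; rewrite big_cons.
pose B := [set x | exists2 Z, Z \in L & Z x].
have BC : B `<=` C by move=> x [Z ZL Zx]; apply: (LC Z) => //; rewrite inE ZL orbT.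
have AC : A `<=` C by apply: LC; rewrite mem_head.
apply: (le_trans _ (@rvarD A B C f M AC BC _ HC)).
  rewrite lerD2l; apply: IH => //; last exact: varleS HC.
  by move=> Z ZL x Zx; exists Z.
by move=> x y Ax [Z /AL /asboolP ZL Zy]; exact: ZL.
Qed.

(** An increasing sequence of the image pulls back, through a right inverse [j] of [k], to an
    increasing or a decreasing sequence of [W]; in the second case it is reversed. *)
Lemma varle_image (k : R -> R) W f v : strictly_monotone_on W k ->
  varle W (f \o k) v -> varle (k @` W) f v.
Proof.
move=> mk H s ss sW.
have /choice[j jP] : forall x, exists y, (k @` W) x -> W y /\ k y = x.
  by move=> x; have [[y Wy <-]|n] := pselect ((k @` W) x); [exists y | exists 0].
have jW x : x \in s -> W (j x) by move=> /sW /jP [].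
have kj x : x \in s -> k (j x) = x by move=> /sW /jP [].
have sE : s = map k (map j s).
  by rewrite -map_comp -[LHS]map_id; apply/eq_in_map => x xs /=; rewrite kj.
case: mk => mk.
- rewrite sE seqvar_map; apply: H; last by move=> _ /mapP[x xs ->]; exact: jW.
  rewrite sorted_map; apply: (@sub_in_sorted _ [in s] _ _ _ s (allss s) ss).
  move=> x y xs ys /= xy; rewrite ltNge le_eqVlt; apply/negP => /orP[/eqP E|].
    by move: xy; rewrite -(kj x xs) -(kj y ys) E ltxx.
  move=> /mk; rewrite !inE kj // kj // => /(_ (jW _ ys) (jW _ xs)).
  by rewrite ltNge (ltW xy).
- rewrite sE seqvar_map -seqvar_rev; apply: H; last first.
    by move=> z; rewrite mem_rev => /mapP[x xs ->]; exact: jW.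
  rewrite rev_sorted sorted_map; apply: (@sub_in_sorted _ [in s] _ _ _ s (allss s) ss).
  move=> x y xs ys /= xy; rewrite ltNge le_eqVlt; apply/negP => /orP[/eqP E|].
    by move: xy; rewrite -(kj x xs) -(kj y ys) E ltxx.
  move=> /mk; rewrite !inE kj // kj // => /(_ (jW _ ys) (jW _ xs)).
  by rewrite ltNge (ltW xy).
Qed.

(** An increasing sequence enters the interval [W] at most once and leaves it at most once, and each
    of these two jumps is at most [M]. *)
Lemma varle_extend0 Y W f v M : interval_in Y W -> varle W f v ->
  (forall x, W x -> `|f x| <= M) -> 0 <= M ->
  (forall x, Y x -> ~ W x -> f x = 0) -> varle Y f (v + 2 * M).
Proof.
move=> [WY Wc] H fM M0 f0.
(* [P3]: nothing happens after [W] has been left. [P2]: a path starting in [W] pays for leaving.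
   [P1]: a general path may pay for entering as well. *)
have P3 x s w : path <%R x s -> (forall z, z \in x :: s -> Y z) ->
    W w -> w < x -> ~ W x -> pathvar f x s = 0.
  elim: s x => [|y s IH] x //= /andP[xy ps] sY Ww wx nWx.
  have Yx : Y x by apply: sY; rewrite mem_head.
  have Yy : Y y by apply: sY; rewrite !inE eqxx orbT.
  have nWy : ~ W y by move=> Wy; apply: nWx; apply: (Wc w y) => //; exact: ltW.
  rewrite !f0 // subrr normr0 add0r (IH y) //; last exact: lt_trans xy.
  by move=> z zs; apply: sY; rewrite inE zs orbT.
have P2 x s : path <%R x s -> (forall z, z \in x :: s -> Y z) -> W x ->
    exists t, [/\ path <%R x t, (forall z, z \in t -> W z) &
      pathvar f x s <= pathvar f x t + M].
  elim: s x => [|y s IH] x /=; first by exists [::]; split => //=; rewrite add0r.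
  move=> /andP[xy ps] sY Wx.
  have sY' z : z \in y :: s -> Y z by move=> zs; apply: sY; rewrite inE zs orbT.
  have Yy : Y y by apply: sY'; rewrite mem_head.
  have [Wy|nWy] := pselect (W y).
  - have [t [pt tW le]] := IH y ps sY' Wy.
    exists (y :: t); split => /=; [by rewrite xy| |by rewrite -addrA lerD2l].
    by move=> z; rewrite inE => /orP[/eqP -> //|/tW].
  - exists [::]; split => //=.
    by rewrite (P3 _ _ x) // f0 // sub0r normrN addr0 add0r fM.
have P1 s : sorted <%R s -> (forall z, z \in s -> Y z) ->
    exists t, [/\ sorted <%R t, (forall z, z \in t -> W z) &
      seqvar f s <= seqvar f t + 2 * M].
  case: s => [|x s].
    by exists [::]; split => //=; rewrite add0r mulr_ge0.
  elim: s x => [|y s IH] x /=; first by exists [::]; split => //=; rewrite add0r mulr_ge0.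
  move=> /andP[xy ps] sY.
  have sY' z : z \in y :: s -> Y z by move=> zs; apply: sY; rewrite inE zs orbT.
  have Yx : Y x by apply: sY; rewrite mem_head.
  have [Wx|nWx] := pselect (W x).
  - have [|t [pt tW le]] := @P2 x (y :: s) _ sY Wx; first by rewrite /= xy.
    exists (x :: t); split => //=.
      by move=> z; rewrite inE => /orP[/eqP -> //|/tW].
    by apply: (le_trans le); rewrite lerD2l; rewrite mulr_natl mulr2n lerDl.
  - have [Wy|nWy] := pselect (W y).
    + have [t [pt tW le]] := P2 y s ps sY' Wy.
      exists (y :: t); split => //=.
        by move=> z; rewrite inE => /orP[/eqP -> //|/tW].
      rewrite (f0 x) // subr0 (_ : _ + 2 * M = M + (pathvar f y t + M)); last by ring.
      by apply: lerD => //; exact: fM.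
    + have [t [pt tW le]] := IH y ps sY'.
      exists t; split => //; rewrite !f0 // ?subrr ?normr0 ?add0r //.
      by apply: sY'; rewrite mem_head.
move=> s ss sY; have [t [st tW le]] := P1 s ss sY.
by apply: (le_trans le); rewrite lerD2r; exact: H.
Qed.

(* The hypotheses on S and m say that S A and m A are the supremum and the
   infimum of |f| on A. A bad set is compared with the last good set before it
   or, when there is none, with the first good set. *)
Lemma sum_sup_le (L : seq (set R)) (good : pred (set R)) C f (V : R)
    (S m : set R -> R) (e : nat) :
  pairwise (fun A B => `[< forall x y, A x -> B y -> x < y >]) L ->
  (forall A, A \in L -> A `<=` C /\ A !=set0) ->
  varle C f V ->
  (forall A c, A \in L -> (forall x, A x -> `|f x| <= c) -> S A <= c) ->
  (forall A c, A \in L -> (forall x, A x -> c <= `|f x|) -> c <= m A) ->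
  (forall p K q, L = p ++ K ++ q -> all (predC good) K -> (size K <= e)%N) ->
  has good L ->
  \sum_(A <- L) S A <= (1 + 2 * e%:R) * (V + \sum_(A <- L | good A) m A).
Proof.
move=> Lo LC HV HS Hm He Hg.
have HSm D A B : A \in L -> B \in L -> A `<=` D -> B `<=` D -> D `<=` C ->
    S A <= m B + rvar D f.
  move=> AL BL AD BD DC; apply: HS => // x Ax.
  rewrite -lerBlDr; apply: Hm => // y By; rewrite lerBlDr.
  have HD := varle_rvar (varleS DC HV).
  have := varle_dist HD (AD _ Ax) (BD _ By).
  have := ler_normD (f x - f y) (f y); rewrite subrK; lra.
have m0 A : A \in L -> 0 <= m A by move=> AL; apply: Hm.
have rv0 D : D `<=` C -> 0 <= rvar D f by move=> DC; apply: rvar_ge0 (varleS DC HV).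
have sumblock D (B : seq (set R)) G : G \in L -> {subset B <= L} -> D `<=` C -> G `<=` D ->
    (forall A, A \in B -> A `<=` D) -> (size B <= e)%N ->
    \sum_(A <- B) S A <= e%:R * (m G + rvar D f).
  move=> GL BL DC GD BD Be.
  apply: (@le_trans _ _ (\sum_(A <- B) (m G + rvar D f))).
    rewrite big_seq [leRHS]big_seq; apply: ler_sum => A AB.
    by apply: HSm => //; [exact: BL | exact: BD].
  rewrite big_const_seq count_predT iter_addr addr0 -[leLHS]mulr_natl.
  by rewrite ler_wpM2r ?ler_nat // addr_ge0 ?m0 ?rv0.
pose U (K : seq (set R)) : set R := [set x | exists2 A, A \in K & A x].
have UC K : {subset K <= L} -> U K `<=` C.
  by move=> KL x [A AK Ax]; have [+ _] := LC A (KL _ AK); exact.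
(* Induction over blocks made of a good set and the bad run after it. A block has at most 1 + e
   members, all compared with its good set over the union of the block. These unions are ordered, so
   their variations add up to at most the total one. *)
have QQ k : forall p K, (size K <= k)%N -> L = p ++ K -> (if K is G :: _ then good G else false) ->
    \sum_(A <- K) S A <= (1 + e%:R) * (rvar (U K) f + \sum_(A <- K | good A) m A).
  elim: k => [|k IH] p K.
    by rewrite leqn0 size_eq0 => /eqP ->.
  case: K => [|G K] //; rewrite ltnS => Kk LE gG.
  have KL : {subset K <= L} by move=> A AK; rewrite LE mem_cat inE AK !orbT.
  have GL : G \in L by rewrite LE mem_cat mem_head orbT.
  set j := find good K; set B := take j K; set K' := drop j K.
  have KE : K = B ++ K' by rewrite cat_take_drop.
  have bB : all (predC good) B.
    apply/allP => A /(nthP set0)[i]; rewrite size_take => ij <-.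
    have ij' : (i < j)%N by move: ij; case: ifP => // /negbT; rewrite -leqNgt => h1 h2; exact: leq_trans h2 h1.
    by rewrite nth_take //= before_find.
  have Be : (size B <= e)%N by apply: (He (p ++ [:: G]) _ K') => //; rewrite LE -catA /= -KE.
  have BK : {subset B <= K} by move=> A AB; rewrite KE mem_cat AB.
  have K'K : {subset K' <= K} by move=> A AB; rewrite KE mem_cat AB orbT.
  have mB : \sum_(A <- B | good A) m A = 0.
    by rewrite big_seq_cond big1 // => A /andP[/(allP bB) /= /negP].
  have GKL : {subset G :: K <= L} by move=> A; rewrite inE => /orP[/eqP -> //|/KL].
  have UG : G `<=` U (G :: B) by move=> x Gx; exists G; rewrite ?mem_head.
  have UB A : A \in B -> A `<=` U (G :: B).
    by move=> AB x Ax; exists A; rewrite ?inE ?AB ?orbT.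
  have UGBC : U (G :: B) `<=` C.
    by apply: UC => A; rewrite inE => /orP[/eqP -> //|/BK /KL].
  have S1 := sumblock (U (G :: B)) B G GL (fun A AB => KL A (BK A AB)) UGBC UG UB Be.
  have S2 := HSm (U (G :: B)) G G GL GL UG UG UGBC.
  have e0 : (0 : R) <= e%:R by [].
  rewrite !big_cons gG KE !big_cat /= mB add0r.
  have : \sum_(A <- K') S A <= (1 + e%:R) * (rvar (U K') f + \sum_(A <- K' | good A) m A).
    case EK' : K' => [|G' K''].
      rewrite !big_nil addr0; apply: mulr_ge0; first by lra.
      by apply: rv0; apply: UC.
    rewrite -EK'; apply: (IH (p ++ G :: B)).
    - by apply: leq_trans Kk; rewrite size_drop leq_subr.
    - by rewrite LE -catA /= -KE.
    - rewrite EK'.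
      have hj : has good K.
        by rewrite has_find -/j ltnNge; apply/negP => h; move: EK'; rewrite /K' drop_oversize.
      have : good (nth set0 K j) by apply: nth_find.
      by rewrite -[j]addn0 -nth_drop -/K' EK'.
  have RV : rvar (U (G :: B)) f + rvar (U K') f <= rvar (U (G :: B ++ K')) f.
    apply: (@rvarD _ _ _ _ V).
    - move=> x [A AG Ax]; exists A => //; rewrite inE mem_cat.
      by move: AG; rewrite inE => /orP[->|->]; rewrite ?orbT.
    - by move=> x [A AG Ax]; exists A => //; rewrite inE mem_cat AG !orbT.
    - move=> x y [A AG Ax] [B' BK' By].
      move: Lo; rewrite LE KE pairwise_cat -cat_cons pairwise_cat.
      move=> /and3P[_ _ /and3P[/allrelP /(_ A B' AG BK') /asboolP h _ _]].
      exact: h.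
    - apply: (varleS _ HV); apply: UC => A; rewrite -KE; exact: GKL.
  have := m0 G GL; have := rv0 _ UGBC.
  move: S1 S2 RV; set r1 := rvar (U (G :: B)) f; set r2 := rvar (U K') f.
  set r3 := rvar (U (G :: _)) f.
  move: (e%:R) e0 => E E0 S1 S2 RV r10 mG0 H.
  have : (1 + E) * (r1 + r2) <= (1 + E) * r3 by rewrite ler_wpM2l //; lra.
  move: H; rewrite !mulrDr !mulrDl; move: S1; rewrite mulrDr; lra.
(* The initial bad run [B] has no good set before it and is compared with the first one after it,
   over all of [C]: this is the second e in 1 + 2e. *)
set j := find good L; set B := take j L; set K := drop j L.
have LE : L = B ++ K by rewrite cat_take_drop.
have KL : {subset K <= L} by move=> A AK; rewrite LE mem_cat AK orbT.
have BL : {subset B <= L} by move=> A AK; rewrite LE mem_cat AK.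
have bB : all (predC good) B.
  apply/allP => A /(nthP set0)[i]; rewrite size_take -has_find Hg => ij <-.
  by rewrite nth_take //= before_find.
have mB : \sum_(A <- B | good A) m A = 0.
  by rewrite big_seq_cond big1 // => A /andP[/(allP bB) /= /negP].
have Be : (size B <= e)%N by apply: (He [::] _ K).
case EK : K => [|G K1].
  by move: Hg; rewrite has_find -/j ltnNge; move: EK; rewrite /K => /eqP; rewrite -size_eq0 size_drop subn_eq0 => ->.
have gG : good G.
  have : good (nth set0 L j) by apply: nth_find.
  by rewrite -[j]addn0 -nth_drop -/K EK.
have H1 := QQ (size K) B K (leqnn _) LE; rewrite EK gG in H1.
have {}H1 := H1 isT.
have GL : G \in L by apply: KL; rewrite EK mem_head.
have S1 : \sum_(A <- B) S A <= e%:R * (m G + rvar C f).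
  apply: sumblock => //; first by have [] := LC G GL.
  by move=> A AB; have [] := LC A (BL _ AB).
have sm : m G <= \sum_(A <- K | good A) m A.
  rewrite EK big_cons gG lerDl big_seq_cond sumr_ge0 // => A /andP[AK _].
  by apply: m0; apply: KL; rewrite EK inE AK orbT.
rewrite LE !big_cat /= mB add0r EK; rewrite EK in sm H1 KL.
set s1 := \sum_(_ <- _) _ in S1 *; set s2 := \sum_(_ <- _) _ in H1 *.
set s3 := \sum_(_ <- _ | _) _ in H1 sm *.
have rC : rvar C f <= V := rvar_le HV.
have rU : rvar (U (G :: K1)) f <= V := rvar_le (varleS (UC _ KL) HV).
have e0 : (0 : R) <= e%:R by [].
have E1 : e%:R * (m G + rvar C f) <= e%:R * (V + s3) by rewrite ler_wpM2l //; lra.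
have E2 : (1 + e%:R) * (rvar (U (G :: K1)) f + s3) <= (1 + e%:R) * (V + s3).
  by rewrite ler_wpM2l //; lra.
have -> : (1 + 2 * e%:R) * (V + s3) = e%:R * (V + s3) + (1 + e%:R) * (V + s3) by ring.
lra.
Qed.

End variation.

(** * Monotone images and density of X_w *)

Section monotone_images.
Context {R : realType}.
Implicit Types (A W Y : set R) (f g : R -> R).

Lemma smonoS A W f : W `<=` A -> strictly_monotone_on A f -> strictly_monotone_on W f.
Proof.
move=> WA [H|H]; [left|right] => x y; rewrite !inE => Wx Wy; apply: H;
  rewrite inE; exact: WA.
Qed.

Lemma smono_comp W f g : strictly_monotone_on W f ->
  strictly_monotone_on (f @` W) g -> strictly_monotone_on W (g \o f).
Proof.
move=> [Hf|Hf] [Hg|Hg]; [left|right|right|left] => x y Wx Wy xy /=; apply: Hg;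
  by [rewrite inE; exists x => //; rewrite -inE | rewrite inE; exists y => //; rewrite -inE
     | exact: Hf].
Qed.

Lemma smono_inj W f x y : strictly_monotone_on W f -> W x -> W y -> f x = f y -> x = y.
Proof.
move=> Hf /mem_set Wx /mem_set Wy; apply: contra_eq; rewrite neq_lt.
by case: Hf => Hf /orP[] h; rewrite ?(lt_eqF (Hf _ _ _ _ h)) ?(gt_eqF (Hf _ _ _ _ h)).
Qed.

Lemma smono_lt W f x y : strictly_monotone_on W f -> W x -> W y ->
  f x < f y -> {in W &, {homo f : x y / x < y}} -> x < y.
Proof.
move=> _ /mem_set Wx /mem_set Wy fxy Hf; rewrite ltNge le_eqVlt; apply/negP => /orP[/eqP E|yx].
  by move: fxy; rewrite E ltxx.
by have := Hf _ _ Wy Wx yx; rewrite ltNge (ltW fxy).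
Qed.

Lemma interval_in_image A W Y f : strictly_monotone_on A f ->
  interval_in Y (f @` A) -> interval_in A W -> interval_in Y (f @` W).
Proof.
move=> mf [fAY fAc] [WA Wc]; split.
  by move=> _ [x /WA Ax <-]; apply: fAY; exists x.
move=> _ _ z [x Wx <-] [y Wy <-] Yz xz zy.
have Ax := WA _ Wx; have Ay := WA _ Wy.
have [||t At tz] := fAc (f x) (f y) z _ _ Yz xz zy; [by exists x|by exists y|].
exists t => //; rewrite -tz in xz zy.
have M u v : A u -> A v -> f u <= f v -> ({in A &, {homo f : x y / x < y}} -> u <= v) /\
    ({in A &, {homo f : x y /~ x < y}} -> v <= u).
  move=> Au Av; rewrite le_eqVlt => /orP[/eqP E|fuv].
    by rewrite (smono_inj mf Au Av E).
  move: Au Av => /mem_set Au /mem_set Av.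
  split=> H; rewrite leNgt; apply/negP => h.
    by have := H _ _ Av Au h; rewrite ltNge (ltW fuv).
  by have := H _ _ Av Au h; rewrite ltNge (ltW fuv).
case: mf => mf.
- by apply: (Wc x y) => //; [have [/(_ mf)] := M x t Ax At xz|have [/(_ mf)] := M t y At Ay zy].
- by apply: (Wc y x) => //; [have [_ /(_ mf)] := M t y At Ay zy|have [_ /(_ mf)] := M x t Ax At xz].
Qed.

Lemma is_intervalT W : is_interval W <-> interval_in setT W.
Proof.
split=> [H|[_ H] x y Wx Wy z /andP[xz zy]]; last exact: (H x y).
by split=> // x y z Wx Wy _ xz zy; apply: (H x y) => //; rewrite xz zy.
Qed.

End monotone_images.

(** * Branches of the iterates and density of the fibers X_w *)

Section system.
Context {R : realType} {d : measure_display} {Omega : measurableType d}.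
Variable s : open_system R Omega.
Implicit Types (w : Omega) (n i k : nat) (x y z : R) (W : set R).

Lemma thetan_theta n w : thetan s n (theta s w) = thetan s n.+1 w.
Proof. by rewrite /thetan iterSr. Qed.

Lemma thetan_add m n w : thetan s m (thetan s n w) = thetan s (m + n) w.
Proof. by rewrite /thetan iterD. Qed.

Lemma Tn_theta w n x : Tn s w n.+1 x = Tn s (theta s w) n (Tw s w x).
Proof. by elim: n => [|n IH] //; rewrite [RHS]/= -IH /= thetan_theta. Qed.

Lemma XwP w x : Xw s w x <->
  Ivl s x /\ forall k, ~ Dw s (thetan s k w) (Tn s w k x).
Proof.
split=> [[Ix nS]|[Ix nD]].
  by split=> // k Dk; apply: nS; split=> //; exists k.
by split=> // -[_ [k Dk]]; exact: nD Dk.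
Qed.

Hypothesis hmap : map_assumptions s.

Lemma Tw_Ivl w x : Ivl s x -> Ivl s (Tw s w x).
Proof. by move=> Ix; rewrite -(map_surjective hmap w); exists x. Qed.

Lemma Tn_Ivl w n x : Ivl s x -> Ivl s (Tn s w n x).
Proof. by move=> Ix; elim: n => //= n; exact: Tw_Ivl. Qed.

Lemma Tw_X w x : Xw s w x -> Xw s (theta s w) (Tw s w x).
Proof.
move=> /XwP[Ix nD]; apply/XwP; split; first exact: Tw_Ivl.
by move=> k; rewrite thetan_theta -Tn_theta.
Qed.

Lemma Tn_X w n x : Xw s w x -> Xw s (thetan s n w) (Tn s w n x).
Proof. by move=> Xx; elim: n => //= n; exact: Tw_X. Qed.

Lemma Tw_X_inv w x : Ivl s x -> ~ Dw s w x -> Xw s (theta s w) (Tw s w x) -> Xw s w x.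
Proof.
move=> Ix nD /XwP[_ H]; apply/XwP; split=> // -[//|k].
by rewrite Tn_theta -thetan_theta.
Qed.

Lemma Zstar_bounds w i x : Zstar s w i x -> lo s <= x <= hi s.
Proof. by move=> /(map_branch_interval hmap w i).2; rewrite /Ivl /= in_itv. Qed.

(** If t were an endpoint of some Z_j, then Z_j would have points between u and v, hence j = i by
    disjointness; but an endpoint of Z_i cannot lie strictly between two of its points. *)
Lemma interior_notD w i u v t : Zstar s w i u -> Zstar s w i v -> u < t -> t < v ->
  ~ Dw s w t.
Proof.
move=> Zu Zv ut tv [j [q Zq]] H.
have [Iz _] := map_branch_interval hmap w i.
have disj z : Zstar s w j z -> Zstar s w i z -> j = i.
  by move=> Zjz Ziz; apply: (@map_branch_disjoint _ _ _ _ hmap w j i I I); exists z.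
have HI : has_inf (Zstar s w j).
  by split; [exists q|exists (lo s) => z /Zstar_bounds /andP[]].
have HS : has_sup (Zstar s w j).
  by split; [exists q|exists (hi s) => z /Zstar_bounds /andP[]].
case: H => E.
- have [z Zz zv] : exists2 z, Zstar s w j z & z < v.
    by apply: inf_lt; [exists q|rewrite -E].
  have tz : t <= z by rewrite E; apply: ge_inf => //; exact: HI.2.
  have ij : j = i.
    apply: (disj z) => //; apply: (Iz u v) => //.
    by rewrite (ltW zv) (le_trans (ltW ut)).
  have : t <= u by rewrite E ij; apply: ge_inf => //; rewrite -ij; exact: HI.2.
  by rewrite leNgt ut.
- have [z Zz uz] : exists2 z, Zstar s w j z & u < z.
    by apply: sup_gt; [exists q|rewrite -E].
  have zt : z <= t by rewrite E; apply: ub_le_sup => //; exact: HS.2.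
  have ij : j = i.
    apply: (disj z) => //; apply: (Iz u v) => //.
    by rewrite (ltW uz) (le_trans zt (ltW tv)).
  have : v <= t by rewrite E ij; apply: ub_le_sup => //; rewrite -ij; exact: HS.2.
  by rewrite leNgt tv.
Qed.

Lemma branch_smono w i : strictly_monotone_on (Zstar s w i) (Tw s w).
Proof. by have [] := map_branch_monotone hmap w i. Qed.

(** The image of the whole branch is an interval by assumption. The preimage t of a point of
    X_{theta w} is in X_w unless t is in D_w; this cannot happen strictly between two points of the
    branch, and at those two points there is nothing to prove. *)
Lemma branch_image w i :
  interval_in (Xw s (theta s w)) (Tw s w @` (Zstar s w i `&` Xw s w)).
Proof.
split; first by move=> _ [x [_ Xx] <-]; exact: Tw_X.
move=> _ _ z [x [Zx Xx] <-] [y [Zy Xy] <-] Xz xz zy.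
have [_ mT _ Ti] := map_branch_monotone hmap w i.
have [t Zt tz] : (Tw s w @` Zstar s w i) z.
  by apply: (Ti (Tw s w x) (Tw s w y)); [exists x|exists y|rewrite xz zy].
exists t => //; split=> //.
move: xz zy; rewrite -tz !le_eqVlt => /orP[/eqP E|xt].
  by rewrite -(smono_inj mT Zx Zt E).
move=> /orP[/eqP E|ty].
  by rewrite (smono_inj mT Zt Zy E).
apply: Tw_X_inv; [exact: (map_branch_interval hmap w i).2| |by rewrite tz].
case: (mT) => mT'.
- apply: (interior_notD Zx Zy); first exact: (smono_lt mT Zx Zt xt mT').
  exact: (smono_lt mT Zt Zy ty mT').
- have lt' u v : Zstar s w i u -> Zstar s w i v -> Tw s w u < Tw s w v -> v < u.
    move=> Zu Zv uv; rewrite ltNge le_eqVlt; apply/negP => /orP[/eqP E|h].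
      by move: uv; rewrite E ltxx.
    by have := mT' v u (mem_set Zv) (mem_set Zu) h; rewrite ltNge (ltW uv).
  by apply: (interior_notD Zy Zx); exact: lt'.
Qed.

Lemma Tn_branch w n W : interval_in (Xw s w) W ->
  (forall i, (i < n)%N -> exists j, Tn s w i @` W `<=` Zstar s (thetan s i w) j) ->
  strictly_monotone_on W (Tn s w n) /\
  interval_in (Xw s (thetan s n w)) (Tn s w n @` W).
Proof.
move=> IW; elim: n => [|n IH] H.
  split; first by left.
  by rewrite /= image_id.
have [|mW iW] := IH; first by move=> i ni; apply: H; exact: ltnW.
have [j Wj] := H n (ltnSn n).
have WX : Tn s w n @` W `<=` Zstar s (thetan s n w) j `&` Xw s (thetan s n w).
  by move=> y Wy; split; [exact: Wj|exact: iW.1].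
have -> : Tn s w n.+1 = Tw s (thetan s n w) \o Tn s w n by [].
split.
  apply: smono_comp => //.
  by apply: (smonoS Wj); exact: branch_smono.
rewrite -image_comp; apply: (@interval_in_image _ (Zstar s (thetan s n w) j `&` Xw s (thetan s n w))).
- by apply: (@smonoS _ (Zstar s (thetan s n w) j)); [exact: subIsetl|exact: branch_smono].
- exact: branch_image.
- split=> // x y z Wx Wy [_ Xz]; exact: iW.2.
Qed.

(* A nondegenerate interval meets some Z*_i in a nondegenerate interval, as
   the Z*_i cover all but a null set and a countable set is null. *)
Lemma branch_inside w p q : lo s <= p -> p < q -> q <= hi s ->
  exists i u v, [/\ Zstar s w i u, Zstar s w i v, u < v, p < u & v < q].
Proof.
move=> lop pq qhi; apply: contrapT => H.
pose C := \bigcup_i (Zstar s w i `&` `]p, q[%classic).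
have cC : countable C.
  apply: bigcup_countable => // i _.
  have [[x [Zx xpq]]|/set0P/negP/negPn/eqP ->] :=
    pselect (Zstar s w i `&` `]p, q[%classic !=set0); last exact: countable0.
  apply: (@sub_countable _ _ _ [set x]); last exact: countable1.
  apply: subset_card_le => y [Zy ypq]; apply: contrapT => yx.
  move: xpq ypq; rewrite /= !in_itv /= => /andP[px xq] /andP[py yq].
  have /orP[h|h] : (x < y) || (y < x) by rewrite -neq_lt; apply/eqP => E; apply: yx.
  - by apply: H; exists i, x, y.
  - by apply: H; exists i, y, x.
have mZ : measurable (\bigcup_i Zstar s w i).
  by apply: bigcup_measurable => i _; apply: is_interval_measurable; have [] := map_branch_interval hmap w i.
have mC : measurable C.
  apply: bigcup_measurable => i _; apply: measurableI => //.
  by apply: is_interval_measurable; have [] := map_branch_interval hmap w i.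
have mN : measurable (Ivl s `\` \bigcup_i Zstar s w i) by apply: measurableD => //; exact: measurable_itv.
have sub : `]p, q[%classic `<=` (Ivl s `\` \bigcup_i Zstar s w i) `|` C.
  move=> x xpq; have [[i _ Zx]|nZ] := pselect ((\bigcup_i Zstar s w i) x).
    by right; exists i.
  left; split=> //; move: xpq; rewrite /Ivl /= !in_itv /= => /andP[px xq].
  by rewrite (le_trans lop (ltW px)) (le_trans (ltW xq) qhi).
have : (lebesgue_measure (`]p, q[%classic : set R) <= 0)%E.
  apply: (@le_trans _ _ (lebesgue_measure ((Ivl s `\` \bigcup_i Zstar s w i) `|` C))).
    by apply: le_measure => //; rewrite inE //; exact: measurableU.
  apply: (le_trans (measureU2 _ _ _)) => //.
  apply: (@le_trans _ _ (0 + 0)%E); last by rewrite adde0.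
  apply: leeD; rewrite le_eqVlt; apply/orP; left; apply/eqP.
    exact: (map_branch_cover hmap w).
  exact: countable_lebesgue_measure0.
rewrite lebesgue_measure_itv /= lte_fin pq -EFinB lee_fin subr_le0.
by rewrite leNgt pq.
Qed.

Let good_seg w k (uv : R * R) := [/\ uv.1 < uv.2, lo s <= uv.1, uv.2 <= hi s,
  strictly_monotone_on `[uv.1, uv.2]%classic (Tn s w k) &
  is_interval (Tn s w k @` `[uv.1, uv.2]%classic)].

(** One step of the nested construction for [Xw_dense]: the image of the segment under T^k contains
    a nondegenerate piece of some Z*_i, and the new segment is pulled back from the inside of that
    piece. *)
Let good_segS w k uv : good_seg w k uv -> exists uv', [/\ good_seg w k.+1 uv',
  uv.1 < uv'.1, uv'.2 < uv.2 &
  forall t, uv'.1 <= t -> t <= uv'.2 -> ~ Dw s (thetan s k w) (Tn s w k t)].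
Proof.
case: uv => u v [/= uv lou vhi mT iT].
pose W := `[u, v]%classic.
have Wu : W u by rewrite /W /= in_itv /= lexx (ltW uv).
have Wv : W v by rewrite /W /= in_itv /= lexx (ltW uv).
have WI x : W x -> Ivl s x.
  rewrite /W /Ivl /= !in_itv /= => /andP[ux xv].
  by rewrite (le_trans lou ux) (le_trans xv vhi).
pose p := Order.min (Tn s w k u) (Tn s w k v).
pose q := Order.max (Tn s w k u) (Tn s w k v).
have Tuv : Tn s w k u != Tn s w k v.
  by apply/eqP => /(smono_inj mT Wu Wv) E; move: uv; rewrite E ltxx.
have pq : p < q.
  by rewrite /p /q lt_max !gt_min !ltxx /= orbF orbC -neq_lt.
have lop : lo s <= p.
  by rewrite /p le_min; have := Tn_Ivl w k (WI u Wu); have := Tn_Ivl w k (WI v Wv);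
    rewrite /Ivl /= !in_itv /= => /andP[-> _] /andP[-> _].
have qhi : q <= hi s.
  by rewrite /q ge_max; have := Tn_Ivl w k (WI u Wu); have := Tn_Ivl w k (WI v Wv);
    rewrite /Ivl /= !in_itv /= => /andP[_ ->] /andP[_ ->].
have [i [a [b [Za Zb ab pa bq]]]] := branch_inside (thetan s k w) lop pq qhi.
(* The middle third keeps the closed image [c, e] strictly between two points of Z*_i, where
   [interior_notD] applies up to the ends. *)
pose c := a + (b - a) / 3%:R; pose e := b - (b - a) / 3%:R.
have ac : a < c by rewrite /c; lra.
have ce : c < e by rewrite /c /e; lra.
have eb : e < b by rewrite /e; lra.
have im z : p <= z <= q -> exists2 t, W t & Tn s w k t = z.
  move=> /andP[pz zq].
  have Tp : (Tn s w k @` W) p by rewrite /p minEle; case: ifP => _; [exists u|exists v].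
  have Tq : (Tn s w k @` W) q by rewrite /q maxEle; case: ifP => _; [exists v|exists u].
  by have [|t Wt <-] := iT p q Tp Tq z; [rewrite pz zq|exists t].
have [c' Wc' c'E] := im c ltac:(by rewrite (ltW (lt_trans pa ac)) (ltW (lt_trans ce (lt_trans eb bq)))).
have [e' We' e'E] := im e ltac:(by rewrite (ltW (lt_trans pa (lt_trans ac ce))) (ltW (lt_trans eb bq))).
have ne x : W x -> p < Tn s w k x -> Tn s w k x < q -> u < x /\ x < v.
  move=> Wx px xq; split.
  - have : W x := Wx; rewrite /W /= in_itv /= le_eqVlt => /andP[/orP[/eqP E|//] _].
    by move: px xq Tuv; rewrite -E /p /q neq_lt gt_min lt_max !ltxx /= => h1 h2; rewrite ltNge (ltW h1) ltNge (ltW h2).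
  - have : W x := Wx; rewrite /W /= in_itv /= [x <= v]le_eqVlt => /andP[_ /orP[/eqP E|//]].
    by move: px xq Tuv; rewrite E /p /q neq_lt gt_min lt_max !ltxx !orbF /= => h1 h2; rewrite ltNge (ltW h2) ltNge (ltW h1).
have [uc cv] : u < c' /\ c' < v.
  by apply: ne => //; rewrite c'E; [exact: lt_trans ac|exact: lt_trans ce (lt_trans eb bq)].
have [ue ev] : u < e' /\ e' < v.
  by apply: ne => //; rewrite e'E; [exact: lt_trans (lt_trans ac ce)|exact: lt_trans eb bq].
pose u' := Order.min c' e'; pose v' := Order.max c' e'.
have c'e' : c' != e' by apply: contraTneq ce => E; rewrite -c'E -e'E E ltxx.
have u'v' : u' < v' by rewrite /u' /v' lt_max !gt_min !ltxx /= orbF orbC -neq_lt.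
have uu' : u < u' by rewrite /u' lt_min uc ue.
have v'v : v' < v by rewrite /v' gt_max cv ev.
have W'W : `[u', v']%classic `<=` W.
  move=> x; rewrite /W /= !in_itv /= => /andP[ux xv].
  by rewrite (le_trans (ltW uu') ux) (le_trans xv (ltW v'v)).
have rng t : `[u', v']%classic t -> c <= Tn s w k t <= e.
  move=> Wt; have WWt := W'W _ Wt; move: Wt; rewrite /= in_itv /= => /andP[].
  case: (mT) => mT'.
  - have M x y : W x -> W y -> x <= y -> Tn s w k x <= Tn s w k y.
      move=> Wx Wy; rewrite le_eqVlt => /orP[/eqP -> //|xy].
      by apply/ltW/mT' => //; rewrite inE.
    rewrite /u' /v'; case: (ltgtP c' e') c'e' => //= h _.
    + by move=> ct te; rewrite -c'E -e'E !M.
    + have := M e' c' We' Wc' (ltW h); rewrite c'E e'E; move: ce; rewrite ltNge; by move=> /negP.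
  - have M x y : W x -> W y -> x <= y -> Tn s w k y <= Tn s w k x.
      move=> Wx Wy; rewrite le_eqVlt => /orP[/eqP -> //|xy].
      by apply/ltW/mT' => //; rewrite inE.
    rewrite /u' /v'; case: (ltgtP c' e') c'e' => //= h _.
    + have := M c' e' Wc' We' (ltW h); rewrite c'E e'E; move: ce; rewrite ltNge; by move=> /negP.
    + by move=> ct te; rewrite -c'E -e'E !M.
have ZZ t : `[u', v']%classic t -> Zstar s (thetan s k w) i (Tn s w k t).
  move=> /rng /andP[ct te].
  apply: ((map_branch_interval hmap (thetan s k w) i).1 a b) => //.
  by rewrite (le_trans (ltW ac) ct) (le_trans te (ltW eb)).
have mB := branch_smono (thetan s k w) i.
exists (u', v'); split => //=; last first.
  move=> t ut tv; have /rng/andP[ct te] : `[u', v']%classic t by rewrite /= in_itv /= ut tv.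
  by apply: (interior_notD Za Zb); [exact: lt_le_trans ct|exact: le_lt_trans eb].
split => //=.
- exact: le_trans lou (ltW uu').
- exact: le_trans (ltW v'v) vhi.
- apply: (@smono_comp _ _ (Tn s w k) (Tw s (thetan s k w))).
    exact: smonoS W'W mT.
  apply: smonoS mB; by move=> _ [t Wt <-]; exact: ZZ.
- rewrite -(image_comp (Tn s w k) (Tw s (thetan s k w))).
  have iW' : interval_in setT (Tn s w k @` `[u', v']%classic).
    apply: (@interval_in_image _ W) => //; first exact/is_intervalT.
    split=> // x y z; rewrite /= !in_itv /= => /andP[ux _] /andP[_ yv] _ xz zy.
    by rewrite (le_trans ux xz) (le_trans zy yv).
  apply/is_intervalT; apply: (@interval_in_image _ (Zstar s (thetan s k w) i)) => //.
    by apply/is_intervalT; have [] := map_branch_monotone hmap (thetan s k w) i.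
  split; first by move=> _ [t Wt <-]; exact: ZZ.
  by move=> x y z Wx Wy _; exact: iW'.2.
Qed.

(* The singular set cannot fill an interval: nested compact intervals are mapped
   by T^k_w into the interior of an element of Z*, and a common point of them
   is in X_w. *)
Lemma Xw_dense w p q : lo s <= p -> p < q -> q <= hi s ->
  exists x, [/\ Xw s w x, p < x & x < q].
Proof.
move=> lop pq qhi.
have g0 : good_seg w 0 (p, q).
  split=> //=; first by left.
  rewrite image_id => x y; rewrite /= !in_itv /= => /andP[ux _] /andP[_ yv] z /andP[xz zy].
  by rewrite /= in_itv /= (le_trans ux xz) (le_trans zy yv).
(* The time k travels with the segment, so that the k-th step of the dependent choice avoids D at
   time k. Strict nesting puts the limit point strictly between p and q. *)
pose T := {kuv : nat * (R * R) | good_seg w kuv.1 kuv.2}.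
pose nxt (a b : T) := [/\ (sval b).1 = (sval a).1.+1,
  (sval a).2.1 < (sval b).2.1, (sval b).2.2 < (sval a).2.2 &
  forall t, (sval b).2.1 <= t -> t <= (sval b).2.2 ->
    ~ Dw s (thetan s (sval a).1 w) (Tn s w (sval a).1 t)].
have [a|f [f0 fS]] := @dependent_choice T nxt _ (exist _ (0%N, (p, q)) g0).
  case: a => -[k uv] /= Hk; apply: cid.
  by have [uv' [H1 H2 H3 H4]] := good_segS Hk; exists (exist _ (k.+1, uv') H1).
have fk k : (sval (f k)).1 = k.
  by elim: k => [|k IH]; [rewrite f0|have [-> _ _ _] := fS k; rewrite IH].
pose u k := (sval (f k)).2.1; pose v k := (sval (f k)).2.2.
have uS k : u k < u k.+1 by have [] := fS k.
have vS k : v k.+1 < v k by have [] := fS k.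
have uv k : u k < v k by rewrite /u /v; case: (f k) => -[j uv] [].
have umono j k : u j <= u (j + k)%N.
  by elim: k => [|k IH]; rewrite ?addn0 // addnS (le_trans IH) // ltW.
have vmono j k : v (j + k)%N <= v j.
  by elim: k => [|k IH]; rewrite ?addn0 // addnS (le_trans _ IH) // ltW.
have uvjk j k : u j <= v k.
  apply: (le_trans (umono j k)); apply: (le_trans (ltW (uv _))).
  by rewrite addnC.
pose x := sup (range u).
have ux k : u k <= x by apply: ub_le_sup; [exists (v 0%N) => _ [j _ <-]|exists k].
have xv k : x <= v k by apply: ge_sup; [exists (u 0%N), 0%N|move=> _ [j _ <-]].
have u0 : u 0%N = p by rewrite /u f0.
have v0 : v 0%N = q by rewrite /v f0.
have px : p < x by rewrite -u0; exact: lt_le_trans (uS 0%N) (ux 1%N).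
have xq : x < q by rewrite -v0; exact: le_lt_trans (xv 1%N) (vS 0%N).
exists x; split=> //; apply/XwP; split.
  by rewrite /Ivl /= in_itv /= (le_trans lop (ltW px)) (le_trans (ltW xq) qhi).
by move=> k; have [_ _ _] := fS k; rewrite fk; apply; [exact: ux|exact: xv].
Qed.

End system.

(** * The transfer operators as finite sums *)

Lemma set_sum_finite (R : realType) (A : set R) (f : R -> R) :
  finite_set A -> set_sum A f = \sum_(y <- finmap.enum_fset (fset_set A)) f y.
Proof.
move=> fA; rewrite /set_sum !esum_fset //; last 2 first.
- by move=> y _; rewrite lee_fin /funrneg le_max lexx orbT.
- by move=> y _; rewrite lee_fin /funrpos le_max lexx orbT.
rewrite !fsumEFin // !fsbig_finite //= -sumrB.
by apply: eq_bigr => y _; rewrite -[in RHS](funrposBneg f).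
Qed.

Section operators.
Context {R : realType} {d : measure_display} {Omega : measurableType d}.
Variables (P : probability Omega R) (s : open_system R Omega).
Variables (a b : R) (U Ut : Omega -> nat -> set (set R)).
Hypothesis hmap : map_assumptions s.
Hypothesis hpot : potential_assumptions P s.
Hypothesis hpart : partition_assumptions P s a b U Ut.
Implicit Types (w : Omega) (n i k : nat) (x y z : R) (f g : R -> R) (W Z : set R).

Lemma Zn_branch w n Z : Zn s w n Z -> forall i, (i < n)%N ->
  exists j, Tn s w i @` Z `<=` Zstar s (thetan s i w) j.
Proof.
move=> [_ [B HB ->]] i ni; have [_ [j Bj]] := HB i ni.
by exists j => _ [x [_ /(_ i ni)] Bx <-]; move: Bx; rewrite Bj => -[].
Qed.

Lemma Ut_spec w n : (1 <= n)%N -> adapted_partition s w n (U w n) (Ut w n).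
Proof. by move=> n1; have [] := part_Ut hpart w n1. Qed.

Lemma Ut_interval w n Z : (1 <= n)%N -> Ut w n Z -> interval_in (Xw s w) Z.
Proof. by move=> n1 UZ; have [_ [_ H] _ _ _] := Ut_spec w n1; exact: H. Qed.

Lemma Ut_branch w n Z : (1 <= n)%N -> Ut w n Z ->
  strictly_monotone_on Z (Tn s w n) /\
  interval_in (Xw s (thetan s n w)) (Tn s w n @` Z).
Proof.
move=> n1 UZ; apply: (Tn_branch hmap); first exact: Ut_interval UZ.
move=> i ni; have [_ _ /(_ _ UZ)[Z' ZZ' sub] _ _] := Ut_spec w n1.
have [j H] := Zn_branch ZZ' ni; exists j.
by move=> _ [x Zx <-]; apply: H; exists x => //; exact: sub.
Qed.

(** Although there may be infinitely many branches, the finite partition [Ut w 1] refines them, and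
    T_w is injective on each of its cells. This turns the operators into finite sums. *)
Lemma preimage_finite w x : finite_set [set y | Xw s w y /\ Tw s w y = x].
Proof.
have [fU [[cU _ _] _] _ _ _] := Ut_spec w (leqnn 1).
rewrite (_ : mkset _ = \bigcup_(Z in Ut w 1%N) (Z `&` [set y | Xw s w y /\ Tw s w y = x])).
  apply: bigcup_finite => // Z UZ.
  have [mZ _] := Ut_branch (leqnn 1) UZ.
  have [[y [Zy [Xy Ty]]]|/set0P/negP/negPn/eqP ->] :=
    pselect (Z `&` [set y | Xw s w y /\ Tw s w y = x] !=set0); last exact: finite_set0.
  apply: sub_finite_set (finite_set1 y) => z [Zz [Xz Tz]].
  by apply: (smono_inj mZ Zz Zy) => /=; rewrite Tz Ty.
apply/seteqP; split=> [y [Xy Ty]|y [Z _ [_]]] //.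
have : (cover (Ut w 1) id) y by rewrite cU.
by move=> [Z UZ Zy]; exists Z.
Qed.

Definition preimages w x : seq R := finmap.enum_fset (fset_set [set y | Xw s w y /\ Tw s w y = x]).

Lemma mem_preimages w x y : y \in preimages w x <-> Xw s w y /\ Tw s w y = x.
Proof.
by rewrite /preimages in_fset_set ?inE //; exact: preimage_finite.
Qed.

Lemma preimages_uniq w x : uniq (preimages w x).
Proof. exact: finmap.fset_uniq. Qed.

Lemma LcE w f x : Lc s w f x = \sum_(y <- preimages w x) f y * g1 s w y.
Proof. by rewrite /Lc set_sum_finite //; exact: preimage_finite. Qed.

Lemma g1_ge0 w x : 0 <= g1 s w x.
Proof. by rewrite fine_ge0 // expeR_ge0. Qed.

Lemma indic_ge0 W x : 0 <= \1_W x :> R. Proof. by rewrite indicE; case: (x \in W). Qed.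

Lemma indic_sqr W x : \1_W x * \1_W x = \1_W x :> R.
Proof. by rewrite indicE; case: (x \in W); rewrite ?mulr1 ?mulr0. Qed.

Lemma indicT W x : W x -> \1_W x = 1 :> R.
Proof. by move=> Wx; rewrite indicE mem_set. Qed.

Lemma indicN W x : ~ W x -> \1_W x = 0 :> R.
Proof. by move=> Wx; rewrite indicE memNset. Qed.

Lemma LopenE w f x :
  Lopen s w f x = \sum_(y <- preimages w x) f y * (\1_(Jw s w) y * g1 s w y).
Proof. by rewrite /Lopen LcE; apply: eq_bigr => y _; rewrite mulrA. Qed.

Lemma kernel_ge0 w y : 0 <= \1_(Jw s w) y * g1 s w y.
Proof. by rewrite mulr_ge0 ?indic_ge0 ?g1_ge0. Qed.

Lemma Lopen_le w f g : (forall y, Xw s w y -> f y <= g y) ->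
  forall x, Lopen s w f x <= Lopen s w g x.
Proof.
move=> fg x; rewrite !LopenE big_seq [leRHS]big_seq; apply: ler_sum => y.
by move=> /mem_preimages[Xy _]; rewrite ler_wpM2r ?kernel_ge0 ?fg.
Qed.

Lemma Ln_le w n f g : (forall y, Xw s w y -> f y <= g y) ->
  forall x, Xw s (thetan s n w) x -> Ln s w n f x <= Ln s w n g x.
Proof. by move=> fg; elim: n => [|n IH] // x _; exact: Lopen_le. Qed.

Lemma eq_Ln w n f g : (forall y, Xw s w y -> f y = g y) ->
  forall x, Xw s (thetan s n w) x -> Ln s w n f x = Ln s w n g x.
Proof.
move=> fg x Xx; apply/eqP; rewrite eq_le; apply/andP; split.
- by apply: Ln_le Xx => y Xy; rewrite fg.
- by apply: Ln_le Xx => y Xy; rewrite fg.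
Qed.

Lemma LnZ w n c f x : Ln s w n (fun y => c * f y) x = c * Ln s w n f x.
Proof.
elim: n x => [|n IH] // x; rewrite [LHS]/= [in RHS]/= !LopenE mulr_sumr.
by apply: eq_bigr => y _; rewrite IH mulrA.
Qed.

Lemma Ln_sum (I : eqType) (r : seq I) (p : pred I) w n (F : I -> R -> R) x :
  Ln s w n (fun y => \sum_(i <- r | p i) F i y) x = \sum_(i <- r | p i) Ln s w n (F i) x.
Proof.
elim: n x => [|n IH] // x; rewrite [LHS]/= LopenE.
under [RHS]eq_bigr => i _ do rewrite [Ln _ _ _ _ _]/= LopenE.
rewrite exchange_big /=; apply: eq_bigr => y _.
by rewrite IH mulr_suml.
Qed.

Lemma Ln0 w n x : Ln s w n (cst 0) x = 0.
Proof. by elim: n x => // n IH x /=; rewrite LopenE big1 // => y _; rewrite IH mul0r. Qed.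

Lemma Ln_ge0 w n f : (forall y, Xw s w y -> 0 <= f y) ->
  forall x, Xw s (thetan s n w) x -> 0 <= Ln s w n f x.
Proof. by move=> f0 x Xx; rewrite -(Ln0 w n x); exact: Ln_le. Qed.

Lemma Ln_add w m n f : Ln s (thetan s m w) n (Ln s w m f) = Ln s w (n + m) f.
Proof. by elim: n => [|n IH] //=; rewrite IH thetan_add. Qed.

Lemma g1_bounded w : exists M, forall x, Ivl s x -> g1 s w x <= M.
Proof.
have [[M HM] _] := pot_BV hpot w; exists M => x /HM.
by apply: le_trans; exact: ler_norm.
Qed.

Lemma g1_gt0 w x : Xw s w x -> 0 < g1 s w x.
Proof.
move=> Xx; have [i _ Zx] := map_Z1_cover hmap Xx.
have Z1x : Z1 s w (Zstar s w i `&` Xw s w) by split; [exists x|exists i].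
apply: (lt_le_trans (pot_inf_gt0 hpot Z1x)); apply: ge_inf; last by exists x.
by exists 0 => _ [y _ <-]; exact: g1_ge0.
Qed.

Lemma expeR_phi_fin w x : Ivl s x -> expeR (phi s w x) \is a fin_num.
Proof.
move=> Ix; rewrite ge0_fin_numE ?expeR_ge0 //.
by have := pot_lty hpot w Ix; case: (phi s w x) => //= r _; rewrite ltry.
Qed.

Lemma gcn0 w x : gcn s w 0 x = 1.
Proof. by rewrite /gcn big_ord0 expeR0. Qed.

Lemma gcn_fin w n x : Ivl s x ->
  expeR (\sum_(i < n) phi s (thetan s i w) (Tn s w i x))%E \is a fin_num.
Proof.
move=> Ix; elim: n => [|n IH]; first by rewrite big_ord0 expeR0.
by rewrite big_ord_recr /= expeRD fin_numM // expeR_phi_fin //; exact: Tn_Ivl.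
Qed.

Lemma gcnS w n x : Ivl s x ->
  gcn s w n.+1 x = gcn s w n x * g1 s (thetan s n w) (Tn s w n x).
Proof.
move=> Ix; rewrite /gcn big_ord_recr /= expeRD fineM ?gcn_fin //.
by apply: expeR_phi_fin; exact: Tn_Ivl.
Qed.

Lemma gcn_ge0 w n x : 0 <= gcn s w n x.
Proof. by rewrite fine_ge0 // expeR_ge0. Qed.

Lemma gcn_gt0 w n x : Xw s w x -> 0 < gcn s w n x.
Proof.
move=> Xx; have Ix : Ivl s x by case: Xx.
elim: n => [|n IH]; first by rewrite gcn0.
by rewrite gcnS // mulr_gt0 // g1_gt0 //; exact: Tn_X.
Qed.

Lemma gcn_bounded w n : exists M, forall x, Ivl s x -> gcn s w n x <= M.
Proof.
elim: n => [|n [M HM]]; first by exists 1 => x _; rewrite gcn0.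
have [N HN] := g1_bounded (thetan s n w); exists (M * N) => x Ix.
by rewrite gcnS // ler_pM ?gcn_ge0 ?g1_ge0 ?HM ?HN //; exact: Tn_Ivl.
Qed.

(* K_{w,n-1}, also meaningful for n = 0. *)
Definition Kn w n : set R :=
  [set x | Xw s w x /\ forall i, (i < n)%N -> Jw s (thetan s i w) (Tn s w i x)].

Lemma KnE w n : (1 <= n)%N -> Kn w n = Kw s w n.-1.
Proof. by case: n. Qed.

(** For f supported on a set where T^n is injective, the sum defining L^n f has at most one nonzero
    term, given by the survivor in [W] if there is one. *)
Lemma Ln_branch w n f W : W `<=` Xw s w -> strictly_monotone_on W (Tn s w n) ->
  (forall y, Xw s w y -> ~ W y -> f y = 0) ->
  (forall z, W z -> Kn w n z -> Ln s w n f (Tn s w n z) = f z * gcn s w n z) /\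
  (forall x, Xw s (thetan s n w) x ->
     ~ (Tn s w n @` (W `&` Kn w n)) x -> Ln s w n f x = 0).
Proof.
move=> WX mW f0.
(* A collision at time i persists until time n; stating injectivity for all i <= n makes the
   induction on n possible. *)
have inj i y z : (i <= n)%N -> W y -> W z -> Tn s w i y = Tn s w i z -> y = z.
  move=> ni Wy Wz E; apply: (smono_inj mW Wy Wz).
  rewrite -(subnK ni); elim: (n - i)%N => [|k IH] //=.
  by rewrite IH.
elim: n {mW} inj => [|n IH] inj.
  split=> [z _ _|x Xx H] /=; first by rewrite gcn0 mulr1.
  apply: f0 => // Wx; apply: H; exists x => //; split=> //; split=> //.
have [|IH1 IH2] := IH; first by move=> i y z ni; apply: inj; exact: leqW.
have main y x : Xw s (thetan s n w) y -> Tw s (thetan s n w) y = x ->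
    Ln s w n f y * (\1_(Jw s (thetan s n w)) y * g1 s (thetan s n w) y) != 0 ->
    exists z, [/\ W z, Kn w n.+1 z, y = Tn s w n z & x = Tn s w n.+1 z].
  move=> Xy Ty nz.
  have Jy : Jw s (thetan s n w) y.
    by apply: contrapT => nJ; move: nz; rewrite indicN // mul0r mulr0 eqxx.
  have [z [Wz [Xz Kz]] zy] : (Tn s w n @` (W `&` Kn w n)) y.
    by apply: contrapT => H; move: nz; rewrite IH2 // mul0r eqxx.
  exists z; split=> //; last by rewrite /= zy Ty.
  split=> // i; rewrite ltnS leq_eqVlt => /orP[/eqP -> |/Kz //].
  by rewrite zy.
split=> [z Wz Kz|x Xx H].
- have [Xz Kz'] := Kz.
  have Kz0 : Kn w n z by split=> // i ni; apply: Kz'; exact: ltnW.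
  have zpre : Tn s w n z \in preimages (thetan s n w) (Tn s w n.+1 z).
    by apply/mem_preimages; split=> //; exact: Tn_X.
  rewrite [LHS]/= LopenE (bigD1_seq _ zpre (preimages_uniq _ _)) /= big_seq_cond.
  rewrite big1 ?addr0 => [|y /andP[/mem_preimages[Xy Ty] yz]].
    rewrite IH1 // indicT; last exact: Kz'.
    by rewrite mul1r gcnS ?mulrA //; case: Xz.
  apply/eqP/negPn/negP => nz; have [z' [Wz' Kz'1 yE xE]] := main _ _ Xy Ty nz.
  by move: yz; rewrite yE (inj n.+1 z' z) ?eqxx //.
- rewrite [LHS]/= LopenE big_seq big1 // => y /mem_preimages[Xy Ty].
  apply/eqP/negPn/negP => nz; have [z [Wz Kz yE xE]] := main _ _ Xy Ty nz.
  by apply: H; exists z.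
Qed.

Lemma has_sup_norm W f M : (forall x, W x -> `|f x| <= M) ->
  forall x, W x -> `|f x| <= supnorm W f.
Proof.
move=> HM x Wx; apply: ub_le_sup; last by exists x.
by exists M => _ [y Wy <-]; exact: HM.
Qed.

Lemma gcn_le_norm w n x : (1 <= n)%N -> Kw s w n.-1 x -> gcn s w n x <= open_gnorm s w n.
Proof.
move=> n1 Kx; apply: (le_trans (ler_norm _)).
have [M HM] := gcn_bounded w n.
apply: (@has_sup_norm _ _ M) => // y [[Iy _] _].
by rewrite ger0_norm ?gcn_ge0 ?HM.
Qed.

Lemma open_gnorm_ge0 w n : 0 <= open_gnorm s w n.
Proof.
have [M HM] := gcn_bounded w n; rewrite /open_gnorm /supnorm /supremum_on.
have [[x Kx]|/set0P/negP/negPn/eqP ->] := pselect (Kw s w n.-1 !=set0); last first.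
  by rewrite image_set0 sup0.
apply: (le_trans (normr_ge0 (gcn s w n x))).
apply: (@has_sup_norm _ _ M) => // y [[Iy _] _].
by rewrite ger0_norm ?gcn_ge0 ?HM.
Qed.

Definition cells w n : seq (set R) := finmap.enum_fset (fset_set (Ut w n)).

Lemma mem_cells w n Z : (1 <= n)%N -> Z \in cells w n <-> Ut w n Z.
Proof.
move=> n1; have [fU _ _ _ _] := Ut_spec w n1.
by rewrite /cells in_fset_set ?inE.
Qed.

Lemma cells_uniq w n : uniq (cells w n).
Proof. exact: finmap.fset_uniq. Qed.

Definition Kcells w n : seq (set R) :=
  [seq Z <- cells w n | `[< Z `<=` Kw s w n.-1 >]].

Lemma mem_Kcells w n Z : (1 <= n)%N ->
  Z \in Kcells w n <-> Ut w n Z /\ Z `<=` Kw s w n.-1.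
Proof.
move=> n1; rewrite mem_filter; split=> [/andP[/asboolP ZK /(mem_cells _ _ n1)]|] //.
by move=> [/(mem_cells _ _ n1) UZ ZK]; apply/andP; split=> //; exact/asboolP.
Qed.

Lemma Kcells_cover w n x : (1 <= n)%N -> Kw s w n.-1 x ->
  exists2 Z, Z \in Kcells w n & Z x.
Proof.
move=> n1 Kx; have [_ [[cU _ _] _] _ _ AK] := Ut_spec w n1.
have : (cover (Ut w n) id) x by rewrite cU; case: Kx.
move=> [Z UZ Zx]; exists Z => //; apply/mem_Kcells => //; split=> //.
by have [//|E] := AK _ UZ; have : (Z `&` Kw s w n.-1) x by []; rewrite E.
Qed.

Lemma Ut_disjoint w n Z Z' x : (1 <= n)%N -> Ut w n Z -> Ut w n Z' -> Z x -> Z' x -> Z = Z'.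
Proof.
move=> n1 UZ UZ' Zx Z'x; have [_ [[_ tU _] _] _ _ _] := Ut_spec w n1.
by apply: (tU Z Z') => //; exists x.
Qed.

(** A cell that is not contained in K_{w,n-1} is disjoint from it, so what f carries there falls
    into the hole before time n. *)
Lemma Ln_cells w n f x : (1 <= n)%N -> Xw s (thetan s n w) x ->
  Ln s w n f x = \sum_(Z <- Kcells w n) Ln s w n (fun y => f y * \1_Z y) x.
Proof.
move=> n1 Xx; have [_ [[cU _ _] _] _ _ AK] := Ut_spec w n1.
rewrite (@eq_Ln w n f (fun y => \sum_(Z <- cells w n) f y * \1_Z y)) // => [|y Xy].
  rewrite (Ln_sum _ _ w n (fun (Z : set R) y => f y * \1_Z y)) /Kcells big_filter.
  rewrite [RHS]big_mkcond /= big_seq [RHS]big_seq; apply: eq_bigr => Z /(mem_cells _ _ n1) UZ.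
  case: asboolP => // nK.
  have [mZ iZ] := Ut_branch n1 UZ.
  have [|ZK] := AK _ UZ; first by move=> /nK.
  have [_ H] := @Ln_branch w n (fun y => f y * \1_Z y) Z (Ut_interval n1 UZ).1 mZ
    (fun y _ nZ => etrans (congr1 _ (indicN nZ)) (mulr0 _)).
  apply: H => // -[y [Zy Ky] _]; move: Ky; rewrite KnE // => Ky.
  by have : (Z `&` Kw s w n.-1) y by []; rewrite ZK.
have : (cover (Ut w n) id) y by rewrite cU.
move=> [Z UZ Zy].
rewrite (bigD1_seq Z _ (cells_uniq _ _)) /=; last exact/mem_cells.
rewrite big_seq_cond big1 ?addr0; first by rewrite indicT ?mulr1.
move=> Z' /andP[/(mem_cells _ _ n1) UZ' /eqP ne]; rewrite indicN ?mulr0 // => Z'y; apply: ne.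
exact: Ut_disjoint UZ' UZ Z'y Zy.
Qed.

Lemma Ln_cell w n f Z : (1 <= n)%N -> Z \in Kcells w n ->
  (forall z, Z z -> Ln s w n (fun y => f y * \1_Z y) (Tn s w n z) = f z * gcn s w n z) /\
  (forall x, Xw s (thetan s n w) x -> ~ (Tn s w n @` Z) x ->
     Ln s w n (fun y => f y * \1_Z y) x = 0).
Proof.
move=> n1 /(mem_Kcells _ _ n1)[UZ ZK].
have [mZ iZ] := Ut_branch n1 UZ.
have [H1 H2] := @Ln_branch w n (fun y => f y * \1_Z y) Z (Ut_interval n1 UZ).1 mZ
    (fun y _ nZ => etrans (congr1 _ (indicN nZ)) (mulr0 _)).
split=> [z Zz|x Xx nx].
  by rewrite H1 ?KnE ?indicT ?mulr1 //; exact: ZK.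
by apply: H2 => // -[z [Zz _] zx]; apply: nx; exists z.
Qed.

Lemma Ln_cell_le w n f Z (M : R) x : (1 <= n)%N -> Z \in Kcells w n ->
  Xw s (thetan s n w) x -> 0 <= M -> (forall z, Z z -> `|f z| <= M) ->
  `|Ln s w n (fun y => f y * \1_Z y) x| <= M * open_gnorm s w n.
Proof.
move=> n1 ZK Xx M0 fM; have [H1 H2] := Ln_cell f n1 ZK.
have [[z Zz <-]|nx] := pselect ((Tn s w n @` Z) x); last first.
  by rewrite H2 // normr0 mulr_ge0 // open_gnorm_ge0.
rewrite H1 // normrM ler_pM ?fM // ger0_norm ?gcn_ge0 // gcn_le_norm //.
by move/(mem_Kcells _ _ n1): ZK => [_]; exact.
Qed.

Lemma Ln_bound w n f (M : R) x : (1 <= n)%N -> Xw s (thetan s n w) x -> 0 <= M ->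
  (forall z, Kw s w n.-1 z -> `|f z| <= M) ->
  `|Ln s w n f x| <= (size (Kcells w n))%:R * (M * open_gnorm s w n).
Proof.
move=> n1 Xx M0 fM; rewrite Ln_cells // (le_trans (ler_norm_sum _ _ _)) //.
have -> : (size (Kcells w n))%:R * (M * open_gnorm s w n) =
    \sum_(Z <- Kcells w n) (M * open_gnorm s w n).
  by rewrite big_const_seq count_predT iter_addr addr0 mulr_natl.
rewrite big_seq [leRHS]big_seq; apply: ler_sum => Z ZK.
apply: Ln_cell_le => // z Zz; apply: fM.
by move/(mem_Kcells _ _ n1): ZK => [_]; exact.
Qed.

Lemma gnorm_gt0 w n : (1 <= n)%N -> Kw s w n.-1 !=set0 -> 0 < open_gnorm s w n.
Proof.
move=> n1 [x Kx]; apply: (@lt_le_trans _ _ (gcn s w n x)); first by apply: gcn_gt0; case: Kx.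
exact: gcn_le_norm.
Qed.

End operators.

(** * The functional F *)

Section functional.
Context {R : realType} {d : measure_display} {Omega : measurableType d}.
Variables (P : probability Omega R) (s : open_system R Omega).
Variables (nu : R.-pker Omega ~> R).
Variables (a b : R) (U Ut : Omega -> nat -> set (set R)).
Hypothesis hbase : base_assumptions P s.
Hypothesis hmap : map_assumptions s.
Hypothesis hpot : potential_assumptions P s.
Hypothesis hhole : hole_assumptions P s nu.
Hypothesis hF : functional_assumptions P s.
Hypothesis hpart : partition_assumptions P s a b U Ut.
Implicit Types (w : Omega) (n i k : nat) (x y z : R) (f g : R -> R) (W Z : set R).

Let Lopen_le := Lopen_le hmap hpart.
Let Ln_le := Ln_le hmap hpart.
Let LnZ := LnZ hmap hpart.
Let Ln_ge0 := Ln_ge0 hmap hpart.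

Lemma thetanK n w : thetaVn s n (thetan s n w) = w.
Proof.
elim: n w => [|n IH] w //; rewrite /thetaVn iterSr -/(thetaVn s n _) /thetan /=.
by rewrite (base_thetaK hbase); exact: IH.
Qed.

Lemma thetaVnK n w : thetan s n (thetaVn s n w) = w.
Proof.
elim: n w => [|n IH] w //; rewrite /thetan iterSr -/(thetan s n _) /thetaVn /=.
by rewrite (base_thetaVK hbase); exact: IH.
Qed.

Lemma SwE w n x : Sw s (thetan s n w) n x <->
  Xw s (thetan s n w) x /\ Ln s w n (\1_(Jw s w)) x != 0.
Proof. by rewrite /Sw /= thetanK. Qed.

Lemma Sw_neq0 w n : Sw s (thetan s n w) n !=set0.
Proof. by have [x Sx] := hole_Sinf hhole (thetan s n w); exists x; exact: Sx. Qed.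

(** Without surviving cells L^n 1 would be an empty sum, while S_{theta^n w,n} is nonempty. *)
Lemma Kw_neq0 w n : (1 <= n)%N -> Kw s w n.-1 !=set0.
Proof.
move=> n1; have [x /SwE[Xx]] := Sw_neq0 w n; rewrite (Ln_cells hmap hpot hpart) //.
have [/eqP K0|] := eqVneq (Kcells s Ut w n) [::].
  by move=> /eqP; rewrite (eqP K0) big_nil.
case E: (Kcells s Ut w n) => [|Z l] // _ _.
have : Z \in Kcells s Ut w n by rewrite E mem_head.
move/(mem_Kcells hpart _ _ n1) => [UZ ZK].
have [_ [[_ _ ne] _] _ _ _] := Ut_spec hpart w n1.
by have [y Zy] := ne _ UZ; exists y; exact: ZK.
Qed.

Lemma Ln1_ge0 w n x : Xw s (thetan s n w) x -> 0 <= Ln s w n (\1_(Jw s w)) x.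
Proof. by move=> Xx; apply: Ln_ge0 Xx => y _; exact: indic_ge0. Qed.

Lemma Ln1_gt0 w n x : Sw s (thetan s n w) n x -> 0 < Ln s w n (\1_(Jw s w)) x.
Proof. by move=> /SwE[Xx nz]; rewrite lt0r nz Ln1_ge0. Qed.

Definition ratio_inf w n f : R :=
  infimum_on (Sw s (thetan s n w) n)
             (fun x => Ln s w n f x / Ln s w n (\1_(Jw s w)) x).

(** The class on which the limit defining F is studied: it contains indicators and |f| for f in BV,
    and it is stable under the operators. *)
Definition nonneg_bounded w f := (forall x, Xw s w x -> 0 <= f x) /\
  exists M, forall x, Xw s w x -> f x <= M.

Lemma ratio_lb w n f : nonneg_bounded w f -> has_lbound
  [set Ln s w n f x / Ln s w n (\1_(Jw s w)) x | x in Sw s (thetan s n w) n].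
Proof.
move=> [f0 _]; exists 0 => _ [x Sx <-]; rewrite divr_ge0 //.
  by apply: Ln_ge0 => //; case/SwE: Sx.
by rewrite ltW // Ln1_gt0.
Qed.

Lemma ratio_inf_ge w n f c :
  (forall x, Sw s (thetan s n w) n x -> c * Ln s w n (\1_(Jw s w)) x <= Ln s w n f x) ->
  c <= ratio_inf w n f.
Proof.
move=> H; apply: lb_le_inf.
  by have [x Sx] := Sw_neq0 w n; eexists; exists x.
by move=> _ [x Sx <-]; rewrite ler_pdivlMr ?Ln1_gt0 // H.
Qed.

Lemma ratio_inf_ge0 w n f : nonneg_bounded w f -> 0 <= ratio_inf w n f.
Proof.
move=> [f0 _]; apply: ratio_inf_ge => x /SwE[Xx _]; rewrite mul0r; exact: Ln_ge0.
Qed.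

(** The product form also holds where L^n 1 vanishes, so the positive operator can be applied to it
    once more. *)
Lemma ratio_inf_le w n f x : nonneg_bounded w f -> Xw s (thetan s n w) x ->
  ratio_inf w n f * Ln s w n (\1_(Jw s w)) x <= Ln s w n f x.
Proof.
move=> nf Xx; have [E|nz] := eqVneq (Ln s w n (\1_(Jw s w)) x) 0.
  by rewrite E mulr0; apply: Ln_ge0 => //; exact: nf.1.
have Sx : Sw s (thetan s n w) n x by apply/SwE.
rewrite -ler_pdivlMr ?Ln1_gt0 //; apply: ge_inf; first exact: ratio_lb.
by exists x.
Qed.

Lemma ratio_inf_nd w f : nonneg_bounded w f -> nondecreasing_seq (fun n => ratio_inf w n f).
Proof.
move=> nf; apply/nondecreasing_seqP => n.
apply: ratio_inf_ge => x _.
rewrite -LnZ; apply: (Lopen_le (w := thetan s n w)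
  (f := Ln s w n (fun y => ratio_inf w n f * \1_(Jw s w) y)) (g := Ln s w n f)) => y Xy; rewrite LnZ; exact: ratio_inf_le.
Qed.

Lemma ratio_inf_ub w f M n : nonneg_bounded w f -> (forall x, Xw s w x -> f x <= M) ->
  ratio_inf w n.+1 f <= M.
Proof.
move=> nf fM; have [x Sx] := Sw_neq0 w n.+1; have [Xx nz] := (SwE _ _ _).1 Sx.
rewrite -(ler_pM2r (Ln1_gt0 Sx)); apply: (le_trans (ratio_inf_le nf Xx)).
rewrite -LnZ (@le_trans _ _ (Ln s w n.+1 (fun y => f y * \1_(Jw s w) y) x)) //.
  (* One application of the operator already multiplies f by 1_J; hence the successor index in the
     statement. *)
  have -> // : forall m, Ln s w m.+1 f = Ln s w m.+1 (fun y => f y * \1_(Jw s w) y).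
  elim=> [|m IH] /=; last by rewrite -[Lopen _ _ (Ln s w m f)]/(Ln s w m.+1 f) IH.
  apply/funext => y; rewrite !(LopenE hmap hpart); apply: eq_bigr => z _.
  by rewrite -!mulrA [\1_(Jw s w) z * (\1_(Jw s w) z * _)]mulrA indic_sqr.
apply: Ln_le => // y Xy; rewrite ler_wpM2r ?indic_ge0 //; exact: fM.
Qed.

Lemma ratio_inf_cvg w f : nonneg_bounded w f -> ratio_inf w n f @[n --> \oo] --> Fw s w f.
Proof.
move=> nf; apply: nondecreasing_is_cvgn; first exact: ratio_inf_nd.
have [M HM] := nf.2; exists M => _ [n _ <-].
by apply: le_trans (ratio_inf_ub n nf HM); exact: ratio_inf_nd.
Qed.

Lemma ratio_inf_leF w n f : nonneg_bounded w f -> ratio_inf w n f <= Fw s w f.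
Proof.
move=> nf; apply: nondecreasing_cvgn_le; first exact: ratio_inf_nd.
by apply/cvg_ex; eexists; exact: ratio_inf_cvg.
Qed.

Lemma Fw_ge0 w f : nonneg_bounded w f -> 0 <= Fw s w f.
Proof. by move=> nf; apply: le_trans (ratio_inf_leF 0 nf); exact: ratio_inf_ge0. Qed.

(** The infimum of a sum dominates the sum of the infima, and the limit keeps this. The one-term
    case gives [FwZ_le] and monotonicity. *)
Lemma Fw_superadditive (I : eqType) (r : seq I) (p : pred I) w f (c : I -> R) (F : I -> R -> R) :
  nonneg_bounded w f -> (forall j, p j -> 0 <= c j) -> (forall j, p j -> nonneg_bounded w (F j)) ->
  (forall x, Xw s w x -> \sum_(j <- r | p j) c j * F j x <= f x) ->
  \sum_(j <- r | p j) c j * Fw s w (F j) <= Fw s w f.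
Proof.
move=> nf c0 nF H.
apply: (@ler_cvg_to _ \oo _ R (fun n => \sum_(j <- r | p j) c j * ratio_inf w n (F j))
  (fun n => ratio_inf w n f)).
- elim: r {H} => [|j r IH].
    under eq_fun do rewrite big_nil; rewrite big_nil; exact: cvg_cst.
  case pj : (p j).
    under eq_fun do rewrite big_cons pj; rewrite big_cons pj.
    by apply: cvgD => //; apply: cvgM; [exact: cvg_cst|apply: ratio_inf_cvg; exact: nF].
  by under eq_fun do rewrite big_cons pj; rewrite big_cons pj.
- exact: ratio_inf_cvg.
- near=> n; apply: ratio_inf_ge => x Sx; have [Xx _] := (SwE _ _ _).1 Sx.
  apply: (@le_trans _ _ (Ln s w n (fun y => \sum_(j <- r | p j) c j * F j y) x)); last exact: Ln_le.
  rewrite (Ln_sum hmap hpart _ _ _ _ (fun j y => c j * F j y)) mulr_suml.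
  apply: ler_sum => j pj; rewrite LnZ -mulrA ler_wpM2l ?c0 //.
  by apply: ratio_inf_le => //; exact: nF.
Unshelve. all: by end_near.
Qed.

Lemma FwZ_le w f c : nonneg_bounded w f -> 0 <= c -> c * Fw s w f <= Fw s w (fun x => c * f x).
Proof.
move=> nf c0.
have := @Fw_superadditive unit [:: tt] xpredT w (fun x => c * f x) (fun _ => c) (fun _ => f).
rewrite !big_cons big_nil addr0; apply => //; last by move=> x _; rewrite big_cons big_nil addr0.
split=> [x Xx|]; first by rewrite mulr_ge0 //; exact: nf.1.
by have [M HM] := nf.2; exists (c * M) => x /HM h; rewrite ler_wpM2l.
Qed.

Lemma nonneg_bounded_Ln w n f : nonneg_bounded w f -> nonneg_bounded (thetan s n w) (Ln s w n f).
Proof.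
case: n => [|n] // nf; split=> [x Xx|]; first by apply: Ln_ge0 => //; exact: nf.1.
have [M HM] := nf.2.
eexists => x Xx; apply: (le_trans (ler_norm _)).
apply: (@Ln_bound _ _ _ _ _ _ _ _ _ hmap hpot hpart w n.+1 f (Num.max 0 M)) => //.
  by rewrite le_max lexx.
move=> z [Xz _]; rewrite ger0_norm; last exact: nf.1.
by rewrite le_max HM ?orbT.
Qed.

Lemma nonneg_bounded_indic w W : nonneg_bounded w (\1_W).
Proof.
split=> [x _|]; first exact: indic_ge0.
by exists 1 => x _; rewrite indicE; case: (x \in W).
Qed.

(** The ratio of L^{n+1}_w f to L^n_{theta w} 1 is its ratio to L^{n+1}_w 1 times the ratio of
    L^n_{theta w}(L_w 1) to L^n_{theta w} 1. The infima of the two factors tend to F_w(f) and to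
    rho_w. *)
Lemma Fw_Lopen w f : nonneg_bounded w f -> rho s w * Fw s w f <= Fw s (theta s w) (Lopen s w f).
Proof.
move=> nf; have nL : nonneg_bounded (theta s w) (Lopen s w f) by exact: (nonneg_bounded_Ln 1 nf).
have n1 : nonneg_bounded (theta s w) (Lopen s w (\1_(Jw s w))) by exact: (nonneg_bounded_Ln 1 (nonneg_bounded_indic w _)).
apply: (@ler_cvg_to _ \oo _ R
  (fun n => ratio_inf (theta s w) n (Lopen s w (\1_(Jw s w))) * ratio_inf w n.+1 f)
  (fun n => ratio_inf (theta s w) n (Lopen s w f))).
- apply: cvgM; first exact: ratio_inf_cvg.
  by rewrite (cvg_shiftS (fun n => ratio_inf w n f)); exact: ratio_inf_cvg.
- exact: ratio_inf_cvg.
- near=> n; apply: ratio_inf_ge => x /SwE[Xx _].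
  have E g : Ln s (theta s w) n (Lopen s w g) = Ln s w n.+1 g.
    by rewrite -[theta s w]/(thetan s 1 w) -[Lopen s w g]/(Ln s w 1 g) Ln_add addn1.
  rewrite thetan_theta in Xx.
  rewrite E (le_trans _ (ratio_inf_le nf Xx)) //.
  rewrite [X in X * _ <= _]mulrC -mulrA ler_wpM2l ?ratio_inf_ge0 //.
  by rewrite -E; apply: ratio_inf_le => //; rewrite thetan_theta.
Unshelve. all: by end_near.
Qed.

Lemma rhon_gt0 w n : 0 < rhon s w n.
Proof. by apply: prodr_gt0 => i _; exact: (rho_gt0 hF). Qed.

Lemma Ltn_add w m n f : Ltn s (thetan s m w) n (Ltn s w m f) = Ltn s w (n + m) f.
Proof.
apply/funext => x; rewrite /Ltn LnZ Ln_add mulrA; congr (_ * _).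
rewrite -invfM; congr (_^-1); rewrite /rhon addnC big_split_ord /= mulrC; congr (_ * _).
by apply: eq_bigr => i _; rewrite thetan_add addnC.
Qed.

Lemma nonneg_bounded_Ltn w n f : nonneg_bounded w f -> nonneg_bounded (thetan s n w) (Ltn s w n f).
Proof.
move=> nf; have [H0 [M HM]] := nonneg_bounded_Ln n nf.
have r0 : 0 <= (rhon s w n)^-1 by rewrite invr_ge0 ltW // rhon_gt0.
split=> [x Xx|]; first by rewrite mulr_ge0 ?H0.
by exists ((rhon s w n)^-1 * M) => x Xx; rewrite ler_wpM2l ?HM.
Qed.

(** Moves every functional term met along the orbit to the final fiber. *)
Lemma Fw_Ltn w n f : nonneg_bounded w f -> Fw s w f <= Fw s (thetan s n w) (Ltn s w n f).
Proof.
move=> nf; elim: n => [|n IH].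
  rewrite (_ : Ltn s w 0 f = f) //; apply/funext => x.
  by rewrite /Ltn /rhon big_ord0 invr1 mul1r.
apply: (le_trans IH); set w' := thetan s n w; set g := Ltn s w n f.
have ng : nonneg_bounded w' g by exact: nonneg_bounded_Ltn.
have -> : Ltn s w n.+1 f = (fun x => (rho s w')^-1 * Lopen s w' g x).
  rewrite -add1n -Ltn_add; apply/funext => x.
  by rewrite /Ltn /rhon big_ord1.
apply: le_trans (FwZ_le (nonneg_bounded_Ln 1 ng) _); last by rewrite invr_ge0 ltW // (rho_gt0 hF).
by rewrite mulrC ler_pdivlMr ?(rho_gt0 hF) // mulrC; exact: Fw_Lopen.
Qed.

End functional.

(** * Cells, contiguity and the Lasota-Yorke inequality *)

Section cells.
Context {R : realType} {d : measure_display} {Omega : measurableType d}.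
Variables (P : probability Omega R) (s : open_system R Omega).
Variables (a b : R) (U Ut : Omega -> nat -> set (set R)).
Hypothesis hmap : map_assumptions s.
Hypothesis hpart : partition_assumptions P s a b U Ut.
Implicit Types (w : Omega) (n i k : nat) (x y z : R) (A B C Z : set R).

Let before : rel (set R) := fun A B => `[< forall x y, A x -> B y -> x < y >].
Let Xlo w x : Xw s w x -> lo s <= x. Proof. by case; rewrite /Ivl /= in_itv /= => /andP[]. Qed.
Let Xhi w x : Xw s w x -> x <= hi s. Proof. by case; rewrite /Ivl /= in_itv /= => /andP[]. Qed.

Lemma cell_neq0 w n Z : (1 <= n)%N -> Ut w n Z -> Z !=set0.
Proof. by move=> n1 UZ; have [_ [[_ _ ne] _] _ _ _] := Ut_spec hpart w n1; exact: ne. Qed.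

Lemma cells_ordered w n A B x y : (1 <= n)%N -> Ut w n A -> Ut w n B -> A <> B ->
  A x -> B y -> x <= y -> before A B.
Proof.
move=> n1 UA UB AB Ax By xy; apply/asboolP => x' y' Ax' By'.
have [AX Ac] := Ut_interval hpart n1 UA.
have [BX Bc] := Ut_interval hpart n1 UB.
have nAB z : A z -> B z -> False by move=> Az Bz; apply: AB; exact: (Ut_disjoint hpart n1 UA UB Az Bz).
rewrite ltNge; apply/negP => y'x'.
have [yx'|x'y] := leP y x'; first by apply: (nAB y) => //; apply: (Ac x x') => //; exact: BX.
by apply: (nAB x') => //; apply: (Bc y' y) => //; [exact: AX|exact: ltW].
Qed.

(** Disjoint nonempty intervals are ordered like any points chosen in them, so sorting by [rep]
    lists the cells from left to right. *)
Definition rep A : R := xget 0 A.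

Lemma repP A : A !=set0 -> A (rep A).
Proof. by case=> x Ax; rewrite /rep; case: xgetP => // /(_ x). Qed.

Definition sorted_cells w n : seq (set R) :=
  sort (fun A B => rep A <= rep B) (Kcells s Ut w n).

Lemma mem_sorted_cells w n Z : (1 <= n)%N ->
  Z \in sorted_cells w n <-> Ut w n Z /\ Z `<=` Kw s w n.-1.
Proof. by move=> n1; rewrite mem_sort; exact: (mem_Kcells hpart). Qed.

Lemma sorted_cells_pairwise w n : (1 <= n)%N -> pairwise before (sorted_cells w n).
Proof.
move=> n1.
have us : uniq (sorted_cells w n) by rewrite sort_uniq filter_uniq // cells_uniq.
have ss : pairwise (fun A B => rep A <= rep B) (sorted_cells w n).
  rewrite -sorted_pairwise; first by apply: sort_sorted => A B; exact: le_total.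
  by move=> A B C; exact: le_trans.
have : pairwise [rel A B | (A != B) && (rep A <= rep B)] (sorted_cells w n).
  by rewrite pairwise_relI ss andbT -uniq_pairwise.
apply: (@sub_in_pairwise _ [in sorted_cells w n]); last exact: allss.
move=> A B /(mem_sorted_cells _ _ n1)[UA _] /(mem_sorted_cells _ _ n1)[UB _] /andP[/eqP AB rAB].
by apply: (cells_ordered n1 UA UB AB _ _ rAB); apply: repP; [exact: (cell_neq0 n1 UA)|exact: (cell_neq0 n1 UB)].
Qed.

(** If sup A < inf B, density would put a point of X_w into the gap. *)
Lemma gap_share_endpoint w A B : A !=set0 -> B !=set0 ->
  A `<=` Xw s w -> B `<=` Xw s w -> before A B ->
  (forall z, Xw s w z -> (forall x, A x -> x < z) -> (forall y, B y -> z < y) -> False) ->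
  share_endpoint A B.
Proof.
move=> A0 B0 AX BX /asboolP AB gap; split=> //.
have supA x : A x -> x <= sup A.
  by move=> Ax; apply: ub_le_sup => //; exists (hi s) => z /AX /Xhi.
have infB y : B y -> inf B <= y.
  by move=> By; apply: ge_inf => //; exists (lo s) => z /BX /Xlo.
apply/eqP; rewrite eq_le; apply/andP; split.
  apply: ge_sup => // x Ax; apply: lb_le_inf => // y By; exact/ltW/AB.
rewrite leNgt; apply/negP => h.
have [x0 Ax0] := A0; have [y0 By0] := B0.
have [||z [Xz sz zi]] := Xw_dense hmap w _ h _.
- exact: le_trans (Xlo (AX _ Ax0)) (supA _ Ax0).
- exact: le_trans (infB _ By0) (Xhi (BX _ By0)).
- apply: (gap z) => // [x /supA|y /infB] H; [exact: le_lt_trans sz|exact: lt_le_trans H].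
Qed.

(* What lies strictly between two consecutive cells of K_{w,n-1} is either empty
   or a single component of the preimages of the hole. *)
Lemma consecutive_contiguous w n p A B q : (1 <= n)%N ->
  sorted_cells w n = p ++ A :: B :: q -> contiguous s w n A B.
Proof.
move=> n1 E; have pw := sorted_cells_pairwise w n1; rewrite E in pw.
move: pw; rewrite pairwise_cat => /and3P[/allrelP pAB _].
rewrite pairwise_cons => /andP[/allP ABq]; rewrite pairwise_cons => /andP[/allP Bq _].
have AB : before A B by apply: ABq; rewrite mem_head.
have inK C : C \in [:: A, B & q] -> Ut w n C /\ C `<=` Kw s w n.-1.
  by move=> Cq; apply/(mem_sorted_cells _ _ n1); rewrite E mem_cat Cq orbT.
have [|UA AK] := inK A; first by rewrite mem_head.
have [|UB BK] := inK B; first by rewrite !inE eqxx orbT.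
have KX x : Kw s w n.-1 x -> Xw s w x by case.
have AX : A `<=` Xw s w by move=> x /AK /KX.
have BX : B `<=` Xw s w by move=> x /BK /KX.
have A0 := cell_neq0 n1 UA; have B0 := cell_neq0 n1 UB.
pose M := [set z | [/\ Xw s w z, forall x, A x -> x < z & forall y, B y -> z < y]].
have MX : M `<=` Xw s w by move=> z [].
have [M0|M0] := pselect (M !=set0); last first.
  by left; apply: (gap_share_endpoint A0 B0 AX BX AB) => z Xz Az Bz; apply: M0; exists z.
(* A surviving point of the gap would lie in a third cell of K_{w,n-1}, yet the sorted list places
   every other cell before [A] or after [B]. *)
have Mhole : M `<=` hole_preimages s w n.
  move=> z [Xz Az zB]; split=> //; apply: contrapT => H.
  have Kz : Kw s w n.-1 z.
    split=> // i; rewrite -ltnS prednK // => ni; split; first exact: Tn_X.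
    by move=> Hi; apply: H; exists i.
  have [C /(mem_Kcells hpart _ _ n1) CK Cz] := Kcells_cover hpart n1 Kz.
  move/(mem_sorted_cells _ _ n1): CK; rewrite E mem_cat => /orP[Cp|].
    have /asboolP CA : before C A by apply: pAB => //; rewrite mem_head.
    have [x Ax] := A0; have := CA z x Cz Ax; have := Az x Ax; move=> h1 h2.
    by have := lt_trans h1 h2; rewrite ltxx.
  rewrite !inE => /or3P[/eqP CA|/eqP CB|Cq].
  - by have := Az z; rewrite -CA ltxx => /(_ Cz).
  - by have := zB z; rewrite -CB ltxx => /(_ Cz).
  - have /asboolP BC := Bq C Cq.
    have [y By] := B0; have := BC y z By Cz; have := zB y By; move=> h1 h2.
    by have := lt_trans h1 h2; rewrite ltxx.
have nKhole x : Kw s w n.-1 x -> ~ hole_preimages s w n x.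
  move=> [_ Kx] [_ [i ni Hi]]; have [|_] := Kx i; first by rewrite -ltnS prednK.
  exact.
right; exists M; split.
- split=> //.
    split=> // x y z [_ Ax _] [_ _ By] Xz xz zy; split=> // [u Au|u Bu].
      exact: lt_le_trans (Ax _ Au) xz.
    exact: le_lt_trans zy (By _ Bu).
  (* Maximality of [M]: a larger interval would reach past a point of [A] or [B], and such points
     survive, so they are not in the preimages of the hole. *)
  move=> C [CX Cc] Chole MC; apply/seteqP; split=> // z Cz; have Xz := CX _ Cz.
  have [m Mm] := M0; have [_ Am mB] := Mm.
  split=> // [x Ax|y By]; rewrite ltNge; apply/negP => h.
    apply: (nKhole x (AK _ Ax)); apply: Chole; apply: (Cc z m) => //; first exact: MC.
      exact: AX.
    exact/ltW/Am.
  apply: (nKhole y (BK _ By)); apply: Chole; apply: (Cc m z) => //; first exact: MC.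
    exact: BX.
  exact/ltW/mB.
- apply: (gap_share_endpoint A0 M0 AX MX); first by apply/asboolP => x z Ax [_ + _]; exact.
  move=> z Xz Az zM; have [m Mm] := M0; have [_ _ mB] := Mm.
  have /zM : M z by split=> // y By; exact: lt_trans (zM _ Mm) (mB _ By).
  by rewrite ltxx.
- apply: (gap_share_endpoint M0 B0 MX BX); first by apply/asboolP => z y [_ _ +] By; exact.
  move=> z Xz Mz zB; have [m Mm] := M0; have [_ Am _] := Mm.
  have /Mz : M z by split=> // x Ax; exact: lt_trans (Am _ Ax) (Mz _ Mm).
  by rewrite ltxx.
Qed.

Lemma contiguous_before w n A B : contiguous s w n A B -> before A B.
Proof.
case=> [[AB _]|[C [[[z Cz] _ _ _] [AC _] [CB _]]]]; apply/asboolP => // x y Ax By.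
exact: lt_trans (AC _ _ Ax Cz) (CB _ _ Cz By).
Qed.

Lemma chain_size w n k c : (1 <= n)%N ->
  contiguous_chain s w n (Zb s (Ut w n) w n) k c -> (k <= size (Kcells s Ut w n))%N.
Proof.
move=> n1 [cQ cc].
have cU i : (i < k)%N -> Ut w n (c i) by move=> /cQ[].
have lt i j : (i < j)%N -> (j < k)%N -> before (c i) (c j).
  elim: j => // j IH; rewrite ltnS leq_eqVlt => /orP[/eqP -> jk|ij jk].
    exact: contiguous_before (cc _ jk).
  have /asboolP h1 := IH ij (ltnW jk).
  have /asboolP h2 := contiguous_before (cc _ jk).
  have [z Cz] := cell_neq0 n1 (cU _ (ltnW jk)).
  by apply/asboolP => x y cx cy; exact: lt_trans (h1 _ _ cx Cz) (h2 _ _ Cz cy).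
have neq i j : (i < j)%N -> (j < k)%N -> c i <> c j.
  move=> ij jk E; have /asboolP h := lt _ _ ij jk.
  by have [z Cz] := cell_neq0 n1 (cU _ jk); have := h z z; rewrite E ltxx => /(_ Cz Cz).
rewrite -(size_iota 0 k) -(size_map c); apply: uniq_leq_size.
  rewrite map_inj_in_uniq ?iota_uniq // => i j; rewrite !mem_iota /= !add0n => ik jk E.
  by case: (ltngtP i j) => // h; [case: (neq _ _ h jk)|case: (neq _ _ h ik)].
move=> Z /mapP[i + ->]; rewrite mem_iota /= add0n => ik.
by apply/(mem_Kcells hpart _ _ n1); have [] := cQ i ik.
Qed.

(** The members of a contiguous chain are ordered, hence distinct, so chain lengths are bounded by
    the number of cells and the [sup] is a maximum. *)
Lemma eta_nat w n : (1 <= n)%N -> exists2 e : nat, Defs.eta s (Ut w n) w n = e%:R &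
  forall k c, contiguous_chain s w n (Zb s (Ut w n) w n) k c -> (k <= e)%N.
Proof.
move=> n1; pose Q k := `[< exists c, contiguous_chain s w n (Zb s (Ut w n) w n) k c >].
have Q0 : exists k, Q k by exists 0%N; apply/asboolP; exists (fun _ => set0); split.
have Qm k : Q k -> (k <= size (Kcells s Ut w n))%N.
  by move=> /asboolP[c]; exact: chain_size.
case: (ex_maxnP Q0 Qm) => e Qe He; exists e; last first.
  by move=> k c kc; apply: He; apply/asboolP; exists c.
rewrite /Defs.eta; apply/eqP; rewrite eq_le; apply/andP; split.
  apply: ge_sup; first by exists e%:R, e => //; exact/asboolP.
  by move=> _ [k [c kc] <-]; rewrite ler_nat; apply: He; apply/asboolP; exists c.
apply: ub_le_sup; last by exists e => //; exact/asboolP.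
by exists e%:R => _ [k [c kc] <-]; rewrite ler_nat; apply: He; apply/asboolP; exists c.
Qed.

Lemma eta_ge0 w n : (1 <= n)%N -> 0 <= Defs.eta s (Ut w n) w n.
Proof. by move=> n1; have [e -> _] := eta_nat w n1. Qed.

Lemma bad_run_size w n p K q : (1 <= n)%N -> sorted_cells w n = p ++ K ++ q ->
  (forall Z, Z \in K -> Zb s (Ut w n) w n Z) ->
  contiguous_chain s w n (Zb s (Ut w n) w n) (size K) (nth set0 K).
Proof.
move=> n1 E KB; split=> i iK; first by apply: KB; exact: mem_nth.
apply: (@consecutive_contiguous w n (p ++ take i K) _ _ (drop i.+2 K ++ q) n1).
rewrite E -{1}(cat_take_drop i K) -!catA; congr (_ ++ (_ ++ _)).
by rewrite (drop_nth set0 (ltnW iK)) (drop_nth set0 iK).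
Qed.

End cells.

(** * The Lasota-Yorke inequality on one fiber *)

Section lasota_yorke.
Context {R : realType} {d : measure_display} {Omega : measurableType d}.
Variables (P : probability Omega R) (s : open_system R Omega).
Variables (nu : R.-pker Omega ~> R).
Variables (a b : R) (U Ut : Omega -> nat -> set (set R)).
Hypothesis hbase : base_assumptions P s.
Hypothesis hmap : map_assumptions s.
Hypothesis hpot : potential_assumptions P s.
Hypothesis hhole : hole_assumptions P s nu.
Hypothesis hF : functional_assumptions P s.
Hypothesis hpart : partition_assumptions P s a b U Ut.
Implicit Types (w : Omega) (n i k : nat) (x y z : R) (f g : R -> R) (W Z : set R).

(** The product rule on [Z] gives a sup|f| + var f, in units of the norm of g^n. Transport by the
    monotone map T^n is free, and extension by zero off the image costs 2 sup|f| in the same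
    units. *)
Lemma varle_cell w n f V Z : (1 <= n)%N -> Z \in Kcells s Ut w n ->
  varle (Xw s w) f V ->
  varle (Xw s (thetan s n w)) (Ln s w n (fun y => f y * \1_Z y))
    (open_gnorm s w n * ((a + 2) * supnorm Z f + rvar Z f)).
Proof.
move=> n1 ZK HV; have [UZ ZKw] := (mem_Kcells hpart w Z n1).1 ZK.
have [ZX _] := Ut_interval hpart n1 UZ.
have [mZ iZ] := Ut_branch hmap hpart n1 UZ.
have [H1 H2] := Ln_cell hmap hpot hpart f n1 ZK.
have [M HM] := varle_bounded HV.
have fS z : Z z -> `|f z| <= supnorm Z f.
  by apply: (@has_sup_norm _ _ _ M) => x /ZX; exact: HM.
have [z0 Zz0] := cell_neq0 hpart n1 UZ.
have S0 : 0 <= supnorm Z f by apply: le_trans (fS _ Zz0).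
have g0 : 0 <= open_gnorm s w n := open_gnorm_ge0 hmap hpot w n.
have gle z : Z z -> `|gcn s w n z| <= open_gnorm s w n.
  by move=> Zz; rewrite ger0_norm ?gcn_ge0 // (gcn_le_norm hmap hpot) //; exact: ZKw.
have vg : varle Z (gcn s w n) (a * open_gnorm s w n).
  have [_ _ _ /(_ _ UZ)[A UA ZA] _] := Ut_spec hpart w n1.
  have [_ _ /(_ _ UA)[/var_leP H _]] := part_U hpart w n1.
  by apply: varleS H => z Zz; split; [exact: ZA|exact: ZKw].
have vfg := varleM (varle_rvar (varleS ZX HV)) vg fS gle S0 g0.
have vh : varle (Tn s w n @` Z) (Ln s w n (fun y => f y * \1_Z y))
    (supnorm Z f * (a * open_gnorm s w n) + open_gnorm s w n * rvar Z f).
  by apply: varle_image => //; apply: eq_varle vfg => z Zz /=; rewrite H1.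
have := @varle_extend0 _ _ _ _ _ (supnorm Z f * open_gnorm s w n) iZ vh.
rewrite (_ : _ + _ + 2 * _ = open_gnorm s w n * ((a + 2) * supnorm Z f + rvar Z f)); last by ring.
apply; last 2 first.
- exact: mulr_ge0.
- by move=> x Xx nx; exact: H2.
by move=> _ [z Zz <-]; rewrite H1 // normrM ler_pM ?fS ?gle.
Qed.

(** [varle_cell] is summed over the cells: the suprema are controlled by [sum_sup_le], the
    variations add up to at most V, and a + 2 <= a + 2b. *)
Theorem lasota_yorke w n f (V delta : R) : (1 <= n)%N ->
  Zg s (Ut w n) w n !=set0 -> 0 < delta ->
  (forall A, Zg s (Ut w n) w n A -> 2 * delta <= Fw s w (\1_A)) ->
  varle (Xw s w) f V ->
  varle (Xw s (thetan s n w)) (Ln s w n f)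
    (open_gnorm s w n * ((a + 2 * b + 1 + (2 * a + 4 * b) * Defs.eta s (Ut w n) w n) * V +
       (a + 2 * b) * (1 + 2 * Defs.eta s (Ut w n) w n) * (2 * delta)^-1 *
         Fw s w (fun x => `|f x|))).
Proof.
move=> n1 [G [UG GK FG]] delta0 Hdelta HV.
have [M HM] := varle_bounded HV.
have nf : nonneg_bounded s w (fun x => `|f x|) by split=> [x _|]; [exact: normr_ge0|exists M].
have F0 := Fw_ge0 hbase hmap hhole hpart nf.
set L := sorted_cells s Ut w n.
have memL Z : Z \in L <-> Ut w n Z /\ Z `<=` Kw s w n.-1 := mem_sorted_cells hpart w Z n1.
have KX x : Kw s w n.-1 x -> Xw s w x by case.
pose good Z := `[< 0 < Fw s w (\1_Z) >].
have pL := sorted_cells_pairwise hpart w n1.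
have [e eE He] := eta_nat hpart w n1.
pose m (Z : set R) := infimum_on Z (fun x => `|f x|).
have LX Z : Z \in L -> Z `<=` Xw s w by move=> /memL[_ ZK] x /ZK /KX.
have m0 Z : Z \in L -> 0 <= m Z.
  move=> /memL[UZ _]; have [z Zz] := cell_neq0 hpart n1 UZ.
  apply: lb_le_inf; first by exists `|f z|, z.
  by move=> _ [x _ <-].
have S1 : \sum_(Z <- L) supnorm Z f <= (1 + 2 * e%:R) * (V + \sum_(Z <- L | good Z) m Z).
  apply: (@sum_sup_le _ L good (Xw s w) f V (fun Z => supnorm Z f) m e) => //.
  - move=> Z ZL; split; first exact: LX.
    by have [UZ _] := (memL Z).1 ZL; exact: (cell_neq0 hpart n1 UZ).
  - move=> Z c /memL[UZ _] H; have [z Zz] := cell_neq0 hpart n1 UZ.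
    apply: ge_sup; first by exists `|f z|, z.
    by move=> _ [x Zx <-]; exact: H.
  - move=> Z c /memL[UZ _] H; have [z Zz] := cell_neq0 hpart n1 UZ.
    apply: lb_le_inf; first by exists `|f z|, z.
    by move=> _ [x Zx <-]; exact: H.
  - move=> p K q E /allP bK; apply: (He _ (nth set0 K)).
    apply: (bad_run_size hmap hpart n1 E) => Z ZK.
    have [UZ ZKw] : Ut w n Z /\ Z `<=` Kw s w n.-1.
      by apply/memL; rewrite E !mem_cat ZK orbT.
    split=> //; have /asboolP := bK Z ZK.
    have := Fw_ge0 hbase hmap hhole hpart (nonneg_bounded_indic s w Z).
    by rewrite le_eqVlt => /orP[/eqP <-|].
  - by apply/hasP; exists G; [exact/memL|exact/asboolP].
(* The step function equal to inf_Z |f| on each good cell Z is below |f|, so superadditivity of F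
   applies. *)
have S2 : 2 * delta * \sum_(Z <- L | good Z) m Z <= Fw s w (fun x => `|f x|).
  have := @Fw_superadditive _ _ _ _ _ _ _ _ _ _ hbase hmap hhole hpart _ L
    (fun Z => (Z \in L) && good Z) w (fun x => `|f x|) m (fun Z => \1_Z) nf.
  move=> H; apply: le_trans (H _ _ _); last 3 first.
  - by move=> Z /andP[ZL _]; exact: m0.
  - by move=> Z _; exact: nonneg_bounded_indic.
  - move=> x Xx.
    have [[Z ZL Zx]|nZ] := pselect (exists2 Z, Z \in L & Z x); last first.
      rewrite big_seq_cond big1 ?normr_ge0 // => Z /andP[ZL _].
      by rewrite indicN ?mulr0 // => Zx; apply: nZ; exists Z.
    have uL : uniq L by rewrite sort_uniq filter_uniq // cells_uniq.
    apply: (@le_trans _ _ (\sum_(Z' <- L) m Z' * \1_Z' x)).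
      rewrite big_mkcond big_seq [leRHS]big_seq; apply: ler_sum => Z' Z'L; case: ifP => // _.
      by rewrite mulr_ge0 ?m0 ?indic_ge0.
    rewrite (bigD1_seq Z ZL uL) /= big_seq_cond big1 ?addr0.
      rewrite indicT // mulr1; apply: ge_inf; last by exists x.
      by exists 0 => _ [y _ <-].
    move=> Z' /andP[/memL[UZ' _] /eqP ne]; rewrite indicN ?mulr0 // => Z'x; apply: ne.
    by have [UZ _] := (memL Z).1 ZL; exact: (Ut_disjoint hpart n1 UZ' UZ Z'x Zx).
  rewrite mulr_sumr [leLHS]big_seq_cond.
  apply: ler_sum => Z /andP[ZL /asboolP gZ]; rewrite mulrC ler_wpM2l ?m0 //.
  by apply: Hdelta; have [UZ ZK] := (memL Z).1 ZL; split.
have S3 : \sum_(Z <- L) rvar Z f <= V.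
  by apply: le_trans (rvar_le HV); apply: rvar_sum HV.
have HL : varle (Xw s (thetan s n w)) (Ln s w n f)
    (\sum_(Z <- L) open_gnorm s w n * ((a + 2) * supnorm Z f + rvar Z f)).
  apply: (@eq_varle _ _ (fun x => \sum_(Z <- L) Ln s w n (fun y => f y * \1_Z y) x)).
    move=> x Xx; rewrite [RHS](Ln_cells hmap hpot hpart) //; apply: perm_big.
    by rewrite perm_sort.
  apply: varle_sum => Z; rewrite mem_sort => ZK; exact: (varle_cell n1 ZK HV).
apply: varle_le HL _.
rewrite -mulr_sumr ler_wpM2l ?(open_gnorm_ge0 hmap hpot) // big_split /= -mulr_sumr eE.
have a0 := part_a hpart; have b1 := part_b hpart.
have S4 : \sum_(Z <- L | good Z) m Z <= (2 * delta)^-1 * Fw s w (fun x => `|f x|).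
  by rewrite mulrC ler_pdivlMr ?mulr_gt0 // mulrC.
have e0 : 0 <= e%:R :> R by [].
set S := \sum_(Z <- L) supnorm Z f in S1 *; set mm := \sum_(Z <- L | _) _ in S1 S4 *.
set rv := \sum_(Z <- L) _ in S3 *; set FF := Fw _ _ _ in S4 *.
have S5 : S <= (1 + 2 * e%:R) * (V + (2 * delta)^-1 * FF).
  by apply: (le_trans S1); rewrite ler_wpM2l ?lerD2l // addr_ge0 ?mulr_ge0.
apply: (@le_trans _ _ ((a + 2 * b) * ((1 + 2 * e%:R) * (V + (2 * delta)^-1 * FF)) + V)).
  apply: lerD => //; apply: ler_pM => //; [lra| |lra].
  rewrite /S big_seq sumr_ge0 // => Z ZL; have [UZ _] := (memL Z).1 ZL.
  have [z Zz] := cell_neq0 hpart n1 UZ; apply: (le_trans (normr_ge0 (f z))).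
  by apply: (@has_sup_norm _ _ _ M) => // x /(LX _ ZL); exact: HM.
by rewrite le_eqVlt; apply/orP; left; apply/eqP; ring.
Qed.

Lemma Cst_gt0 w n : (1 <= n)%N -> 0 < Cst s a b Ut w n.
Proof.
move=> n1; have a0 := part_a hpart; have b1 := part_b hpart.
have e0 := eta_ge0 hpart w n1.
rewrite /Cst !mulr_gt0 ?invr_gt0 ?(rhon_gt0 hF) //; last first.
  by apply: (gnorm_gt0 hmap hpot n1); exact: (Kw_neq0 hbase hmap hpot hhole hpart).
have : 0 <= (2 * a + 4 * b) * Defs.eta s (Ut w n) w n by rewrite mulr_ge0 //; lra.
by lra.
Qed.

Corollary lasota_yorke_normalized w n f (V delta : R) : (1 <= n)%N ->
  Zg s (Ut w n) w n !=set0 -> 0 < delta ->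
  (forall A, Zg s (Ut w n) w n A -> 2 * delta <= Fw s w (\1_A)) ->
  varle (Xw s w) f V ->
  varle (Xw s (thetan s n w)) (Ltn s w n f)
    (Cst s a b Ut w n * V + Cst s a b Ut w n / delta * Fw s w (fun x => `|f x|)).
Proof.
move=> n1 Z0 delta0 Hdelta HV.
have H := varleZ (rhon s w n)^-1 (lasota_yorke n1 Z0 delta0 Hdelta HV).
apply: varle_le H _.
have r0 : 0 < (rhon s w n)^-1 by rewrite invr_gt0 (rhon_gt0 hF).
rewrite gtr0_norm //.
have [M HM] := varle_bounded HV.
have nf : nonneg_bounded s w (fun x => `|f x|) by split=> [x _|]; [exact: normr_ge0|exists M].
have F0 := Fw_ge0 hbase hmap hhole hpart nf.
have g0 := open_gnorm_ge0 hmap hpot w n; have e0 := eta_ge0 hpart w n1.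
have a0 := part_a hpart; have b1 := part_b hpart; rewrite /Cst.
set g := open_gnorm s w n in g0 *; set FF := Fw _ _ _ in F0 *; set e := Defs.eta _ _ _ _ in e0 *.
set r := (rhon s w n)^-1 in r0 *; set k := a + 2 * b + 1 + _.
have -> : r * k * g * V + r * k * g / delta * FF = r * (g * (k * V + k * delta^-1 * FF)).
  by ring.
apply: ler_wpM2l; first exact: ltW.
apply: ler_wpM2l => //; rewrite lerD2l; apply: ler_wpM2r => //.
have E0 : 0 <= (2 * a + 4 * b) * e by rewrite mulr_ge0 //; lra.
have d0 : 0 <= delta^-1 by rewrite invr_ge0 ltW.
have -> : (a + 2 * b) * (1 + 2 * e) = k - 1 by rewrite /k; ring.
have k0 : 0 <= k * delta^-1 by rewrite mulr_ge0 // /k; lra.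
by rewrite invfM; have := d0; nra.
Qed.

End lasota_yorke.

(** * Existence of good cells *)

(** Strict inequality between exponential rates absorbs any constant factor c. The maximum with 1 is
    harmless because the rate of [e] is nonnegative. *)
Lemma exponential_gap (R : realType) (G e I : nat -> R) (l1 l2 : \bar R) (c : R) :
  (forall k, (1 <= k)%N -> 0 < G k) ->
  (forall k, (1 <= k)%N -> e k = 0 \/ 1 <= e k) ->
  (fun k => ((k%:R)^-1)%:E * lne (G k)%:E)%E @ \oo --> l1 ->
  (fun k => ((k%:R)^-1)%:E * lne (I k)%:E)%E @ \oo --> l2 ->
  adde_def l1 (limn_esup (fun k => ((k%:R)^-1 * ln (e k))%:E)) ->
  (l1 + limn_esup (fun k => ((k%:R)^-1 * ln (e k))%:E) < l2)%E ->
  exists k0, forall k, (k0 <= k)%N -> c * (Num.max 1 (e k) * G k) < I k.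
Proof.
move=> G0 e01 c1 c2 dl.
set v := fun k => ((k%:R)^-1 * ln (e k))%:E.
(* The value e = 0 counts as rate 0, since [ln 0 = 0]. *)
have v0 k : (1 <= k)%N -> (0 <= v k)%E.
  move=> k1; rewrite lee_fin mulr_ge0 ?invr_ge0 //.
  by case: (e01 k k1) => [->|h]; [rewrite ln0|exact: ln_ge0].
have lsE : limn_esup v = ereal_inf (range (esups v)).
  by rewrite limn_esup_lim; apply/cvg_lim => //; exact: cvg_esups_inf.
have ls0 : (0 <= limn_esup v)%E.
  rewrite lsE; apply: le_ereal_inf_tmp => _ [k _ <-].
  apply: (le_trans (v0 k.+1 isT)); apply: ereal_sup_ubound; exists k.+1 => //=.
have [L HL] : exists L : R, limn_esup v = L%:E \/ limn_esup v = +oo%E.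
  by move: ls0; case: (limn_esup v) => [L| |] // _; [exists L; left|exists 0; right].
(* An infinite rate would make the left side of the gap +oo: [adde_def] rules out l1 = -oo here. *)
case: HL => HL; last first.
  by move: dl; rewrite -/v HL; case: l1 c1 => //= [r|] _ _; rewrite ltNge leey.
move: ls0; rewrite -/v HL lee_fin => L0 gap.
have [r1 [r2 [r12 h1 h2]]] : exists r1 r2 : R, [/\ r1 < r2, (l1 < (r1 - L)%:E)%E & (r2%:E < l2)%E].
  case: l1 c1 gap dl => [x1||] c1 gap dl.
  - case: l2 c2 gap => [x2||] c2 gap.
    + have g : x1 + L < x2 by rewrite -lte_fin.
      pose t := (x2 - (x1 + L)) / 3%:R.
      exists (x1 + L + t), (x2 - t); rewrite !lte_fin /t; split; lra.
    + exists (x1 + L + 1), (x1 + L + 2); rewrite lte_fin; split; [lra|lra|exact: ltry].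
    + by move: gap; rewrite ltNge leNye.
  - by move: gap; rewrite ltNge leey.
  - case: l2 c2 gap => [x2||] c2 gap.
    + by exists (x2 - 2), (x2 - 1); rewrite lte_fin; split; [lra|exact: ltNyr|lra].
    + by exists 0, 1; split; [lra|exact: ltNyr|exact: ltry].
    + by move: gap; rewrite ltxx.
(* One third of the gap goes to the upper limit, one to the constant, and the last keeps the
   inequality strict. *)
pose t := (r2 - r1) / 3%:R.
have t0 : 0 < t by rewrite /t; lra.
have [N1 _ HN1] : \forall k \near \oo, (((k%:R)^-1)%:E * lne (G k)%:E < (r1 - L)%:E)%E.
  by apply: (c1 [set x | (x < (r1 - L)%:E)%E]); apply: open_nbhs_nbhs; split => //; exact: open_ereal_lt_ereal.
have [N2 _ HN2] : \forall k \near \oo, (r2%:E < ((k%:R)^-1)%:E * lne (I k)%:E)%E.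
  by apply: (c2 [set x | (r2%:E < x)%E]); apply: open_nbhs_nbhs; split => //; exact: open_ereal_gt_ereal.
have [N3 HN3] : exists N, forall k, (N <= k)%N -> (v k < (L + t)%:E)%E.
  have : (ereal_inf (range (esups v)) < (L + t)%:E)%E by rewrite -lsE HL lte_fin ltrDl.
  move=> /ereal_inf_lt[_ [N _ <-] HN]; exists N => k Nk; apply: le_lt_trans HN.
  by apply: ereal_sup_ubound; exists k.
pose C := Num.max c 1.
have C1 : 1 <= C by rewrite le_max lexx orbT.
have cC : c <= C by rewrite le_max lexx.
pose N4 := Num.Def.archi_bound (ln C / t).
exists (maxn 1 (maxn N1 (maxn N2 (maxn N3 N4)))) => k; rewrite !geq_max => /and5P[k1 kN1 kN2 kN3 kN4].
have kR : 0 < k%:R :> R by rewrite ltr0n.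
have Gk := G0 k k1.
have lnG : ln (G k) < k%:R * (r1 - L).
  have : (((k%:R)^-1)%:E * lne (G k)%:E < (r1 - L)%:E)%E := HN1 k kN1; rewrite lne_EFin // -EFinM lte_fin.
  by rewrite mulrC ltr_pdivrMr // mulrC.
have lnv : ln (e k) < k%:R * (L + t).
  have := HN3 k kN3; rewrite /v lte_fin.
  by rewrite mulrC ltr_pdivrMr // mulrC.
have Ik : 0 < I k.
  rewrite ltNge; apply/negP => Ik; have : (r2%:E < ((k%:R)^-1)%:E * lne (I k)%:E)%E := HN2 k kN2.
  by rewrite le0_lneNy ?lee_fin // gt0_muleNy ?lte_fin ?invr_gt0 // ltNge leNye.
have lnI : k%:R * r2 < ln (I k).
  have : (r2%:E < ((k%:R)^-1)%:E * lne (I k)%:E)%E := HN2 k kN2; rewrite lne_EFin // -EFinM lte_fin.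
  by rewrite [X in _ < X]mulrC ltr_pdivlMr // mulrC.
have m1 : 1 <= Num.max 1 (e k) by rewrite le_max lexx.
have lnm : ln (Num.max 1 (e k)) < k%:R * (L + t).
  case: (e01 k k1) => [->|h]; last by rewrite max_r.
  by rewrite max_l // ln1 mulr_gt0 //; lra.
have lnC : ln C <= k%:R * t.
  have : ln C / t < N4%:R.
    apply: archi_boundP; rewrite divr_ge0 //; [exact: ln_ge0|exact: ltW].
  rewrite ltr_pdivrMr // => h; apply: (le_trans (ltW h)).
  by rewrite ler_wpM2r ?ler_nat // ltW.
apply: (@le_lt_trans _ _ (C * (Num.max 1 (e k) * G k))).
  by rewrite ler_wpM2r // mulr_ge0 ?(le_trans ler01 m1) // ltW.
have m0 := lt_le_trans ltr01 m1; have C0 := lt_le_trans ltr01 C1.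
rewrite -ltr_ln ?posrE ?mulr_gt0 //.
rewrite !lnM ?posrE ?mulr_gt0 //.
apply: le_lt_trans lnI.
have -> : k%:R * r2 = k%:R * t + (k%:R * (L + t) + k%:R * (r1 - L)) + k%:R * t.
  by rewrite /t; field.
by have := mulr_gt0 kR t0; lra.
Qed.

Section good_cells.
Context {R : realType} {d : measure_display} {Omega : measurableType d}.
Variables (P : probability Omega R) (s : open_system R Omega).
Variables (nu : R.-pker Omega ~> R).
Variables (a b : R) (U Ut : Omega -> nat -> set (set R)).
Hypothesis hbase : base_assumptions P s.
Hypothesis hmap : map_assumptions s.
Hypothesis hpot : potential_assumptions P s.
Hypothesis hhole : hole_assumptions P s nu.
Hypothesis hF : functional_assumptions P s.
Hypothesis hpart : partition_assumptions P s a b U Ut.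
Implicit Types (w : Omega) (n i k : nat) (x y z : R) (f g : R -> R) (W Z : set R).

Definition contracting_at w := exists l1 l2 : \bar R,
  let ls := limn_esup (fun n =>
    ((n%:R)^-1 * ln (Defs.eta s (Ut w n) w n))%:E) in
  [/\ (fun n => ((n%:R)^-1)%:E * lne (open_gnorm s w n)%:E)%E @ \oo --> l1,
      (fun n => ((n%:R)^-1)%:E *
         lne (infimum_on (Sinf s (thetan s n w))
                         (Ln s w n (\1_(Jw s w))))%:E)%E @ \oo --> l2,
      adde_def l1 ls &
      (l1 + ls < l2)%E].

Lemma contracting_gap w (c : R) : contracting_at w ->
  exists k0, forall k, (k0 <= k)%N -> forall x, Sinf s (thetan s k w) x ->
    c * (Num.max 1 (Defs.eta s (Ut w k) w k) * open_gnorm s w k) < Ln s w k (\1_(Jw s w)) x.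
Proof.
move=> [l1 [l2 [c1 c2 dl gap]]].
have [|k k1|k0 Hk0] := exponential_gap c _ _ c1 c2 dl gap.
- move=> k k1; apply: (gnorm_gt0 hmap hpot k1).
  exact: (Kw_neq0 hbase hmap hpot hhole hpart).
- have [[|e] -> _] := eta_nat hpart w k1; first by left.
  by right; rewrite ler1n.
- exists k0 => k kk0 x Sx; apply: (lt_le_trans (Hk0 k kk0)).
  apply: ge_inf; last by exists x.
  exists 0 => _ [y Sy <-]; have [Xy _] : Sw s (thetan s k w) 0 y by exact: Sy.
  exact: (Ln1_ge0 hmap hpart).
Qed.

(** Without good cells all cells of K_{w,k-1} form one contiguous bad chain, so there are at most
    eta of them and L^k 1 <= eta ||g^k||, against the contraction. *)
Lemma Zg_eventually w : contracting_at w ->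
  exists k0, forall k, (k0 <= k)%N -> (1 <= k)%N /\ Zg s (Ut w k) w k !=set0.
Proof.
move=> /(contracting_gap 1)[k0 Hk0]; exists (maxn 1 k0) => k; rewrite geq_max => /andP[k1 kk0].
split=> //; apply: contrapT => Z0.
have [x Sx] := hole_Sinf hhole (thetan s k w).
have Xx : Xw s (thetan s k w) x by have [] : Sw s (thetan s k w) 0 x by exact: Sx.
have := Hk0 k kk0 x Sx; rewrite mul1r; apply/negP; rewrite -leNgt.
apply: (le_trans (ler_norm _)).
apply: (le_trans (Ln_bound hmap hpot hpart k1 Xx ler01 _)).
  by move=> z _; rewrite indicE; case: (_ \in _); rewrite ?normr1 ?normr0.
rewrite mul1r ler_wpM2r ?(open_gnorm_ge0 hmap hpot) //.
have [e -> He] := eta_nat hpart w k1.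
rewrite le_max; apply/orP; right; rewrite ler_nat.
rewrite -(size_sort (fun A B => rep A <= rep B)) -/(sorted_cells s Ut w k).
apply: (He _ (nth set0 (sorted_cells s Ut w k))).
apply: (@bad_run_size _ _ _ _ _ _ _ _ _ hmap hpart w k [::] _ [::] k1); first by rewrite cats0.
move=> Z /(mem_sorted_cells hpart _ _ k1)[UZ ZK]; split=> //.
have := Fw_ge0 hbase hmap hhole hpart (nonneg_bounded_indic s w Z).
rewrite le_eqVlt => /orP[/eqP <- //|FZ].
by case: Z0; exists Z.
Qed.

(* If all cells Z of K_{w,n-1} were bad then F_w(1_Z) = 0 and the Lasota-Yorke
   inequality would bound L^k_w 1_Z by a multiple of max(1, eta) ||g^k||; summing
   over Z contradicts the contraction. *)
Lemma Zg_neq0 w n : contracting_at w -> (1 <= n)%N -> Zg s (Ut w n) w n !=set0.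
Proof.
move=> Hw n1; apply: contrapT => Z0.
have [k1 Hk1] := Zg_eventually Hw.
(* Number of cells at time n, times var 1_Z <= 2, times the bracket of the Lasota-Yorke inequality
   with eta bounded by max(1, eta). *)
pose c : R := (size (Kcells s Ut w n))%:R * (2 * (a + 2 * b + 1 + (2 * a + 4 * b))).
have [k2 Hk2] := contracting_gap c Hw.
pose k := maxn n (maxn k1 k2).
have [k1' Zk] := Hk1 k ltac:(by rewrite !leq_max leqnn orbT).
have nk : (n <= k)%N by rewrite leq_max leqnn.
have k2' : (k2 <= k)%N by rewrite !leq_max leqnn !orbT.
have [x Sx] := hole_Sinf hhole (thetan s k w).
have Xx : Xw s (thetan s k w) x by have [] : Sw s (thetan s k w) 0 x by exact: Sx.
have := Hk2 k k2' x Sx; apply/negP; rewrite -leNgt.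
set e := Defs.eta s (Ut w k) w k; set g := open_gnorm s w k.
have e0 : 0 <= e := eta_ge0 hpart w k1'.
have g0 : 0 <= g := open_gnorm_ge0 hmap hpot w k.
have a0 := part_a hpart; have b1 := part_b hpart.
have m1 : 1 <= Num.max 1 e by rewrite le_max lexx.
have me : e <= Num.max 1 e by rewrite le_max lexx orbT.
have [delta [delta0 _ Hdelta]] := part_delta hpart k1'.
pose D := 2 * (a + 2 * b + 1 + (2 * a + 4 * b)) * (Num.max 1 e * g).
have LZ Z : Z \in Kcells s Ut w n -> Ln s w k (\1_Z) x <= D.
  move=> ZK; have [UZ ZKw] := (mem_Kcells hpart w Z n1).1 ZK.
  have iZ := Ut_interval hpart n1 UZ.
  have nZ := nonneg_bounded_indic s w Z.
  have FZ : Fw s w (\1_Z) = 0.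
    have := Fw_ge0 hbase hmap hhole hpart nZ; rewrite le_eqVlt => /orP[/eqP -> //|FZ].
    by case: Z0; exists Z.
  have vZ : varle (Xw s w) (\1_Z) 2.
    rewrite -[2]mulr1 -[2 * 1]add0r; apply: (varle_extend0 iZ) => //.
    - apply: (@eq_varle _ _ (cst 1)) => [y Zy|]; first by rewrite indicT.
      move=> l _ _; case: l => [|y l] //=.
      by elim: l y => [|z l IH] y //=; rewrite subrr normr0 add0r.
    - by move=> y Zy; rewrite indicT // normr1.
    - by move=> y _; exact: indicN.
  have nE : (fun y => `|\1_Z y|) = \1_Z :> (R -> R).
    by apply/funext => y; rewrite ger0_norm ?indic_ge0.
  have := lasota_yorke hbase hmap hpot hhole hpart k1' Zk (delta0 w) (Hdelta w) vZ.
  rewrite nE FZ mulr0 addr0 -/e -/g => vL.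
  have Hx y : Sw s (thetan s k w) k y -> Ln s w k (\1_Z) x <= Ln s w k (\1_Z) y + g * ((a + 2 * b + 1 + (2 * a + 4 * b) * e) * 2).
    move=> /(SwE hbase)[Xy _]; have := varle_dist vL Xx Xy; have := ler_norm (Ln s w k (\1_Z) x - Ln s w k (\1_Z) y); lra.
  (* F_w(1_Z) = 0 is an increasing limit of nonnegative infima, so L^k 1_Z is arbitrarily small
     somewhere relative to L^k 1 <= B; the variation bound then carries smallness to the point x. *)
  have Q0 : ratio_inf s w k (\1_Z) = 0.
    apply/eqP; rewrite eq_le -{1}FZ (ratio_inf_leF hbase hmap hhole hpart) //.
    exact: (ratio_inf_ge0 hbase hmap hhole hpart).
  pose B := (size (Kcells s Ut w k))%:R * (1 * g).
  have B0 : 0 <= B by rewrite mulr_ge0 // mul1r.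
  have LB y : Xw s (thetan s k w) y -> Ln s w k (\1_(Jw s w)) y <= B.
    move=> Xy; apply: (le_trans (ler_norm _)).
    apply: (Ln_bound hmap hpot hpart k1' Xy ler01).
    by move=> z _; rewrite indicE; case: (_ \in _); rewrite ?normr1 ?normr0.
  have H0 : Ln s w k (\1_Z) x <= g * ((a + 2 * b + 1 + (2 * a + 4 * b) * e) * 2).
    apply/ler_addgt0Pr => t t0.
    have B1 : 0 < B + 1 by lra.
    have : ratio_inf s w k (\1_Z) < t / (B + 1) by rewrite Q0 divr_gt0.
    move=> /inf_lt[|_ [y Sy <-]].
      by have [y Sy] := Sw_neq0 hhole w k; eexists; exists y.
    have Ly := Ln1_gt0 hbase hmap hpart Sy; rewrite ltr_pdivrMr // => Hy.
    apply: (le_trans (Hx y Sy)); rewrite addrC lerD2l; apply: (le_trans (ltW Hy)).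
    have [Xy _] := (SwE hbase _ _ _).1 Sy.
    rewrite mulrAC ler_pdivrMr //; apply: ler_wpM2l; first exact: ltW.
    by apply: (le_trans (LB y Xy)); lra.
  apply: (le_trans H0); rewrite /D.
  have H2 : a + 2 * b + 1 + (2 * a + 4 * b) * e <= (a + 2 * b + 1 + (2 * a + 4 * b)) * Num.max 1 e.
    rewrite [leRHS]mulrDl; apply: lerD; first by rewrite ler_peMr //; lra.
    by rewrite ler_wpM2l //; lra.
  have H3 := ler_wpM2r g0 H2; move: H3.
  set E := a + 2 * b + 1 + _ * e; set K := a + 2 * b + 1 + _; set M := Num.max 1 e => H3.
  have -> : g * (E * 2) = 2 * (E * g) by ring.
  have -> : 2 * K * (M * g) = 2 * (K * M * g) by ring.
  by rewrite ler_wpM2l.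
apply: (@le_trans _ _ (\sum_(Z <- Kcells s Ut w n) Ln s w k (\1_Z) x)); last first.
  apply: (@le_trans _ _ (\sum_(Z <- Kcells s Ut w n) D)).
    by rewrite big_seq [leRHS]big_seq; exact: ler_sum.
  by rewrite big_const_seq count_predT iter_addr addr0 /c /D -[leLHS]mulr_natl !mulrA.
(* As n <= k, each surviving cell at time k lies in K_{w,n-1}, which the n-cells cover; there 1_J is
   at most the sum of the 1_Z. *)
rewrite -(Ln_sum hmap hpart _ _ _ _ (fun (Z : set R) => \1_Z)).
rewrite (Ln_cells hmap hpot hpart) // [leRHS](Ln_cells hmap hpot hpart) //.
rewrite big_seq [leRHS]big_seq; apply: ler_sum => C CK.
have [UC CKw] := (mem_Kcells hpart w C k1').1 CK.
apply: (Ln_le hmap hpart) => // y Xy; have [Cy|nC] := pselect (C y); last by rewrite !(indicN nC) !mulr0.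
rewrite !(indicT Cy) !mulr1.
have [_ Ky] := CKw y Cy.
have Kny : Kw s w n.-1 y by split=> // i ni; apply: Ky; lia.
have [Z ZK Zy] := Kcells_cover hpart n1 Kny.
rewrite (bigD1_seq Z ZK) /=; last by rewrite filter_uniq // cells_uniq.
rewrite (indicT Zy) indicT; last exact: (Ky 0%N).
by rewrite lerDl sumr_ge0 // => Z' _; exact: indic_ge0.
Qed.

End good_cells.

(** * Maximal ergodic inequality *)

Lemma integral_cst_probability (R : realType) (d : measure_display)
    (T : measurableType d) (P : probability T R) (c : R) :
  (\int[P]_w c%:E = c%:E)%E.
Proof.
transitivity (\int[P]_(w in setT) (cst c%:E w))%E => //.
rewrite integral_cst //; apply: etrans (mule1 _); congr (_ * _)%E.
exact: probability_setT.
Qed.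

Section maximal_ergodic.
Context {R : realType} {d : measure_display} {T : measurableType d}.
Variables (P : probability T R) (tau : T -> T).
Hypothesis mtau : measurable_fun setT tau.
Hypothesis Ptau : forall A, measurable A -> P (tau @^-1` A) = P A.
Implicit Types (f h : T -> R) (n : nat).

Lemma integral_pushforward_preserving (f : T -> \bar R) :
  (\int[pushforward P tau]_x f x = \int[P]_x f x)%E.
Proof. by apply: eq_measure_integral => A mA _; exact: Ptau. Qed.

Lemma preserving_integrable (f : T -> \bar R) :
  P.-integrable setT f -> P.-integrable setT (f \o tau).
Proof.
move=> /integrableP[mf If]; apply/integrableP; split; first exact: (measurableT_comp mf mtau).
rewrite [ltLHS](_ : _ = \int[P]_x `|f x|)%E //.
rewrite -integral_pushforward_preserving (@ge0_integral_pushforward _ _ _ _ _ _ mtau) //.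
exact: (measurableT_comp _ mf).
Qed.

Lemma preserving_integral (f : T -> \bar R) :
  P.-integrable setT f -> (\int[P]_x f (tau x) = \int[P]_x f x)%E.
Proof.
move=> If; rewrite -[RHS]integral_pushforward_preserving.
rewrite (@integral_pushforward _ _ _ _ _ _ mtau P setT f) //.
- exact: measurable_int If.
- exact: preserving_integrable.
Qed.

(** The maximum of the Birkhoff sums of h with 0 to n terms. *)
Fixpoint maxsum h n (x : T) : R :=
  if n is n'.+1 then Num.max 0 (h x + maxsum h n' (tau x)) else 0.

Lemma maxsum_ge0 h n x : 0 <= maxsum h n x.
Proof. by case: n => //= n; rewrite le_max lexx. Qed.

Lemma maxsum_nd h n x : maxsum h n x <= maxsum h n.+1 x.
Proof.
elim: n x => [|n IH] x; first by rewrite maxsum_ge0.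
rewrite [leLHS]/= [leRHS]/= ge_max le_max lexx /=.
by rewrite le_max lerD2l IH orbT.
Qed.

Lemma le_maxsum h m n x : (m <= n)%N -> maxsum h m x <= maxsum h n x.
Proof.
move=> /subnK <-; elim: (n - m)%N => [|k IH] //.
by rewrite addSn (le_trans IH) // maxsum_nd.
Qed.

Lemma sum_le_maxsum h n x : \sum_(i < n) h (iter i tau x) <= maxsum h n x.
Proof.
elim: n x => [|n IH] x; first by rewrite big_ord0.
rewrite big_ord_recl /= le_max lerD2l; apply/orP; right.
apply: le_trans (IH _); apply: ler_sum => i _.
by rewrite -iterS iterSr.
Qed.

Definition maxsum_bounded h : set T := [set x | exists m : nat, forall n, maxsum h n x <= m%:R].

Lemma maxsum_bounded_tau h x : maxsum_bounded h x <-> maxsum_bounded h (tau x).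
Proof.
split=> -[m Hm].
- exists (m + Num.Def.archi_bound `|h x|)%N => n.
  have H1 := Hm n.+1; have : h x + maxsum h n (tau x) <= m%:R.
    by apply: le_trans H1; rewrite /= le_max lexx orbT.
  have := archi_boundP (normr_ge0 (h x)); have := ler_norm (- h x).
  by rewrite normrN natrD; lra.
- exists (m + Num.Def.archi_bound `|h x|)%N => -[|n] //=.
  rewrite ge_max ler0n /=; have := Hm n.
  have := archi_boundP (normr_ge0 (h x)); have := ler_norm (h x).
  by rewrite natrD; lra.
Qed.

Lemma measurable_maxsum h n : measurable_fun setT h -> measurable_fun setT (maxsum h n).
Proof.
move=> mh; elim: n => [|n IH]; first exact: measurable_cst.
apply: measurable_maxr; first exact: measurable_cst.
apply: measurable_funD => //; exact: (measurableT_comp IH mtau).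
Qed.

Lemma measurable_maxsum_le h j (r : T -> T) : measurable_fun setT h ->
  measurable_fun setT r -> d.-measurable [set x | forall n, maxsum h n (r x) <= j].
Proof.
move=> mh mr.
rewrite (_ : [set x | forall n, maxsum h n (r x) <= j] = \bigcap_n ((maxsum h n \o r) @^-1` [set y | y <= j])); last first.
  by apply/seteqP; split=> [x H n _|x H n]; [exact: (H n)|exact: (H n I)].
apply: bigcap_measurable => [|n _]; first by exists 0%N.
rewrite -[X in measurable X]setTI; apply: (measurableT_comp (measurable_maxsum n mh) mr) => //.
by rewrite (_ : mkset _ = `]-oo, j]%classic) //; apply/seteqP; split=> y; rewrite /= in_itv.
Qed.

Lemma maxsum_boundedE h : maxsum_bounded h =
  \bigcup_(m : nat) [set x | forall n, maxsum h n x <= m%:R].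
Proof. by apply/seteqP; split=> x [m]; [move=> H; exists m|move=> _ H; exists m]. Qed.

Lemma measurable_maxsum_bounded h : measurable_fun setT h -> measurable (maxsum_bounded h).
Proof.
move=> mh; rewrite maxsum_boundedE; apply: bigcup_measurable => m _.
have H := @measurable_maxsum_le h m%:R id mh (@measurable_id _ T setT). exact: H.
Qed.

Lemma integrable_maxsum h n : P.-integrable setT (EFin \o h) ->
  P.-integrable setT (EFin \o maxsum h n).
Proof.
move=> Ih.
have mh : measurable_fun setT h by apply/measurable_EFinP; exact: measurable_int Ih.
elim: n => [|n IH]; first exact: integrable0.
apply: (@le_integrable _ _ _ P setT measurableT _ (EFin \o (fun x => h x + maxsum h n (tau x)))).
- by apply/measurable_EFinP; exact: (measurable_maxsum n.+1 mh).
- move=> x _ /=; rewrite lee_fin; have [H|H] := leP 0 (h x + maxsum h n (tau x)) => //.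
  by rewrite normr0.
- rewrite (_ : EFin \o _ = (EFin \o h) \+ ((EFin \o maxsum h n) \o tau))%E //.
  by apply: integrableD => //; exact: preserving_integrable.
Qed.

(* Garsia's proof of the maximal ergodic theorem. *)
Lemma maxsum_bounded_neq0 h : P.-integrable setT (EFin \o h) ->
  (\int[P]_x (h x)%:E < 0)%E -> P (maxsum_bounded h) <> 0%E.
Proof.
move=> Ih h0 PE.
have mh : measurable_fun setT h by apply/measurable_EFinP; exact: measurable_int Ih.
(* By invariance and monotonicity in n, D_n has nonnegative integral. It equals max(-M_n(tau x), h
   x), is dominated by |h|, and is eventually h x wherever the maxima are unbounded; if that is
   almost everywhere, the integral of h is nonnegative. *)
pose D n x := maxsum h n.+1 x - maxsum h n (tau x).
have DE n x : D n x = Num.max (- maxsum h n (tau x)) (h x).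
  by rewrite /D /= addr_maxl add0r addrK.
have ID n : (0 <= \int[P]_x (D n x)%:E)%E.
  have -> : (\int[P]_x (D n x)%:E = \int[P]_x ((maxsum h n.+1 x)%:E - (maxsum h n (tau x))%:E))%E by [].
  have It : P.-integrable setT (EFin \o (fun x => maxsum h n (tau x))).
    exact: (preserving_integrable (integrable_maxsum n Ih)).
  rewrite integralB_EFin //; last exact: integrable_maxsum.
  rewrite (preserving_integral (f := EFin \o maxsum h n)); last exact: integrable_maxsum.
  rewrite sube_ge0; last by apply/orP; right; apply: integrable_fin_num => //; exact: integrable_maxsum.
  apply: le_integral => //; try exact: integrable_maxsum.
  by move=> x _; rewrite lee_fin; exact: maxsum_nd.
have aeE : {ae P, forall x, ~ maxsum_bounded h x}.
  exists (maxsum_bounded h); split=> //; first exact: measurable_maxsum_bounded.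
  by move=> x /= /contrapT.
have cvD : {ae P, forall x, setT x -> (EFin \o D^~ x) n @[n --> \oo] --> (h x)%:E}.
  apply: filterS aeE => x nb _.
  have [N HN] : exists N, - h x <= maxsum h N (tau x).
    apply: contrapT => H; apply: nb; apply/maxsum_bounded_tau.
    exists (Num.Def.archi_bound `|h x|) => n; apply: ltW.
    apply: (le_lt_trans _ (archi_boundP (normr_ge0 _))).
    rewrite leNgt; apply/negP => H'; apply: H; exists n.
    by apply: ltW; apply: le_lt_trans H'; rewrite -normrN ler_norm.
  apply: cvg_near_cst; exists N => // n /= Nn; rewrite DE max_r //.
  by rewrite lerNl (le_trans HN) // le_maxsum.
have [||||_ _ cvI] := @dominated_convergence _ _ _ P setT measurableT
    (fun n x => (D n x)%:E) (EFin \o h) (fun x => `|(h x)%:E|)%E _ _ cvD.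
- move=> n; apply/measurable_EFinP; apply: measurable_funB; first exact: (measurable_maxsum n.+1 mh).
  exact: (measurableT_comp (measurable_maxsum n mh) mtau).
- exact/measurable_EFinP.
- exact: integrable_abse.
- apply: aeW => x n _; rewrite /= lee_fin DE.
  have M0 := maxsum_ge0 h n (tau x).
  have [H|H] := leP (- maxsum h n (tau x)) (h x) => //.
  by rewrite normrN ger0_norm //; have := ler_norm (- h x); rewrite normrN; lra.
have : (0 <= \int[P]_x (h x)%:E)%E.
  rewrite -[leRHS](cvg_lim _ cvI) //; apply: lime_ge; last exact: nearW.
  by apply/cvg_ex; eexists; exact: cvI.
by rewrite leNgt h0.
Qed.

End maximal_ergodic.

(** The least index, set to 0 off the union of the [A j] so that its level sets are measurable
    everywhere. *)
Lemma first_index (R : realType) (d : measure_display) (T : measurableType d)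
    (P : probability T R) (A : nat -> set T) :
  (forall j, measurable (A j)) -> {ae P, forall x, exists j, A j x} ->
  exists2 m : T -> nat, (forall k, measurable (m @^-1` [set k])) &
    {ae P, forall x, A (m x) x}.
Proof.
move=> mA aeA.
pose m x := if pselect (exists j, `[< A j x >]) is left H then ex_minn H else 0%N.
have mE x : (exists j, A j x) -> A (m x) x /\ forall k, (k < m x)%N -> ~ A k x.
  move=> Ax; rewrite /m; case: pselect => [H|]; last by case; have [j] := Ax; exists j; apply/asboolP.
  case: ex_minnP => k /asboolP Ak Hk; split=> // i ik /asboolP /Hk.
  by rewrite leqNgt ik.
exists m; last by apply: filterS aeA => x /mE[].
have mF k : measurable (A k `\` \bigcup_(i in `I_k) A i).
  by apply: measurableD => //; apply: bigcup_measurable.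
case=> [|k].
- rewrite (_ : _ @^-1` _ = A 0%N `|` ~` (\bigcup_j A j)).
    by apply: measurableU => //; apply: measurableC; exact: bigcup_measurable.
  apply/seteqP; split=> x /=.
  + move=> mx; have [[j Aj]|nA] := pselect (exists j, A j x).
      by left; have [+ _] := mE x (ex_intro _ j Aj); rewrite mx.
    by right=> -[j _ Aj]; apply: nA; exists j.
  + move=> H; apply/eqP; rewrite -leqn0 leqNgt; apply/negP => m0.
    case: H => [A0|nA]; first by have [_ /(_ 0%N m0)] := mE x (ex_intro _ _ A0).
    move: m0; rewrite /m; case: pselect => // H0 _; have [j /asboolP Aj] := H0.
    by case: nA; exists j.
- rewrite (_ : _ @^-1` _ = A k.+1 `\` \bigcup_(i in `I_k.+1) A i) //.
  apply/seteqP; split=> x /=.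
  + move=> mx; have Ax : exists j, A j x.
      move: mx; rewrite /m; case: pselect => // H0 _; by have [j /asboolP Aj] := H0; exists j.
    have [+ H] := mE x Ax; rewrite mx => Ak; split=> // -[i /= ik Ai].
    by apply: (H i) => //; rewrite mx.
  + move=> [Ak nA]; have [Am Hm] := mE x (ex_intro _ _ Ak).
    case: (ltngtP (m x) k.+1) => // h; last by case: (Hm _ h).
    by case: nA; exists (m x).
Qed.

(** * Bounded and tempered sequences along backward orbits *)

Section ergodic.
Context {R : realType} {d : measure_display} {Omega : measurableType d}.
Variables (P : probability Omega R) (s : open_system R Omega).
Hypothesis hbase : base_assumptions P s.
Implicit Types (w : Omega) (h : Omega -> R).

Lemma thetaV_preserving A : measurable A -> P (thetaV s @^-1` A) = P A.
Proof.
move=> mA.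
have mB : measurable (thetaV s @^-1` A).
  by rewrite -[X in measurable X]setTI; exact: (base_measurableV hbase).
rewrite -(base_preserving hbase mB); congr (P _); apply/seteqP.
by split=> w /=; rewrite (base_thetaK hbase).
Qed.

Lemma measurable_thetaVn n : measurable_fun setT (thetaVn s n).
Proof.
elim: n => [|n IH]; first exact: measurable_id.
exact: (measurableT_comp (base_measurableV hbase) IH).
Qed.

Lemma thetaVn_preserving n A : measurable A -> P (thetaVn s n @^-1` A) = P A.
Proof.
elim: n A => // n IH A mA.
rewrite (_ : _ @^-1` A = thetaVn s n @^-1` (thetaV s @^-1` A)) //.
rewrite IH ?thetaV_preserving //.
by rewrite -[X in measurable X]setTI; exact: (base_measurableV hbase).
Qed.

Lemma ae_thetaVn (Q : Omega -> Prop) : {ae P, forall w, Q w} ->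
  {ae P, forall w, forall n, Q (thetaVn s n w)}.
Proof.
move=> [N [mN PN QN]]; apply: ae_foralln => n.
exists (thetaVn s n @^-1` N); split.
- by rewrite -[X in measurable X]setTI; exact: measurable_thetaVn.
- exact: (etrans (thetaVn_preserving n mN) PN).
- by move=> w Hw; apply: QN.
Qed.

(* theta^N need not be ergodic, but the set of w for which the sums along some
   residue class are bounded is theta-invariant. *)
Lemma bounded_sums N h : (1 <= N)%N -> P.-integrable setT (EFin \o h) ->
  (\int[P]_w (h w)%:E < 0)%E ->
  exists2 m : Omega -> nat, (forall k, measurable (m @^-1` [set k])) &
    {ae P, forall w, exists2 r, (r < N)%N & forall k,
      \sum_(i < k) h (thetaVn s (r + i * N) w) <= (m w)%:R}.
Proof.
move=> N1 Ih h0.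
have mh : measurable_fun setT h by apply/measurable_EFinP; exact: measurable_int Ih.
pose tau := thetaVn s N.
have mtau : measurable_fun setT tau by exact: measurable_thetaVn.
have taui i w : iter i tau w = thetaVn s (i * N) w.
  by elim: i => [|i IH] //=; rewrite IH /tau /thetaVn mulSn iterD.
pose A j := \bigcup_(r in `I_N) [set w | forall n, maxsum tau h n (thetaVn s r w) <= j%:R].
have mA j : measurable (A j).
  apply: bigcup_measurable => r _; apply: measurable_maxsum_le => //.
  exact: measurable_thetaVn.
pose G := \bigcup_j A j.
have mG : measurable G by exact: bigcup_measurable.
have GE w : G w <-> exists2 r, (r < N)%N & maxsum_bounded tau h (thetaVn s r w).
  split=> [[j _ [r rN H]]|[r rN [j H]]]; first by exists r => //; exists j.
  by exists j => //; exists r.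
have iG : theta s @^-1` G = G.
  (* Passing from theta w to w lowers the residue class by one; class 0 becomes class N - 1 because
     boundedness is invariant under [tau]. *)
  have VS r w : thetaVn s r.+1 (theta s w) = thetaVn s r w.
    by rewrite /thetaVn iterSr (base_thetaK hbase).
  apply/seteqP; split=> w /=; rewrite !GE => -[r rN H].
  - case: r rN H => [|r] rN H.
      exists N.-1; first by rewrite prednK.
      by rewrite -VS prednK //; exact: (maxsum_bounded_tau tau h (theta s w)).1 H.
    by exists r; [exact: ltnW|rewrite -VS].
  - have [rN'|] := ltnP r.+1 N; first by exists r.+1; rewrite ?VS.
    move=> Nr; have rE : r.+1 = N by apply/eqP; rewrite eqn_leq rN Nr.
    exists 0%N => //; apply: (maxsum_bounded_tau tau h (theta s w)).2.
    by have -> : tau (theta s w) = thetaVn s r w by rewrite /tau -rE VS.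
have PG : P G = 1%E.
  (* [G] contains the set belonging to r = 0, which is not null by the maximal inequality for
     [tau]. *)
  have [PG0|//] := base_ergodic hbase mG iG; exfalso.
  apply: (maxsum_bounded_neq0 mtau (thetaVn_preserving N) Ih h0).
  apply/eqP; rewrite -measure_le0 -PG0; apply: le_measure; rewrite ?inE //.
    exact: measurable_maxsum_bounded.
  by move=> w Hw; apply/GE; exists 0%N.
have [m mm Am] : exists2 m : Omega -> nat, (forall k, measurable (m @^-1` [set k])) &
    {ae P, forall x, A (m x) x}.
  apply: first_index => //; exists (~` G); split.
  - exact: measurableC.
  - by rewrite probability_setC // PG subee.
  - by move=> w nA [j _ Aj]; apply: nA; exists j.
exists m => //; apply: filterS Am => w [r rN H]; exists r => // k.
apply: le_trans (H k); apply: le_trans (sum_le_maxsum tau h k _).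
apply: ler_sum => i _; rewrite taui /thetaVn -iterD addnC //.
Qed.

(** [bounded_sums] with N = 1, applied to |h| - (E + e/2) and (E - e/2) - |h| with E the mean of
    |h|, bounds the sums S_{j+1} from above and S_j from below; their difference is |h| at
    theta^{-j} w. *)
Lemma tempered h (e : R) : 0 < e -> P.-integrable setT (EFin \o h) ->
  exists2 m : Omega -> nat, (forall k, measurable (m @^-1` [set k])) &
    {ae P, forall w, forall j, `|h (thetaVn s j w)| <= (m w)%:R + e * j%:R}.
Proof.
move=> e0 Ih.
have mh : measurable_fun setT h by apply/measurable_EFinP; exact: measurable_int Ih.
have Ia : P.-integrable setT (EFin \o (fun w => `|h w|)) by exact: (integrable_abse Ih).
have fin_a : (\int[P]_w (`|h w|)%:E)%E \is a fin_num by exact: integrable_fin_num.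
pose E := fine (\int[P]_w (`|h w|)%:E)%E.
have EE : (\int[P]_w (`|h w|)%:E)%E = E%:E by rewrite fineK.
have Ic c : P.-integrable setT (EFin \o cst c) by exact: finite_measure_integrable_cst.
have Iic c : (\int[P]_w (cst c w)%:E)%E = c%:E by exact: integral_cst_probability.
pose c := E + e / 2.
have c1 : (\int[P]_w (`|h w| - cst c w)%:E)%E = (E - c)%:E.
  by rewrite (integralB_EFin measurableT Ia (Ic c)) EE Iic.
have I1 : P.-integrable setT (EFin \o (fun w => `|h w| - cst c w)).
  rewrite (_ : EFin \o _ = (EFin \o (fun w => `|h w|%R)) \- (EFin \o cst c))%E //.
  exact: integrableB.
pose c' := E - e / 2.
have c2 : (\int[P]_w (cst c' w - `|h w|)%:E)%E = (c' - E)%:E.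
  by rewrite (integralB_EFin measurableT (Ic c') Ia) EE Iic.
have I2 : P.-integrable setT (EFin \o (fun w => cst c' w - `|h w|)).
  rewrite (_ : EFin \o _ = (EFin \o cst c') \- (EFin \o (fun w => `|h w|%R)))%E //.
  exact: integrableB.
have [|m1 _ H1] := bounded_sums (leqnn 1) I1.
  by rewrite c1 lte_fin /c; lra.
have [|m2 _ H2] := bounded_sums (leqnn 1) I2.
  by rewrite c2 lte_fin /c'; lra.
pose A k := [set w | forall j, `|h (thetaVn s j w)| <= k%:R + e * j%:R].
apply: (@first_index _ _ _ P A).
  move=> k; rewrite (_ : A k = \bigcap_j ((fun w => `|h (thetaVn s j w)|) @^-1` [set y | y <= k%:R + e * j%:R])).
    apply: bigcap_measurable => [|j _]; first by exists 0%N.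
    rewrite -[X in measurable X]setTI.
    have mf : measurable_fun setT (fun w => `|h (thetaVn s j w)|).
      by apply: measurableT_comp => //; exact: (measurableT_comp mh (measurable_thetaVn j)).
    apply: mf => //.
    by rewrite (_ : mkset _ = `]-oo, k%:R + e * j%:R]%classic) //; apply/seteqP; split=> y; rewrite /= in_itv.
  by apply/seteqP; split=> [w H j _|w H j]; [exact: (H j)|exact: (H j I)].
apply: filterS2 H1 H2 => w [[|//] _ H1] [[|//] _ H2].
exists (m1 w + m2 w + Num.Def.archi_bound `|c|)%N => j.
pose S k := \sum_(i < k) `|h (thetaVn s i w)|.
have E1 k : S k - k%:R * c <= (m1 w)%:R.
  apply: le_trans (H1 k); rewrite sumrB /cst sumr_const card_ord -[c *+ k]mulr_natl.
  by rewrite lerD2r /S; apply: ler_sum => i _; rewrite add0n muln1.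
have E2 k : k%:R * c' - S k <= (m2 w)%:R.
  apply: le_trans (H2 k); rewrite sumrB /cst sumr_const card_ord -[c' *+ k]mulr_natl.
  by rewrite lerD2l lerN2 /S; apply: ler_sum => i _; rewrite add0n muln1.
have := E1 j.+1; have := E2 j; rewrite /S big_ord_recr /= -/(S j) -natr1.
have := archi_boundP (normr_ge0 c); have := ler_norm c.
rewrite !natrD /c /c'; lra.
Qed.

End ergodic.

(** * The recursion along an orbit *)

Section recursion.
Context {R : realType}.
Implicit Types (v al be h : nat -> R) (n j k t N : nat).

Lemma one_steps v al n (Phi A : R) : 0 <= Phi -> (forall j, 0 <= v j) -> 1 <= A ->
  (forall j, (j < n)%N -> v j <= al j.+1 * (v j.+1 + Phi)) ->
  forall t j, (j + t <= n)%N -> (forall i, (i <= j + t)%N -> al i <= A) ->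
  v j <= A ^+ t * (v (j + t)%N + t%:R * Phi).
Proof.
move=> P0 v0 A1 H t; elim: t => [|t IH] j jt alA.
  by rewrite addn0 expr0 mul0r addr0 mul1r.
have A0 : 0 <= A by apply: le_trans A1.
have vP : 0 <= v j.+1 + Phi by rewrite addr_ge0.
apply: (le_trans (H j _)); first by lia.
have aj : al j.+1 <= A by apply: alA; lia.
apply: (@le_trans _ _ (A * (v j.+1 + Phi))); first by rewrite ler_wpM2r.
rewrite exprS -mulrA ler_wpM2l //.
have E : (j.+1 + t = j + t.+1)%N by lia.
have {}IH := IH j.+1 ltac:(by rewrite E) ltac:(by rewrite E).
rewrite E in IH.
have At : 1 <= A ^+ t by rewrite exprn_ege1.
have : Phi <= A ^+ t * Phi by rewrite ler_peMl.
by rewrite -natr1 !mulrDr mulrDl mul1r mulrDr in IH *; lra.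
Qed.

Lemma geometric_sum_le (q : R) k : 0 <= q -> q < 1 -> \sum_(i < k) q ^+ i <= (1 - q)^-1.
Proof.
move=> q0 q1; have q1' : 0 < 1 - q by rewrite subr_gt0.
rewrite -[leRHS]mul1r ler_pdivlMr // mulrC.
have -> : (1 - q) * \sum_(i < k) q ^+ i = 1 - q ^+ k.
  by rewrite -[X in X - q ^+ k](expr1n R k) subrXX; congr (_ * _); apply: eq_bigr => i _; rewrite expr1n mul1r.
by rewrite gerBl exprn_ge0.
Qed.

Lemma block_steps v h be n N r (Phi : R) : 0 <= Phi -> (forall j, 0 <= v j) ->
  (forall j, (j + N <= n)%N -> v j <= expR (h (j + N)%N) * v (j + N)%N + be (j + N)%N * Phi) ->
  forall k, (r + k * N <= n)%N ->
  v r <= expR (\sum_(i < k) h (r + i.+1 * N)%N) * v (r + k * N)%N +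
     (\sum_(i < k) expR (\sum_(l < i) h (r + l.+1 * N)%N) * be (r + i.+1 * N)%N) * Phi.
Proof.
move=> P0 v0 H; elim=> [|k IH] kn.
  by rewrite !big_ord0 expR0 mul1r mul0r addr0 mul0n addn0.
have E : (r + k * N + N = r + k.+1 * N)%N by rewrite mulSn; lia.
have {}IH := IH ltac:(by lia).
have Hk := H (r + k * N)%N ltac:(by rewrite E).
rewrite E in Hk; apply: (le_trans IH).
rewrite !big_ord_recr /= expRD.
have := ler_wpM2l (expR_ge0 (\sum_(i < k) h (r + i.+1 * N)%N)) Hk.
lra.
Qed.

(** From 0 to r single steps with bounded constants, from r to r + kN blocks, and fewer than N
    single steps up to n. The constant is chosen before v, n, r and Phi, so it depends on the orbit
    only through m and K. *)
Lemma recursion_bound N (xi e eps : R) (m K : nat) : (1 <= N)%N -> 0 < e ->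
  (N%:R + 2) * e <= xi -> (N%:R + 2) * e <= eps ->
  exists2 C : R, 0 < C &
    forall v h al be n r (Phi : R), 0 <= Phi -> (forall j, 0 <= v j) -> (r < N)%N ->
    (forall j, (j < n)%N -> v j <= al j.+1 * (v j.+1 + Phi)) ->
    (forall j, (j + N <= n)%N -> v j <= expR (h (j + N)%N) * v (j + N)%N + be (j + N)%N * Phi) ->
    (forall j, al j <= expR (K%:R + e * j%:R)) ->
    (forall j, be j <= expR (K%:R + e * j%:R)) ->
    (forall k, \sum_(i < k) h (r + i.+1 * N)%N <= m%:R - (k * N)%:R * (xi - e)) ->
    v 0%N <= C * expR (- ((xi - eps) * n%:R)) * v n + C * Phi.
Proof.
move=> N1 e0 exi eeps.
have NR : 1 <= N%:R :> R by rewrite ler1n.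
have xi2 : 0 < xi - 2 * e by nra.
(* Per block, the products decay at rate xi - e and the additive constants [be] grow at rate e; [B]
   is the resulting geometric series. *)
pose q := expR (- (N%:R * (xi - 2 * e))).
have q0 : 0 <= q by exact: expR_ge0.
have q1 : q < 1 by rewrite -[ltRHS]expR0 ltr_expR oppr_lt0 mulr_gt0 //; lra.
pose B := expR (m%:R + K%:R + 2 * e * N%:R) * (1 - q)^-1.
have B0 : 0 <= B by rewrite mulr_ge0 ?expR_ge0 // invr_ge0; lra.
pose A0 := expR (K%:R + e * N%:R).
have A01 : 1 <= A0 by rewrite -[leLHS]expR0 ler_expR addr_ge0 // mulr_ge0 // ltW.
pose D := expR (m%:R + N%:R * K%:R + 2 * N%:R * (xi - e)).
have D0 : 0 <= D by exact: expR_ge0.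
(* Only for n <= r: it compensates exp(-(xi - eps) n), whose exponent may have either sign. *)
pose Z := expR ((`|xi| + `|eps|) * N%:R).
have Z1 : 1 <= Z by rewrite -[leLHS]expR0 ler_expR mulr_ge0 // addr_ge0.
pose C := A0 ^+ N * (D * N%:R + D + B + N%:R) + A0 ^+ N * (N%:R * Z).
have A0N : 1 <= A0 ^+ N by rewrite exprn_ege1.
have C0 : 0 < C.
  rewrite /C -mulrDr; apply: mulr_gt0; first by lra.
  by have : 0 <= D * N%:R by [rewrite mulr_ge0]; nra.
exists C => // v h al be n r Phi P0 v0 rN H1 HN Hal Hbe Hh.
have alle M i : (i <= M)%N -> al i <= expR (K%:R + e * M%:R).
  by move=> iM; apply: (le_trans (Hal i)); rewrite ler_expR lerD2l ler_wpM2l ?ler_nat // ltW.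
have En : 0 <= expR (- ((xi - eps) * n%:R)) by exact: expR_ge0.
have [nr|rn] := leqP n r.
  have nN : (n <= N)%N := leq_trans nr (ltnW rN).
  have S := one_steps P0 v0 A01 H1 (t := n) (j := 0) (leqnn n)
    (fun i hi => alle N i (leq_trans hi nN)).
  rewrite add0n in S; apply: (le_trans S).
  have A0n : A0 ^+ n <= A0 ^+ N by rewrite ler_weXn2l.
  have An0 : 0 <= A0 ^+ n by rewrite exprn_ge0 //; lra.
  have nNR : n%:R <= N%:R :> R by rewrite ler_nat.
  have Zn : 1 <= Z * expR (- ((xi - eps) * n%:R)).
    rewrite /Z -expRD -[leLHS]expR0 ler_expR.
    have h1 := ler_norm xi; have h2 := ler_norm (- eps); rewrite normrN in h2.
    have h3 : (xi - eps) * n%:R <= (`|xi| + `|eps|) * n%:R by rewrite ler_wpM2r //; lra.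
    have h4 : (`|xi| + `|eps|) * n%:R <= (`|xi| + `|eps|) * N%:R by rewrite ler_wpM2l // addr_ge0.
    by lra.
  have CZ : A0 ^+ N * (N%:R * Z) <= C.
    rewrite /C lerDr mulr_ge0 //; first lra.
    by have : 0 <= D * N%:R by [rewrite mulr_ge0]; lra.
  rewrite mulrDr; apply: lerD.
    rewrite ler_wpM2r //; apply: (le_trans A0n).
    apply: (@le_trans _ _ (A0 ^+ N * (N%:R * Z) * expR (- ((xi - eps) * n%:R)))); last first.
      by rewrite ler_wpM2r.
    rewrite -!mulrA ler_peMr //; first lra.
    by apply: (le_trans Zn); rewrite ler_peMl // mulr_ge0 //; lra.
  rewrite mulrA ler_wpM2r //; apply: le_trans CZ; rewrite ler_pM //.
  by rewrite -[leLHS]mulr1 ler_pM.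
pose k := ((n - r) %/ N)%N; pose t := ((n - r) %% N)%N.
have nE : n = (r + k * N + t)%N by rewrite /k /t -addnA -divn_eq subnKC // ltnW.
have tN : (t < N)%N by rewrite ltn_mod.
have S1 := one_steps P0 v0 A01 H1 (t := r) (j := 0) (ltnW rn)
    (fun i hi => alle N i (leq_trans hi (ltnW rN))).
have S2 := block_steps P0 v0 HN (r := r) (k := k) ltac:(by rewrite nE leq_addr).
pose A := expR (K%:R + e * n%:R).
have A1 : 1 <= A by rewrite -[leLHS]expR0 ler_expR addr_ge0 // mulr_ge0 // ltW.
have S3 := one_steps P0 v0 A1 H1 (t := t) (j := (r + k * N)%N) ltac:(by rewrite -nE)
   (fun i hi => alle n i ltac:(by rewrite nE)).
rewrite -nE in S3.
have Sum : \sum_(i < k) expR (\sum_(l < i) h (r + l.+1 * N)%N) * be (r + i.+1 * N)%N <= B.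
  apply: (@le_trans _ _ (\sum_(i < k) expR (m%:R + K%:R + 2 * e * N%:R) * q ^+ i)).
    apply: ler_sum => i _.
    apply: (le_trans (ler_wpM2l (expR_ge0 _) (Hbe _))).
    rewrite -expRD /q -expRM_natl -expRD ler_expR.
    have hi := Hh i.
    have h1 : (r + i.+1 * N)%:R <= (i%:R + 2) * N%:R :> R.
      by rewrite -natrD -natrM ler_nat addn2 [(i.+2 * N)%N]mulSn leq_add2r ltnW.
    have h2 : e * (r + i.+1 * N)%:R <= e * ((i%:R + 2) * N%:R) by rewrite ler_wpM2l // ltW.
    by rewrite natrM in hi; lra.
  by rewrite -mulr_sumr ler_wpM2l ?expR_ge0 // geometric_sum_le.
(* The last t < N steps cost exp(N (K + e n)), and n <= kN + 2N replaces the block time kN by n. *)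
have PA : expR (\sum_(i < k) h (r + i.+1 * N)%N) * A ^+ t <= D * expR (- ((xi - (N%:R + 1) * e) * n%:R)).
  have AtN : A ^+ t <= A ^+ N by rewrite ler_weXn2l // ltnW.
  apply: (le_trans (ler_wpM2l (expR_ge0 _) AtN)).
  rewrite /A -expRM_natl -!expRD ler_expR.
  have hk := Hh k.
  have h1 : n%:R <= (k * N)%:R + 2 * N%:R :> R.
    rewrite -natrM -natrD ler_nat nE addnAC addnC leq_add2l.
    by rewrite mul2n -addnn leq_add // ltnW.
  have h2 : n%:R * (xi - e) <= ((k * N)%:R + 2 * N%:R) * (xi - e) by rewrite ler_wpM2r //; lra.
  by lra.
have E1 : expR (- ((xi - (N%:R + 1) * e) * n%:R)) <= expR (- ((xi - eps) * n%:R)).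
  by rewrite ler_expR lerN2 ler_wpM2r //; lra.
have E2 : expR (- ((xi - (N%:R + 1) * e) * n%:R)) <= 1.
  by rewrite -[leRHS]expR0 ler_expR oppr_le0 mulr_ge0 //; lra.
set E := expR (- ((xi - eps) * n%:R)) in En E1 *.
set E' := expR (- ((xi - (N%:R + 1) * e) * n%:R)) in PA E1 E2.
set G := expR _ in S2 PA; set SS := \sum_(i < k) _ in S2 Sum.
have G0 : 0 <= G := expR_ge0 _.
have tR : t%:R <= N%:R :> R by rewrite ler_nat ltnW.
have rR : r%:R <= N%:R :> R by rewrite ler_nat ltnW.
have V1 : v r <= D * E * v n + (D * N%:R + B) * Phi.
  apply: (le_trans S2).
  have a1 : G * v (r + k * N)%N <= G * A ^+ t * (v n + t%:R * Phi).
    by rewrite -mulrA ler_wpM2l.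
  have a2 : G * A ^+ t * (v n + t%:R * Phi) <= D * E' * (v n + t%:R * Phi).
    by rewrite ler_wpM2r // addr_ge0 // mulr_ge0.
  have a3 : D * E' * v n <= D * E * v n by rewrite ler_wpM2r // ler_wpM2l.
  have a4 : D * E' * (t%:R * Phi) <= D * 1 * (N%:R * Phi).
    by apply: ler_pM; rewrite ?mulr_ge0 ?expR_ge0 //; [rewrite ler_wpM2l|rewrite ler_wpM2r].
  have a5 : SS * Phi <= B * Phi by rewrite ler_wpM2r.
  by rewrite mulrDr in a2; rewrite mulrDl; lra.
have Ar : A0 ^+ r <= A0 ^+ N by rewrite ler_weXn2l // ltnW.
rewrite add0n in S1; apply: (le_trans S1).
apply: (@le_trans _ _ (A0 ^+ N * (D * E * v n + (D * N%:R + B) * Phi + N%:R * Phi))).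
  apply: ler_pM => //.
  - by rewrite exprn_ge0 //; lra.
  - by rewrite addr_ge0 // mulr_ge0.
  - by apply: lerD => //; rewrite ler_wpM2r.
have -> : A0 ^+ N * (D * E * v n + (D * N%:R + B) * Phi + N%:R * Phi) =
   A0 ^+ N * D * (E * v n) + A0 ^+ N * (D * N%:R + B + N%:R) * Phi by ring.
have DN : 0 <= D * N%:R by rewrite mulr_ge0.
have NZ : 0 <= A0 ^+ N * (N%:R * Z) by rewrite !mulr_ge0 //; lra.
apply: lerD.
  rewrite -[leRHS]mulrA ler_wpM2r ?mulr_ge0 // /C.
  apply: (@le_trans _ _ (A0 ^+ N * (D * N%:R + D + B + N%:R))); last by rewrite lerDl.
  by rewrite ler_wpM2l //; lra.
rewrite ler_wpM2r // /C.
apply: (@le_trans _ _ (A0 ^+ N * (D * N%:R + D + B + N%:R))); last by rewrite lerDl.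
by rewrite ler_wpM2l //; lra.
Qed.

End recursion.

(** * Conclusion *)

(** The final constant is picked by choice from two integers; measurability of these integers
    suffices, whatever the choice is. *)
Lemma measurable_fun_nat2 (R : realType) (d : measure_display) (T : measurableType d)
    (m1 m2 : T -> nat) (kappa : nat -> nat -> R) :
  (forall k, measurable (m1 @^-1` [set k])) -> (forall k, measurable (m2 @^-1` [set k])) ->
  measurable_fun setT (fun w => kappa (m1 w) (m2 w)).
Proof.
move=> h1 h2 _ B mB; rewrite setTI.
rewrite (_ : _ @^-1` B = \bigcup_i \bigcup_(j in [set j | B (kappa i j)])
   ((m1 @^-1` [set i]) `&` (m2 @^-1` [set j]))).
  by do 2! (apply: bigcup_measurable => ? _); exact: measurableI.
apply/seteqP; split=> w /=; first by move=> Bw; exists (m1 w) => //; exists (m2 w).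
by move=> [i _ [j /= Bij [-> ->]]].
Qed.

Section transfer_operator_bounds.
Context {R : realType} {d : measure_display} {Omega : measurableType d}.
Variables (P : probability Omega R) (s : open_system R Omega).
Variables (nu : R.-pker Omega ~> R).
Variables (a b : R) (U Ut : Omega -> nat -> set (set R)).
Hypothesis hbase : base_assumptions P s.
Hypothesis hmap : map_assumptions s.
Hypothesis hpot : potential_assumptions P s.
Hypothesis hhole : hole_assumptions P s nu.
Hypothesis hF : functional_assumptions P s.
Hypothesis hpart : partition_assumptions P s a b U Ut.
Implicit Types (w : Omega) (n i j k : nat) (x y z : R) (f g : R -> R).

Lemma Xw_neq0 w : Xw s w !=set0.
Proof.
have [x [Xx _ _]] := Xw_dense hmap w (lexx _) (map_interval hmap) (lexx _).
by exists x.
Qed.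

Let sup_branch w i x : Zstar s w i x -> g1 s w x <= supremum_on (Zstar s w i) (g1 s w).
Proof.
move=> Zx; have [M HM] := g1_bounded hpot w; apply: ub_le_sup; last by exists x.
by exists M => _ [y Zy <-]; apply: HM; exact: (map_branch_interval hmap w i).2.
Qed.

Let sup_branch_ge0 w i : 0 <= supremum_on (Zstar s w i) (g1 s w).
Proof.
have [[x Zx]|/set0P/negP/negPn/eqP ->] := pselect (Zstar s w i !=set0).
  exact: le_trans (g1_ge0 s w x) (sup_branch Zx).
by rewrite /supremum_on image_set0 sup0.
Qed.

Lemma g1_le_S1 w x : Xw s w x -> ((g1 s w x)%:E <= S1 s w)%E.
Proof.
move=> Xx; have [i _ Zx] := map_Z1_cover hmap Xx.
apply: (@le_trans _ _ (\sum_(0 <= j < i.+1) (supremum_on (Zstar s w j) (g1 s w))%:E)%E).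
  rewrite big_nat_recr //= sumEFin -EFinD lee_fin.
  by rewrite (le_trans (sup_branch Zx)) // lerDr sumr_ge0 // => j _; exact: sup_branch_ge0.
by apply: nneseries_lim_ge => j _ _; rewrite lee_fin sup_branch_ge0.
Qed.

Lemma S1_fin w : S1 s w = (fine (S1 s w))%:E /\ 0 < fine (S1 s w).
Proof.
have [x Xx] := Xw_neq0 w.
have h := g1_le_S1 Xx; have g0 := g1_gt0 hmap hpot Xx.
have lt0 : (0 < S1 s w)%E by apply: lt_le_trans h; rewrite lte_fin.
have fS : S1 s w \is a fin_num by rewrite gt0_fin_numE // (pot_S1_lty hpot).
by rewrite fineK //; split=> //; rewrite fine_gt0 // lt0 (pot_S1_lty hpot).
Qed.

Lemma open_gnorm1_le w : open_gnorm s w 1 <= fine (S1 s w).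
Proof.
have [SE S0] := S1_fin w.
have [[x Kx]|/set0P/negP/negPn/eqP K0] := pselect (Kw s w 0 !=set0); last first.
  by rewrite /open_gnorm /= K0 /supnorm /supremum_on image_set0 sup0 ltW.
apply: ge_sup; first by eexists; exists x.
move=> _ [y [Xy _] <-]; rewrite ger0_norm ?gcn_ge0 //.
rewrite (gcnS hmap hpot) ?gcn0 ?mul1r; last by case: Xy.
by rewrite -lee_fin -SE; exact: g1_le_S1.
Qed.

(** The exponent is a sum of functions assumed integrable and a constant, so the one-step constants
    are tempered. The number 3a + 6b + 1 is the bracket at eta = 1. *)
Lemma Cst1_le w : Cst s a b Ut w 1 <=
  expR (`|ln (rho s w)| + `|ln (3 * a + 6 * b + 1)| +
        `|ln (Defs.eta s (Ut w 1) w 1)| + `|ln (fine (S1 s w))|).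
Proof.
have a0 := part_a hpart; have b1 := part_b hpart.
have [_ S0] := S1_fin w.
have r0 := rho_gt0 hF w.
have le_exp (y : R) : 0 < y -> y <= expR `|ln y|.
  by move=> y0; rewrite -[leLHS]lnK ?posrE // ler_expR ler_norm.
have k0 : 0 < 3 * a + 6 * b + 1 by lra.
rewrite /Cst {1}/rhon big_ord1 /= !expRD.
have [e eE _] := eta_nat hpart w (leqnn 1).
have g0 := open_gnorm_ge0 hmap hpot w 1.
apply: ler_pM => //; last by apply: (le_trans (open_gnorm1_le w)); exact: le_exp.
  rewrite mulr_ge0 ?invr_ge0 ?(ltW r0) // addr_ge0 ?mulr_ge0 ?(eta_ge0 hpart) //; lra.
rewrite -mulrA; apply: ler_pM => //.
- by rewrite invr_ge0 ltW.
- rewrite addr_ge0 ?mulr_ge0 ?(eta_ge0 hpart) //; lra.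
- by have := le_exp _ (ltac:(by rewrite invr_gt0) : 0 < (rho s w)^-1); rewrite lnV ?posrE // normrN.
apply: (@le_trans _ _ ((3 * a + 6 * b + 1) * expR `|ln (Defs.eta s (Ut w 1) w 1)|)); last first.
  by rewrite ler_wpM2r ?expR_ge0 ?le_exp.
have E1 : 1 <= expR `|ln (Defs.eta s (Ut w 1) w 1)| by rewrite -[leLHS]expR0 ler_expR.
have E2 : Defs.eta s (Ut w 1) w 1 <= expR `|ln (Defs.eta s (Ut w 1) w 1)|.
  move: E1; rewrite eE; case: e {eE} => [|e] E1; first by rewrite expR_ge0.
  by apply: le_exp; rewrite ltr0n.
move: E1 E2; set E := expR _; set t := Defs.eta _ _ _ _ => E1 E2.
have : (2 * a + 4 * b) * t <= (2 * a + 4 * b) * E by rewrite ler_wpM2l //; lra.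
have : (a + 2 * b + 1) * 1 <= (a + 2 * b + 1) * E by rewrite ler_wpM2l //; lra.
lra.
Qed.

Lemma norm_Ltn_le w n f x : Xw s (thetan s n w) x ->
  `|Ltn s w n f x| <= Ltn s w n (fun y => `|f y|) x.
Proof.
move=> Xx; rewrite /Ltn normrM ger0_norm ?invr_ge0; last by rewrite ltW // (rhon_gt0 hF).
rewrite ler_wpM2l ?invr_ge0 //; first by rewrite ltW // (rhon_gt0 hF).
rewrite ler_norml; apply/andP; split.
  rewrite -mulN1r -(LnZ hmap hpart); apply: (Ln_le hmap hpart) => // y _.
  by rewrite mulN1r lerNl -normrN ler_norm.
by apply: (Ln_le hmap hpart) => // y _; exact: ler_norm.
Qed.

Lemma Fw_le w f g : nonneg_bounded s w f -> nonneg_bounded s w g ->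
  (forall x, Xw s w x -> f x <= g x) -> Fw s w f <= Fw s w g.
Proof.
move=> nf ng fg.
have := @Fw_superadditive _ _ _ _ _ _ _ _ _ _ hbase hmap hhole hpart unit [:: tt] xpredT w g
  (fun _ => 1) (fun _ => f) ng.
rewrite !big_cons big_nil addr0 mul1r; apply => // x Xx.
by rewrite big_cons big_nil addr0 mul1r fg.
Qed.

Lemma thetan_thetaVn m n w : thetan s m (thetaVn s (m + n) w) = thetaVn s n w.
Proof. by rewrite /thetaVn iterD; exact: (thetaVnK hbase). Qed.

(* v j is the variation of the normalized iterate on the fiber over theta^{-j} w. *)
Lemma backward_steps w n f V (Hc : forall j, contracting_at s Ut (thetaVn s j w)) :
  varle (Xw s (thetaVn s n w)) f V ->
  exists v : nat -> R,
  [/\ forall j, 0 <= v j, v n <= V, varle (Xw s w) (Ltn s (thetaVn s n w) n f) (v 0%N) &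
    forall q j (delta : R), (1 <= q)%N -> (j + q <= n)%N -> 0 < delta ->
      (forall A, Zg s (Ut (thetaVn s (j + q) w) q) (thetaVn s (j + q) w) q A ->
         2 * delta <= Fw s (thetaVn s (j + q) w) (\1_A)) ->
      v j <= Cst s a b Ut (thetaVn s (j + q) w) q * v (j + q)%N +
        Cst s a b Ut (thetaVn s (j + q) w) q / delta *
          Fw s w (Ltn s (thetaVn s n w) n (fun x => `|f x|))].
Proof.
move=> HV; set wn := thetaVn s n w.
have [M HM] := varle_bounded HV.
have nf : nonneg_bounded s wn (fun x => `|f x|) by split=> [x _|]; [exact: normr_ge0|exists M].
pose g j := Ltn s wn (n - j) f.
have fib j : (j <= n)%N -> thetan s (n - j) wn = thetaVn s j w.
  by move=> jn; rewrite -(thetan_thetaVn (n - j) j w) subnK.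
(* Finiteness of every intermediate variation comes from one inequality of length n - j, with no
   control of its constant; it makes [rvar] usable below. *)
have gV j : exists W, (j <= n)%N -> varle (Xw s (thetaVn s j w)) (g j) W.
  have [jn|nj] := leqP j n; last by exists 0.
  move: jn; rewrite leq_eqVlt => /orP[/eqP ->|jn].
    exists V => _; rewrite /g subnn; apply: eq_varle HV => x _.
    by rewrite /Ltn /rhon big_ord0 invr1 mul1r.
  have k1 : (1 <= n - j)%N by rewrite subn_gt0.
  have [delta [delta0 _ Hd]] := part_delta hpart k1.
  have Z0 := Zg_neq0 hbase hmap hpot hhole hpart (Hc n) k1.
  have := lasota_yorke_normalized hbase hmap hpot hhole hF hpart k1 Z0 (delta0 wn) (Hd wn) HV.
  by rewrite fib ?(ltnW jn) // => H; eexists => _; exact: H.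
have gB j : (j <= n)%N -> varle (Xw s (thetaVn s j w)) (g j) (rvar (Xw s (thetaVn s j w)) (g j)).
  by move=> jn; have [W HW] := gV j; exact: varle_rvar (HW jn).
exists (fun j => if (j <= n)%N then rvar (Xw s (thetaVn s j w)) (g j) else 0); split.
- by move=> j; case: ifP => // jn; exact: varle_ge0 (gB j jn).
- rewrite leqnn; apply: rvar_le; apply: eq_varle HV => x _.
  by rewrite /g subnn /Ltn /rhon big_ord0 invr1 mul1r.
- by have := gB 0%N (leq0n _); rewrite /g subn0.
move=> q j delta q1 jqn delta0 Hd; rewrite jqn (leq_trans (leq_addr q j) jqn).
set w' := thetaVn s (j + q) w.
have Z0 := Zg_neq0 hbase hmap hpot hhole hpart (Hc (j + q)%N) q1.
have := lasota_yorke_normalized hbase hmap hpot hhole hF hpart q1 Z0 delta0 Hd (gB _ jqn).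
have E1 : thetan s q w' = thetaVn s j w by rewrite /w' addnC thetan_thetaVn.
have E2 : Ltn s w' q (g (j + q)%N) = g j.
  by rewrite /g /w' -(fib _ jqn) (Ltn_add hmap hpart); congr (Ltn s wn _ f); lia.
rewrite E1 E2 => /rvar_le H; apply: (le_trans H); rewrite lerD2l.
apply: ler_wpM2l.
  by rewrite divr_ge0 ?(ltW delta0) // ltW // (Cst_gt0 hbase hmap hpot hhole hF hpart).
(* The intermediate functional term is at most F of the same iterate of |f|, and [Fw_Ltn] carries
   that to the fiber over w. *)
set h := Ltn s wn (n - (j + q)) (fun x => `|f x|).
have nh : nonneg_bounded s w' h.
  by have := nonneg_bounded_Ltn hmap hpot hF hpart (n - (j + q)) nf; rewrite fib.
have ng : nonneg_bounded s w' (fun x => `|g (j + q)%N x|).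
  by split=> //; have [M' HM'] := varle_bounded (gB _ jqn); exists M'.
apply: (@le_trans _ _ (Fw s w' h)).
  apply: Fw_le => // x Xx; apply: norm_Ltn_le; by rewrite fib.
have := Fw_Ltn hbase hmap hpot hhole hF hpart (j + q) nh.
have -> : thetan s (j + q) w' = w by exact: (thetaVnK hbase).
have -> // : Ltn s w' (j + q) h = Ltn s wn n (fun x => `|f x|).
by rewrite /h /w' -(fib _ jqn) (Ltn_add hmap hpart) subnKC.
Qed.

End transfer_operator_bounds.

Theorem proposition3p3 (R : realType) (d : measure_display)
    (Omega : measurableType d) (P : probability Omega R)
    (s : open_system R Omega) (nu : R.-pker Omega ~> R)
    (a b : R) (U Ut : Omega -> nat -> set (set R)) (Nc : nat)
    (hbase : base_assumptions P s)
    (hmap : map_assumptions s)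
    (hpot : potential_assumptions P s)
    (hcontr : closed_contracting P s)
    (hnu : closed_conformal P s nu)
    (hhole : hole_assumptions P s nu)
    (hF : functional_assumptions P s)
    (hpart : partition_assumptions P s a b U Ut)
    (hopen : open_contracting P s Ut)
    (hNc : is_Nc P s a b Ut Nc) :
  forall eps : R, 0 < eps ->
  exists C : Omega -> R,
    [/\ measurable_fun [set: Omega] C,
        forall w, 0 < C w &
        {ae P, forall w, forall n : nat, (1 <= n)%N ->
           forall f : R -> R, BV (Xw s (thetaVn s n w)) f ->
           (var (Xw s w) (Ltn s (thetaVn s n w) n f) <=
            (C w * expR (- ((xi P s a b Ut Nc - eps) * n%:R)))%:E
              * var (Xw s (thetaVn s n w)) f
            + (C w * Fw s w (Ltn s (thetaVn s n w) n (fun x => `|f x|)))%:E)%E}].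
Proof.
have N1 : (1 <= Nc)%N by case: hNc.
have [_ [IC /andP[intC_gt intC_lt]] _] := hNc.
have Cst0 n w : (1 <= n)%N -> 0 < Cst s a b Ut w n.
  exact: (Cst_gt0 hbase hmap hpot hhole hF hpart).
pose lnC w := ln (Cst s a b Ut w Nc).
have lnCE : (fun w => lne (Cst s a b Ut w Nc)%:E) = EFin \o lnC.
  by apply/funext => w; rewrite lne_EFin // Cst0.
have IlnC : P.-integrable setT (EFin \o lnC) by rewrite -lnCE.
set X := xi P s a b Ut Nc.
have NR : 0 < Nc%:R :> R by rewrite ltr0n.
have finC : int_log_Cst P s a b Ut Nc \is a fin_num.
  by rewrite fin_numE gt_eqF // lt_eqF // (lt_trans intC_lt) // ltry.
have intC : (\int[P]_w (lnC w)%:E)%E = (- (Nc%:R * X))%:E.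
  have -> : (\int[P]_w (lnC w)%:E)%E = int_log_Cst P s a b Ut Nc.
    by rewrite /int_log_Cst lnCE.
  rewrite -[LHS]fineK // /X /xi; congr EFin.
  by rewrite mulNr mulrN opprK mulrA divff ?mul1r // gt_eqF.
have X0 : 0 < X.
  have : ((- (Nc%:R * X))%:E < 0)%E.
    by rewrite -intC; move: intC_lt; rewrite /int_log_Cst lnCE.
  by rewrite lte_fin oppr_lt0 pmulr_rgt0.
move=> eps eps0.
(* The largest e allowed by both conditions of [recursion_bound]. *)
pose e := Num.min X eps / (Nc%:R + 2).
have N2 : 0 < Nc%:R + 2 :> R by lra.
have e0 : 0 < e by rewrite /e divr_gt0 // lt_min X0 eps0.
have eE : (Nc%:R + 2) * e = Num.min X eps by rewrite /e mulrC divfK // gt_eqF.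
have eX : (Nc%:R + 2) * e <= X by rewrite eE ge_min lexx.
have eeps : (Nc%:R + 2) * e <= eps by rewrite eE ge_min lexx orbT.
have [d1 [d10 Id1 Hd1]] := part_delta hpart (leqnn 1).
have [dN [dN0 IdN HdN]] := part_delta hpart N1.
(* One integrable majorant for the logarithms of all coefficients in the one-step and block
   inequalities, so that a single [K] serves them all. *)
pose H w := `|ln (rho s w)| + `|ln (3 * a + 6 * b + 1)| +
        `|ln (Defs.eta s (Ut w 1%N) w 1)| + `|ln (fine (S1 s w))| + `|ln (d1 w)|
        + `|lnC w| + `|ln (dN w)|.
have IH : P.-integrable setT (EFin \o H).
  have Iabs (f : Omega -> R) : P.-integrable setT (EFin \o f) ->
    P.-integrable setT (EFin \o (fun w => `|f w|)) by move=> If; exact: (integrable_abse If).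
  have Iadd (f g : Omega -> R) : P.-integrable setT (EFin \o f) -> P.-integrable setT (EFin \o g) ->
    P.-integrable setT (EFin \o (fun w => f w + g w)) by move=> If Ig; exact: (integrableD measurableT If Ig).
  rewrite /H; apply: (Iadd); last exact: (Iabs (fun w => ln (dN w))).
  apply: (Iadd); last exact: (Iabs lnC).
  apply: (Iadd); last exact: (Iabs (fun w => ln (d1 w))).
  apply: (Iadd); last first.
    apply: (Iabs (fun w => ln (fine (S1 s w)))).
    rewrite (_ : _ \o _ = (fun w => lne (S1 s w))); first exact: pot_log_S1 hpot.
    by apply/funext => w /=; have [-> h] := S1_fin hmap hpot w; rewrite lne_EFin.
  apply: (Iadd); last exact: (Iabs (fun w => ln (Defs.eta s (Ut w 1%N) w 1)) (part_eta hpart (leqnn 1))).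
  apply: (Iadd); last exact: finite_measure_integrable_cst.
  apply: (Iabs (fun w => ln (rho s w))).
  rewrite (_ : _ \o _ = (fun w => lne (rho s w)%:E)); first exact: rho_log hF.
  by apply/funext => w; rewrite lne_EFin // (rho_gt0 hF).
have [K mK HK] := tempered hbase e0 IH.
(* Its mean is -Nc e, hence negative. *)
pose h w := lnC w + Nc%:R * (X - e).
have Ic : P.-integrable setT (EFin \o cst (Nc%:R * (X - e))).
  exact: finite_measure_integrable_cst.
have Ih : P.-integrable setT (EFin \o h) by exact: (integrableD measurableT IlnC Ic).
have h0 : (\int[P]_w (h w)%:E < 0)%E.
  rewrite (integralD measurableT IlnC Ic) intC.
  rewrite [X in (_ + X)%E](integral_cst_probability P).
  rewrite -EFinD lte_fin.
  have -> : - (Nc%:R * X) + Nc%:R * (X - e) = - (Nc%:R * e) by ring.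
  by rewrite oppr_lt0 mulr_gt0.
have [m mm Hm] := bounded_sums hbase N1 Ih h0.
pose C1 i j := s2val (cid2 (recursion_bound i j N1 e0 eX eeps)).
(* The constant of a block sits at its starting fiber, Nc steps behind its end; hence [m] is
   evaluated at theta^{-Nc} w, and the residue class is taken there too. *)
exists (fun w => C1 (m (thetaVn s Nc w)) (K w)); split.
- apply: (measurable_fun_nat2 (m1 := m \o thetaVn s Nc)) => // k.
  rewrite comp_preimage -[X in measurable X]setTI.
  exact: (measurable_thetaVn hbase).
- by move=> w; rewrite /C1; case: cid2.
have := ae_thetaVn hbase Hm.
have : {ae P, forall w, contracting_at s Ut w} := hopen.
move=> /(ae_thetaVn hbase); move: HK; apply: filterS3 => w HK Hcon Hm' n n1 f [_ fV].
set wn := thetaVn s n w.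
have [V VE] : exists V : R, var (Xw s wn) f = V%:E.
  have := var_ge0 (Xw s wn) f; move: fV; rewrite -/wn.
  by case: (var _ _) => // V _ _; exists V.
have HV : varle (Xw s wn) f V by apply/var_leP; rewrite VE.
have [v [v0 vn v00 vstep]] := backward_steps hbase hmap hpot hhole hF hpart Hcon HV.
set Phi := Fw s w _ in vstep *.
have [M HM] := varle_bounded HV.
have Phi0 : 0 <= Phi.
  have nf : nonneg_bounded s wn (fun x => `|f x|) by split=> [x _|]; [exact: normr_ge0|exists M].
  apply: (Fw_ge0 hbase hmap hhole hpart).
  have := nonneg_bounded_Ltn hmap hpot hF hpart n nf.
  by rewrite /wn (thetaVnK hbase).
have [r rN Hr] := Hm' Nc.
have C0 : 0 < C1 (m (thetaVn s Nc w)) (K w) by rewrite /C1; case: cid2.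
have HC := s2valP' (cid2 (recursion_bound (m (thetaVn s Nc w)) (K w) N1 e0 eX eeps)).
rewrite -/(C1 _ _) in HC.
set C := C1 _ _ in C0 HC *.
have le_exp (y : R) : 0 < y -> y <= expR `|ln y|.
  by move=> y0; rewrite -[leLHS]lnK ?posrE // ler_expR ler_norm.
have expH j : expR (H (thetaVn s j w)) <= expR ((K w)%:R + e * j%:R).
  by rewrite ler_expR; apply: le_trans (HK j); exact: ler_norm.
have Cst1 w' : Cst s a b Ut w' 1 <= expR (H w').
  apply: (le_trans (Cst1_le hmap hpot hF hpart w')); rewrite ler_expR /H.
  have := normr_ge0 (ln (d1 w')); have := normr_ge0 (lnC w'); have := normr_ge0 (ln (dN w')); lra.
have Cst1d w' : Cst s a b Ut w' 1 / d1 w' <= expR (H w').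
  have h1 : (d1 w')^-1 <= expR `|ln (d1 w')|.
    by have := le_exp (d1 w')^-1; rewrite invr_gt0 lnV ?posrE // normrN; apply.
  apply: (le_trans (ler_pM _ _ (Cst1_le hmap hpot hF hpart w') h1)).
  - by rewrite ltW // Cst0.
  - by rewrite invr_ge0 ltW.
  - rewrite -expRD ler_expR /H.
    have := normr_ge0 (lnC w'); have := normr_ge0 (ln (dN w')); lra.
have CstN w' : Cst s a b Ut w' Nc / dN w' <= expR (H w').
  have h1 : (dN w')^-1 <= expR `|ln (dN w')|.
    by have := le_exp (dN w')^-1; rewrite invr_gt0 lnV ?posrE // normrN; apply.
  have h2 := le_exp _ (Cst0 Nc w' N1).
  apply: (le_trans (ler_pM _ _ h2 h1)).
  - by rewrite ltW // Cst0.
  - by rewrite invr_ge0 ltW.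
  - by rewrite -expRD ler_expR /H lerD2r lerDr !addr_ge0.
have main : v 0%N <= C * expR (- ((X - eps) * n%:R)) * v n + C * Phi.
  (* For single steps one coefficient bounds both the variation and the functional term, hence the
     maximum; for blocks they stay separate, as the first must be exactly C. *)
  apply: (HC v (fun j => lnC (thetaVn s j w))
    (fun j => Num.max (Cst s a b Ut (thetaVn s j w) 1) (Cst s a b Ut (thetaVn s j w) 1 / d1 (thetaVn s j w)))
    (fun j => Cst s a b Ut (thetaVn s j w) Nc / dN (thetaVn s j w)) n r) => //.
  - move=> j jn; have := vstep 1%N j (d1 (thetaVn s j.+1 w)) (leqnn 1); rewrite addn1.
    move=> /(_ jn (d10 _) (Hd1 _)) le1; apply: (le_trans le1); rewrite mulrDr.
    by apply: lerD; rewrite ler_wpM2r // le_max lexx ?orbT.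
  - move=> j jn; rewrite /lnC lnK ?posrE ?Cst0 //.
    exact: (vstep Nc j _ N1 jn (dN0 _) (HdN _)).
  - move=> j; rewrite ge_max; apply/andP; split; exact: le_trans (expH j).
  - move=> j; exact: le_trans (expH j).
  - move=> k; have := Hr k; rewrite /h big_split /= sumr_const card_ord -[_ *+ k]mulr_natr.
    under eq_bigr => i _ do rewrite /thetaVn -iterD -/(thetaVn s _ w).
    move=> le1.
    rewrite (eq_bigr (fun i : 'I_k => lnC (thetaVn s (r + i * Nc + Nc) w))); last first.
      by move=> i _; rewrite mulSn addnCA addnC.
    rewrite natrM; lra.
rewrite VE -EFinM -EFinD; apply/var_leP; apply: varle_le v00 _.
apply: (le_trans main); rewrite lerD2r; apply: ler_wpM2l => //.
by apply: mulr_ge0; [exact: ltW|exact: expR_ge0].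
Qed.
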